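(* Let $(\mathfrak m,[g])$ be a conformal pseudo-subriemannian FGLA of semisimple type, and let $\mathfrak g=\bigoplus_{p\in\mathbb Z}\mathfrak g_p$ be the prolongation of $(\mathfrak m,[g])$. Let $\hat{\mathfrak g}_0=\{A\in\mathfrak g_0:\operatorname{ad}(A)|_{\mathfrak g_{-1}}\in\mathfrak{so}(\mathfrak g_{-1},g)\}$. (1) If the $\mathfrak g_0$-module $\mathfrak g_{-1}$ is irreducible and the $\mathfrak g_0(\mathbb C)$-module $\mathfrak g_{-1}(\mathbb C)$ is reducible, there exist $\mathfrak g_0(\mathbb C)$-submodules $\mathfrak g_{-1}(\mathbb C)^{(i)}$ $(i=1,2)$ such that (i) $\mathfrak g_{-1}(\mathbb C)=\mathfrak g_{-1}(\mathbb C)^{(1)}\oplus\mathfrak g_{-1}(\mathbb C)^{(2)}$; (ii) $\mathfrak g_{-1}(\mathbb C)^{(i)}$ $(i=1,2)$ are totally isotropic subspaces of $(\mathfrak g_{-1}(\mathbb C),g)$; (iii) $\mathfrak g_{-1}(\mathbb C)^{(1)}$ is contragredient to $\mathfrak g_{-1}(\mathbb C)^{(2)}$ as a $\hat{\mathfrak g}_0(\mathbb C)$-module. (2) If the $\mathfrak g_0$-module $\mathfrak g_{-1}$ is reducible, then there exist $\mathfrak g_0$-submodules $\mathfrak g_{-1}^{(i)}$ $(i=1,2)$ such that (i) $\mathfrak g_{-1}=\mathfrak g_{-1}^{(1)}\oplus\mathfrak g_{-1}^{(2)}$; (ii) $\mathfrak g_{-1}^{(i)}$ $(i=1,2)$ are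 totally isotropic subspaces of $(\mathfrak g_{-1},g)$; (iii) $\mathfrak g_{-1}^{(1)}$ is contragredient to $\mathfrak g_{-1}^{(2)}$ as a $\hat{\mathfrak g}_0$-module; (iv) the $\mathfrak g_0(\mathbb C)$-modules $\mathfrak g_{-1}^{(i)}(\mathbb C)$ are irreducible. (3) $\mathfrak g=\bigoplus_{p\in\mathbb Z}\mathfrak g_p$ is a simple graded Lie algebra of class (B); that is, $\mathfrak g$ is simple and its complexification $\mathfrak g(\mathbb C)=\bigoplus_{p\in\mathbb Z}\mathfrak g_p(\mathbb C)$ is a complex simple graded Lie algebra.
   Context: A graded Lie algebra (GLA) is a Lie algebra $\mathfrak g=\bigoplus_{p\in\mathbb Z}\mathfrak g_p$ with $[\mathfrak g_p,\mathfrak g_q]\subset\mathfrak g_{p+q}$. A fundamental graded Lie algebra (FGLA) is a finite dimensional GLA $\mathfrak m=\bigoplus_{p<0}\mathfrak g_p$ generated by its nonzero subspace $\mathfrak g_{-1}$. A conformal pseudo-subriemannian FGLA is a pair $(\mathfrak m,[g])$ where $\mathfrak m$ is an FGLA over $\mathbb R$ with $\mathfrak g_{-2}\ne\{0\}$ and $[g]$ is the class of a nondegenerate real symmetric bilinear form $g$ on $\mathfrak g_{-1}$ under $g\sim\eta g$, $\eta\in\mathbb R_{>0}$. For a real vector space $V$ with symmetric bilinear form $g$: $\mathfrak{so}(V,g)=\{A\in\mathfrak{gl}(V):g(Ax,y)+g(x,Ay)=0\}$ and $\mathfrak{co}(V,g)=\{A\in\mathfrak{gl}(V):g(Ax,y)+g(x,Ay)=\eta_Ag(x,y)\text{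 for some }\eta_A\in\mathbb R\}$. Let $\mathfrak g_0$ be the Lie algebra of all derivations $D$ of $\mathfrak m$ with $D(\mathfrak g_p)\subset\mathfrak g_p$ for all $p<0$ and $D|_{\mathfrak g_{-1}}\in\mathfrak{co}(\mathfrak g_{-1},g)$. The prolongation of $(\mathfrak m,[g])$ is the maximum GLA $\mathfrak g=\bigoplus_{p\in\mathbb Z}\mathfrak g_p$ whose part of degree $\le0$ is $\mathfrak m\oplus\mathfrak g_0$ and which is transitive, i.e. if $X\in\mathfrak g_p$, $p\ge0$, and $[X,\mathfrak g_{-1}]=\{0\}$ then $X=0$. $(\mathfrak m,[g])$ is of semisimple type if its prolongation is finite dimensional and semisimple. $V(\mathbb C)$ denotes the complexification of $V$; $g$ is extended complex-bilinearly to $\mathfrak g_{-1}(\mathbb C)$. A real simple GLA is either a complex simple GLA regarded as a real Lie algebra (class (A)), or a real form of a complex simple Lie algebra whose complexification, with the complexified gradation, is a complex simple GLA (class (B)). *)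

(* Defs.v *)
From HB Require Import structures.
From mathcomp Require Import all_boot all_order all_algebra.
From mathcomp Require Import boolp classical_sets reals.
From mathcomp.real_closed Require Import complex.

Set Implicit Arguments.
Unset Strict Implicit.
Unset Printing Implicit Defensive.

Import Order.TTheory GRing.Theory Num.Theory.
Local Open Scope ring_scope.
Local Open Scope complex_scope.

HB.mixin Record Lmodule_isLie (K : fieldType) L of GRing.Lmodule K L := {
  lie : L -> L -> L;
  lie_linearl : forall z : L, linear (lie^~ z);
  lie_linearr : forall z : L, linear (lie z);
  liexx : forall x, lie x x = 0;
  lie_jacobi : forall x y z,
    lie x (lie y z) + lie y (lie z x) + lie z (lie x y) = 0
}.

#[short(type="lieAlgType")]
HB.structure Definition LieAlgebra (K : fieldType) :=
  {L of Lmodule_isLie K L & GRing.Lmodule K L}.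

#[short(type="lieVectType")]
HB.structure Definition LieVector (K : fieldType) :=
  {L of Lmodule_isLie K L & Vector K L}.

Definition lie_derivation (K : fieldType) (L : lieVectType K) (D : 'End(L)) :=
  forall x y : L, D (lie x y) = lie (D x) y + lie x (D y).

Definition lie_ideal (K : fieldType) (L : lieVectType K) (I : {vspace L}) :=
  forall x y : L, y \in I -> lie x y \in I.

Definition lie_prodv (K : fieldType) (L : lieVectType K) (U V : {vspace L}) :
    {vspace L} :=
  <<[seq lie u v | u <- vbasis U, v <- vbasis V]>>%VS.

Definition lie_solvable (K : fieldType) (L : lieVectType K) (U : {vspace L}) :=
  exists n, iter n (fun V => lie_prodv V V) U = 0%VS.

(* Semisimplicity as the vanishing of the radical. *)
Definition lie_semisimple (K : fieldType) (L : lieVectType K) :=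
  forall I : {vspace L}, lie_ideal I -> lie_solvable I -> I = 0%VS.

Definition lie_simple (K : fieldType) (L : lieVectType K) :=
  (exists x y : L, lie x y <> 0) /\
  (forall I : {vspace L}, lie_ideal I -> I = 0%VS \/ I = fullv).

(* L is allowed to be infinite-dimensional: it is the direct sum of the gr p
   in the sense of finite sums. *)
Record graded_lie (K : fieldType) (L : lieAlgType K) (gr : int -> {pred L}) :
    Prop := {
  graded_submod : forall p, submod_closed (gr p);
  graded_span : forall x, exists (s : seq int) (f : int -> L),
    (forall p, f p \in gr p) /\ x = \sum_(p <- s) f p;
  graded_direct : forall (s : seq int) (f : int -> L), uniq s ->
    (forall p, f p \in gr p) -> \sum_(p <- s) f p = 0 ->
    forall p, p \in s -> f p = 0;
  graded_lieP : forall p q x y,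
    x \in gr p -> y \in gr q -> lie x y \in gr (p + q)
}.

Definition transitive_gla (K : fieldType) (L : lieAlgType K)
    (gr : int -> {pred L}) :=
  forall (p : int) (X : L), 0 <= p -> X \in gr p ->
    (forall y, y \in gr (-1) -> lie X y = 0) -> X = 0.

Definition simple_gla (K : fieldType) (L : lieVectType K)
    (gr : int -> {vspace L}) :=
  graded_lie (fun p => gr p) /\ lie_simple L.

Record fundamental_gla (K : fieldType) (m : lieVectType K)
    (gr : int -> {vspace m}) : Prop := {
  fgla_graded : graded_lie (fun p => gr p);
  fgla_neg : forall p, 0 <= p -> gr p = 0%VS;
  fgla_neq0 : gr (-1) <> 0%VS;
  fgla_gen : forall U : {vspace m}, (gr (-1) <= U)%VS ->
    (forall x y, x \in U -> y \in U -> lie x y \in U) -> U = fullv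
}.

(* A form on the subspace U of V is extended to V by means of a projection on
   U; only its values on U are ever used. *)
Definition ext_form (K : fieldType) (V : vectType K) (U : {vspace V})
    (B : subvs_of U -> subvs_of U -> K) (x y : V) : K :=
  B (vsproj U x) (vsproj U y).

Definition so_on (K : fieldType) (V : vectType K) (U : {vspace V})
    (b : V -> V -> K) (A : V -> V) :=
  forall x y, x \in U -> y \in U -> b (A x) y + b x (A y) = 0.

Definition co_on (K : fieldType) (V : vectType K) (U : {vspace V})
    (b : V -> V -> K) (A : V -> V) :=
  exists eta : K, forall x y, x \in U -> y \in U ->
    b (A x) y + b x (A y) = eta * b x y.

Definition totally_isotropic (K : fieldType) (V : vectType K) (b : V -> V -> K)
    (U : {vspace V}) :=
  forall x y, x \in U -> y \in U -> b x y = 0.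

(* The class [g] is given by a representative B. *)
Record conformal_fgla (R : realType) (m : lieVectType R)
    (gr : int -> {vspace m}) (B : {biscalar (subvs_of (gr (-1)))}) : Prop := {
  cfgla_fgla : fundamental_gla gr;
  cfgla_neq0 : gr (-2) <> 0%VS;
  cfgla_sym : forall x y, B x y = B y x;
  cfgla_nondeg : forall x, (forall y, B x y = 0) -> x = 0
}.

(* The Lie algebra g_0 of m and [B], inside gl(m). *)
Record conf_derivation (R : realType) (m : lieVectType R)
    (gr : int -> {vspace m}) (B : {biscalar (subvs_of (gr (-1)))})
    (D : 'End(m)) : Prop := {
  cder_derivation : lie_derivation D;
  cder_degree : forall p : int, p < 0 -> forall x, x \in gr p -> D x \in gr p;
  cder_co : co_on (gr (-1)) (ext_form B) D
}.

(* The part of degree <= 0 of h is the semidirect product of m and g_0: iota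
   embeds m, and tau, of which only the restriction to g_0 matters, embeds
   g_0. *)
Record nonpos_part (R : realType) (m : lieVectType R) (gr : int -> {vspace m})
    (B : {biscalar (subvs_of (gr (-1)))})
    (h : lieAlgType R) (hgr : int -> {pred h})
    (iota : {linear m -> h}) (tau : {linear 'End(m) -> h}) : Prop := {
  nonpos_iota_inj : injective iota;
  nonpos_tau_inj : forall D, conf_derivation B D -> tau D = 0 -> D = 0;
  nonpos_neg : forall p : int, p < 0 ->
    forall y, y \in hgr p <-> exists2 x, x \in gr p & y = iota x;
  nonpos_zero : forall y,
    y \in hgr 0 <-> exists2 D, conf_derivation B D & y = tau D;
  nonpos_lie_neg : forall x y, iota (lie x y) = lie (iota x) (iota y);
  nonpos_lie_zero_neg : forall D x, conf_derivation B D ->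
    lie (tau D) (iota x) = iota (D x);
  nonpos_lie_zero : forall D E, conf_derivation B D -> conf_derivation B E ->
    lie (tau D) (tau E) = tau ((D \o E)%VF - (E \o D)%VF)
}.

(* Maximality is expressed by embedding in g every transitive graded Lie
   algebra h, of any dimension, with the same part of degree <= 0. *)
Record is_prolongation (R : realType) (m : lieVectType R)
    (gr : int -> {vspace m}) (B : {biscalar (subvs_of (gr (-1)))})
    (g : lieAlgType R) (ggr : int -> {pred g})
    (iota : {linear m -> g}) (tau : {linear 'End(m) -> g}) : Prop := {
  prol_graded : graded_lie ggr;
  prol_transitive : transitive_gla ggr;
  prol_nonpos : nonpos_part B ggr iota tau;
  prol_max : forall (h : lieAlgType R) (hgr : int -> {pred h})
      (iotah : {linear m -> h}) (tauh : {linear 'End(m) -> h}),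
    graded_lie hgr -> transitive_gla hgr -> nonpos_part B hgr iotah tauh ->
    exists f : {linear h -> g},
      [/\ injective f,
          forall x y, f (lie x y) = lie (f x) (f y),
          forall p x, x \in hgr p -> f x \in ggr p,
          forall x, f (iotah x) = iota x
        & forall D, conf_derivation B D -> f (tauh D) = tau D]
}.

(* g_{-1} being identified with its image under iota, the form B on
   iota(g_{-1}), extended to g. *)
Definition transport_form (R : realType) (m g : lieVectType R)
    (U : {vspace m}) (B : subvs_of U -> subvs_of U -> R) (iota : 'Hom(m, g))
    (x y : g) : R :=
  ext_form B ((iota^-1)%VF x) ((iota^-1)%VF y).

(* Below, the elements of a part Q of the Lie algebra L act on subspaces W of L
   by the bracket; submodules of W are Q-stable subspaces of W. *)

Definition res_act (K : fieldType) (L : lieVectType K) (W : {vspace L}) (A : L)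
    (u : subvs_of W) : subvs_of W :=
  vsproj W (lie A (vsval u)).

Definition submodule (K : fieldType) (L : lieVectType K) (Q : set L)
    (W U : {vspace L}) :=
  (U <= W)%VS /\ forall A x, Q A -> x \in U -> lie A x \in U.

Definition irreducible_module (K : fieldType) (L : lieVectType K) (Q : set L)
    (W : {vspace L}) :=
  W <> 0%VS /\ forall U, submodule Q W U -> U = 0%VS \/ U = W.

(* W1 is isomorphic to the dual of W2, on which A acts by
   (A . f) y = - f (A . y). *)
Definition contragredient (K : fieldType) (L : lieVectType K) (Q : set L)
    (W1 W2 : {vspace L}) :=
  exists phi : 'Hom(subvs_of W1, 'Hom(subvs_of W2, K^o)),
    bijective phi /\
    forall A, Q A -> forall x y,
      phi (res_act A x) y = - phi x (res_act A y).

(* The complexification of V: the pair (x, y) stands for x + i y. *)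

Definition cplx (R : rcfType) (V : lmodType R) : Type := (V * V)%type.

HB.instance Definition _ (R : rcfType) (V : lmodType R) :=
  GRing.Zmodule.copy (cplx V) (V * V)%type.

Definition cplx_scale (R : rcfType) (V : lmodType R) (a : R[i]) (z : cplx V) :
    cplx V :=
  (complex.Re a *: z.1 - complex.Im a *: z.2, complex.Re a *: z.2 + complex.Im a *: z.1).

Fact cplx_scaleA (R : rcfType) (V : lmodType R) (a b : R[i]) (z : cplx V) :
  cplx_scale a (cplx_scale b z) = cplx_scale (a * b) z.
Proof.
case: a b z => [a a'] [b b'] [x y]; rewrite /cplx_scale /=; congr pair.
  rewrite !scalerBr !scalerDr !scalerA scalerBl scalerDl !opprD !addrA addrAC.
  by congr (_ + _); rewrite addrAC.
rewrite !scalerBr !scalerDr !scalerA scalerBl scalerDl !addrA addrAC.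
by congr (_ + _); rewrite addrAC.
Qed.

Fact cplx_scale1 (R : rcfType) (V : lmodType R) :
  left_id 1 (@cplx_scale R V).
Proof.
by case=> x y; rewrite /cplx_scale /= !scale1r !scale0r subr0 addr0.
Qed.

Fact cplx_scaleDr (R : rcfType) (V : lmodType R) :
  right_distributive (@cplx_scale R V) +%R.
Proof.
case=> a b [x y] [x' y']; rewrite /cplx_scale /=; congr pair => /=.
  by rewrite !scalerDr opprD addrACA.
by rewrite !scalerDr addrACA.
Qed.

Fact cplx_scaleDl (R : rcfType) (V : lmodType R) (z : cplx V) :
  {morph (@cplx_scale R V)^~ z : a b / a + b}.
Proof.
case: z => x y [a a'] [b b']; rewrite /cplx_scale /=; congr pair => /=.
  by rewrite !scalerDl opprD addrACA.
by rewrite !scalerDl addrACA.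
Qed.

HB.instance Definition _ (R : rcfType) (V : lmodType R) :=
  GRing.Zmodule_isLmodule.Build R[i] (cplx V) (@cplx_scaleA R V)
    (@cplx_scale1 R V) (@cplx_scaleDr R V) (@cplx_scaleDl R V).

Lemma cplx_scaleE (R : rcfType) (V : lmodType R) (a : R[i]) (z : cplx V) :
  a *: z = (complex.Re a *: z.1 - complex.Im a *: z.2,
            complex.Re a *: z.2 + complex.Im a *: z.1).
Proof. by []. Qed.

Lemma cplx_addE (R : rcfType) (V : lmodType R) (z w : cplx V) :
  z + w = (z.1 + w.1, z.2 + w.2).
Proof. by []. Qed.

Import VectorInternalTheory.

Fact cplx_vect_iso (R : rcfType) (V : vectType R) :
  Vector.axiom (dim V) (cplx V).
Proof.
pose f (z : cplx V) : 'rV[R[i]]_(dim V) :=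
  \row_j ((v2r (z.1 : V)) 0 j +i* (v2r (z.2 : V)) 0 j).
pose k (u : 'rV[R[i]]_(dim V)) : cplx V :=
  (r2v (\row_j complex.Re (u 0 j)), r2v (\row_j complex.Im (u 0 j))).
exists f; last first.
  exists k => [[x y]|u]; rewrite /f /k /=.
    by congr pair; apply: (can_inj v2rK); rewrite r2vK; apply/rowP=> j;
      rewrite !mxE.
  by apply/rowP=> j; rewrite !mxE !r2vK !mxE; case: (u 0 j).
move=> [a b] [x y] [x' y']; apply/rowP=> j.
rewrite /f !mxE cplx_scaleE cplx_addE /= !linearD !linearN !linearZ /= !mxE.
by rewrite mulrN.
Qed.

HB.instance Definition _ (R : rcfType) (V : vectType R) :=
  Lmodule_hasFinDim.Build R[i] (cplx V) (@cplx_vect_iso R V).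

Definition cplx_lie (R : rcfType) (L : lieAlgType R) (z w : cplx L) : cplx L :=
  (lie z.1 w.1 - lie z.2 w.2, lie z.1 w.2 + lie z.2 w.1).

Section LieTheory.
Variables (K : fieldType) (L : lieAlgType K).
Implicit Types x y z : L.

HB.instance Definition _ x :=
  GRing.isLinear.Build K L L _ (lie x) (lie_linearr x).

Lemma lieDl x y z : lie (x + y) z = lie x z + lie y z.
Proof. by have := lie_linearl z 1 x y; rewrite /= !scale1r. Qed.

Lemma lieZl a x z : lie (a *: x) z = a *: lie x z.
Proof.
have lie0 : lie 0 z = 0 by apply: (addrI (lie 0 z)); rewrite -lieDl !addr0.
by have := lie_linearl z a x 0; rewrite /= !addr0 lie0 addr0.
Qed.

Lemma lieNl x z : lie (- x) z = - lie x z.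
Proof. by rewrite -scaleN1r lieZl scaleN1r. Qed.

Lemma lieC x y : lie x y = - lie y x.
Proof.
apply/eqP; rewrite -addr_eq0; have := liexx (x + y).
by rewrite lieDl !linearD /= !liexx add0r addr0 => ->.
Qed.

End LieTheory.

Fact cplx_lie_linearr (R : rcfType) (L : lieAlgType R) (z : cplx L) :
  linear (@cplx_lie R L z).
Proof.
case: z => [u v] [a b] [x y] [x' y'].
rewrite /cplx_lie !cplx_scaleE !cplx_addE /= !linearD !linearN !linearZ /=.
congr pair.
  by rewrite addrACA [X in X + _ = _]addrACA.
by rewrite addrACA [X in X + _ = _]addrACA.
Qed.

Fact cplx_lie_linearl (R : rcfType) (L : lieAlgType R) (z : cplx L) :
  linear ((@cplx_lie R L)^~ z).
Proof.
move=> a x y; have cplx_lieC t w : @cplx_lie R L t w = - cplx_lie w t.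
  rewrite /cplx_lie; congr pair => /=.
    by rewrite [lie t.1 _]lieC [lie t.2 _]lieC opprB opprK addrC.
  by rewrite [lie t.1 _]lieC [lie t.2 _]lieC opprD addrC.
by rewrite cplx_lieC cplx_lie_linearr opprD -scalerN -!cplx_lieC.
Qed.

Fact cplx_liexx (R : rcfType) (L : lieAlgType R) (z : cplx L) :
  cplx_lie z z = 0.
Proof. by rewrite /cplx_lie !liexx subr0 [X in (_, X + _)]lieC addNr. Qed.

Fact cplx_lie_jacobi (R : rcfType) (L : lieAlgType R) (z w t : cplx L) :
  cplx_lie z (cplx_lie w t) + cplx_lie w (cplx_lie t z)
    + cplx_lie t (cplx_lie z w) = 0.
Proof.
have J1 (a1 b1 c1 d1 a2 b2 c2 d2 a3 b3 c3 d3 : L) :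
    a1 + a2 + a3 = 0 -> b1 + d2 + c3 = 0 -> c1 + b2 + d3 = 0 ->
    d1 + c2 + b3 = 0 ->
  a1 - b1 + (- c1 - d1) + (a2 - b2 + (- c2 - d2))
    + (a3 - b3 + (- c3 - d3)) = 0.
  move=> ha hb hc hd; transitivity ((a1 + a2 + a3) - (b1 + d2 + c3)
    - (c1 + b2 + d3) - (d1 + c2 + b3)); last by rewrite ha hb hc hd !subr0.
  rewrite !opprD !addrA.
  by rewrite [LHS](ACl (1*5*9*2*8*11*3*6*12*4*7*10)).
have J2 (a1 b1 c1 d1 a2 b2 c2 d2 a3 b3 c3 d3 : L) :
    a1 + b2 + c3 = 0 -> b1 + c2 + a3 = 0 -> c1 + a2 + b3 = 0 ->
    d1 + d2 + d3 = 0 ->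
  a1 + b1 + (c1 - d1) + (a2 + b2 + (c2 - d2)) + (a3 + b3 + (c3 - d3)) = 0.
  move=> ha hb hc hd; transitivity ((a1 + b2 + c3) + (b1 + c2 + a3)
    + (c1 + a2 + b3) - (d1 + d2 + d3)); last by rewrite ha hb hc hd !addr0 subr0.
  rewrite !opprD !addrA.
  by rewrite [LHS](ACl (1*6*11*2*7*9*3*5*10*4*8*12)).
case: z w t => [x y] [x' y'] [x'' y'']; rewrite /cplx_lie !cplx_addE /=.
congr pair; rewrite !linearB !linearD /=.
  by apply: J1; apply: lie_jacobi.
by apply: J2; apply: lie_jacobi.
Qed.

HB.instance Definition _ (R : rcfType) (L : lieAlgType R) :=
  Lmodule_isLie.Build R[i] (cplx L) (@cplx_lie_linearl R L)
    (@cplx_lie_linearr R L) (@cplx_liexx R L) (@cplx_lie_jacobi R L).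

HB.instance Definition _ (R : rcfType) (L : lieVectType R) :=
  LieAlgebra.on (cplx L).

Definition cplx_in (R : rcfType) (V : lmodType R) (x : V) : cplx V := (x, 0).

Definition cplxv (R : rcfType) (V : vectType R) (U : {vspace V}) :
    {vspace cplx V} :=
  <<[seq cplx_in x | x <- vbasis U]>>%VS.

Lemma memv_cplx (R : rcfType) (V : vectType R) (U : {vspace V}) (z : cplx V) :
  (z \in cplxv U) = (z.1 \in U) && (z.2 \in U).
Proof.
apply/idP/idP => [|/andP[z1U z2U]].
  rewrite /cplxv => /coord_span ->; set s := map_tuple _ _.
  elim/big_ind: _ => [|u v /andP[u1 u2] /andP[v1 v2]|i _].
  - by rewrite !mem0v.
  - by rewrite cplx_addE /= !memvD.
  - have /mapP[x /vbasis_mem xU ->] : s`_i \in s.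
      by rewrite mem_nth ?size_tuple.
    by rewrite cplx_scaleE /= !scaler0 subr0 add0r !memvZ.
have inU x : x \in U -> cplx_in x \in cplxv U.
  move=> /coord_vbasis {1}->.
  rewrite (_ : cplx_in _ =
    \sum_i (coord (vbasis U) i x)%:C *: cplx_in (vbasis U)`_i).
    apply: memv_suml => i _; apply/memvZ/memv_span/map_f.
    by rewrite mem_nth ?size_tuple.
  elim/big_ind2: _ => // [u u' v v' <- <-|i _].
    by rewrite cplx_addE /cplx_in /= addr0.
  by rewrite cplx_scaleE /cplx_in /= !scaler0 scale0r subr0 add0r.
rewrite (_ : z = cplx_in z.1 + 'i *: cplx_in z.2) ?memvD ?memvZ ?inU //.
rewrite cplx_scaleE cplx_addE /= scale0r !scaler0 scale1r subr0 !add0r addr0.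
by case: (z).
Qed.

Definition cplx_set (R : rcfType) (V : lmodType R) (Q : set V) : set (cplx V) :=
  [set z | Q z.1 /\ Q z.2]%classic.

Definition cplx_form (R : rcfType) (V : lmodType R) (b : V -> V -> R)
    (z w : cplx V) : R[i] :=
  (b z.1 w.1 - b z.2 w.2) +i* (b z.1 w.2 + b z.2 w.1).

(* Main.v *)
Require Import Defs.
From HB Require Import structures.
From mathcomp Require Import all_boot all_order all_algebra.
From mathcomp Require Import boolp classical_sets reals.
From mathcomp Require Import ring.
From mathcomp.real_closed Require Import complex.

(** Write [kf] for the Killing form.  Nearly everything takes place over an
algebraically closed field with a conjugation, for a graded transitive
semisimple Lie algebra L whose part of degree 0 acts on L_{-1} by conformal maps
of a nondegenerate symmetric form; the theorem follows by applying this to the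
complexification of g and descending along conjugation.

The derivation of m that multiplies by p in degree p is conformal, so it lies
in g_0 and gives a characteristic element E ([characteristic_element]); ideals
are therefore graded.  The Killing form is nondegenerate
([kf_nondegenerate], Cartan's criterion, through Engel's theorem), and it pairs
L_p with L_{-p}.

Conjugated derivations.  If ad z has generalized eigenspaces L_a, the map equal
to the conjugate of a on each L_a is a derivation D, and it is a polynomial in
ad z.  The trace of D o ad z is the sum of the |a|^2, whereas the trace of
D o ad [x, y] is kf (D x) y.  This gives Cartan's criterion, and it also shows
that some elements have real spectrum ([real_spectrum_of_conjugate]).

The structure of L_{-1}.  For a nonzero L_0-submodule U of L_{-1} let z_U in L_0
represent the functional A |-> - tr (A | U) with respect to kf.  It is central
in L_0, has the form of a sum of brackets of U with L_1, has a real spectrum,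
and satisfies kf z_U z_U > 0.  If U is irreducible, z_U acts on U by a scalar
-a < 0.  The main step ([irreducible_trace_dual]) is that every other
eigenvalue of z_U on L_{-1} is nonnegative.  By duality, a further negative one
would give a vector of L_1 that is orthogonal to U and belongs to positive
eigenvalues; under the positive part of L_1 it generates a space on which z_U
has only positive eigenvalues, although z_U acts there as a sum of commutators
([annihilated_positive_eq0]).  In terms of roots, this says that distinct simple
roots form obtuse angles.

Now bring in the form.  The eigenvalues of z_U on L_{-1} are symmetric
under c |-> eta - c, where eta is the conformal factor of z_U.  If U is not
isotropic, this forces U = L_{-1}.  Otherwise U is paired with one irreducible
isotropic W.  If U + W had a nonzero orthogonal complement, the conformal
factors of z_U and z_W would be nonnegative, whence
kf (z_U + z_W) (z_U + z_W) <= 0, contrary to the reality of the spectrum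
([conformal_decomposition]).  So L_{-1} is irreducible or the direct sum of two
nonisomorphic irreducible isotropic submodules, and these are the only nonzero
proper submodules ([submodule_classification]).  The form then makes each
summand the dual of the other under the maps that preserve it
([contragredient_of_isotropic]).

Simplicity.  A nonzero proper ideal I and its Killing complement J would meet
L_{-1} in U and W.  An element of I_0 kills W, so by conformality it acts on U
as a scalar; hence L_0 acts on U by scalars and dim U = 1, and likewise
dim W = 1.  Then L_{-1} is abelian, contrary to g_{-2} <> 0 ([conformal_simple]).

Descent.  A reducible g_{-1} has a real submodule S whose complexification must
be one of U and W; the conjugate of the other summand is again a proper
submodule, so that summand is also defined over the reals
([conjugate_summand_real]). *)

Set Implicit Arguments.
Unset Strict Implicit.
Unset Printing Implicit Defensive.

Import Order.TTheory GRing.Theory Num.Theory.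
Local Open Scope ring_scope.

(** * Subspaces given by predicates, traces and polynomials of endomorphisms *)

Section Subspaces.

Variables (K : fieldType) (V : vectType K).

(** Take a subspace of maximal dimension all of whose elements satisfy P. This
turns every linear condition, decidable or not, into a [{vspace V}]. *)
Lemma vspace_of_pred (P : V -> Prop) :
    P 0 -> (forall a x y, P x -> P y -> P (a *: x + y)) ->
  exists U : {vspace V}, forall x, x \in U <-> P x.
Proof.
move=> P0 Plin.
pose p n := `[< exists2 U : {vspace V}, \dim U = n & forall x, x \in U -> P x >].
have exp : exists n, p n.
  exists 0%N; apply/asboolP; exists 0%VS => [|x]; first by rewrite dimv0.
  by rewrite memv0 => /eqP->.
have bp n : p n -> (n <= \dim {:V})%N.
  by move=> /asboolP[U <- _]; rewrite dimvS ?subvf.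
case: (ex_maxnP exp bp) => d /asboolP[U dU UP] dmax.
exists U => x; split=> [/UP//|Px].
have UxP y : y \in (U + <[x]>)%VS -> P y.
  move=> /memv_addP[u uU [_ /vlineP[a ->] ->]].
  by rewrite addrC; apply: Plin => //; apply: UP.
have /dmax: p (\dim (U + <[x]>)) by apply/asboolP; exists (U + <[x]>)%VS.
rewrite -dU => le; have /eqP-> : U == (U + <[x]>)%VS.
  by rewrite eqEdim addvSl.
by rewrite (subvP (addvSr _ _)) ?memv_line.
Qed.

Lemma coord_span_take n (X : n.-tuple V) (i : 'I_n) x :
  free X -> x \in <<take i X>>%VS -> coord X i x = 0.
Proof.
move=> fX xS; rewrite (coord_span (X := in_tuple (take i X)) xS).
rewrite linear_sum big1 // => j _; rewrite linearZ /=.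
have lt_ji : (j < i)%N.
  by rewrite (leq_trans (ltn_ord j)) // size_take size_tuple ltn_ord.
have lt_jn : (j < n)%N by apply: ltn_trans lt_ji _.
rewrite /= nth_take // (_ : nat_of_ord j = Ordinal lt_jn) // coord_free //.
rewrite (_ : (_ == _) = false) ?mulr0 //.
by apply/eqP => e; move: lt_ji; rewrite -{2}e /= ltnn.
Qed.

End Subspaces.

Section PolynomialAction.

Variables (K : fieldType) (V : vectType K) (T : 'End(V)).
Implicit Types p q : {poly K}.

(** The value p(T) of a polynomial at an endomorphism. As V may be zero, ['End(V)]
is not treated as a nontrivial ring. *)
Definition peval (p : {poly K}) : 'End(V) :=
  \sum_(i < size p) p`_i *: iter i (comp_lfun T) \1%VF.

Lemma peval_wide n p : (size p <= n)%N ->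
  peval p = \sum_(i < n) p`_i *: iter i (comp_lfun T) \1%VF.
Proof.
move=> le_pn; rewrite /peval.
rewrite (big_ord_widen _ (fun i => p`_i *: iter i (comp_lfun T) \1%VF) le_pn).
rewrite big_mkcond; apply: eq_bigr => i _; case: ltnP => // le.
by rewrite nth_default // scale0r.
Qed.

Lemma peval_linear : linear peval.
Proof.
move=> a p q; pose n := maxn (size (a *: p + q)) (maxn (size p) (size q)).
rewrite !(@peval_wide n) /n ?leq_max ?leqnn ?orbT //.
rewrite scaler_sumr -big_split /=; apply: eq_bigr => i _.
by rewrite coefD coefZ scalerDl scalerA.
Qed.

HB.instance Definition _ :=
  GRing.isLinear.Build K {poly K} 'End(V) _ peval peval_linear.

Lemma pevalMX p x : peval (p * 'X) x = T (peval p x).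
Proof.
rewrite (@peval_wide (size p).+1) ?(leq_trans (size_polyMleq _ _)) ?size_polyX ?addn2 //.
rewrite big_ord_recl coefMX /= scale0r add0r !sum_lfunE linear_sum.
apply: eq_bigr => i _; rewrite coefMX /= !scale_lfunE linearZ /=.
by rewrite comp_lfunE.
Qed.

Lemma pevalC c x : peval c%:P x = c *: x.
Proof.
rewrite (@peval_wide 1) ?size_polyC ?leq_b1 // big_ord1 /= coefC eqxx.
by rewrite scale_lfunE id_lfunE.
Qed.

Lemma peval0 x : peval 0 x = 0.
Proof. by rewrite linear0 zero_lfunE. Qed.

Lemma pevalD p q x : peval (p + q) x = peval p x + peval q x.
Proof. by rewrite linearD add_lfunE. Qed.

Lemma pevalX x : peval 'X x = T x.
Proof. by rewrite -['X]mul1r pevalMX -[1]/(1%:P) pevalC scale1r. Qed.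

Lemma pevalM p q x : peval (p * q) x = peval p (peval q x).
Proof.
elim/poly_ind: p x => [|p c IH] x; first by rewrite mul0r peval0 peval0.
rewrite mulrDl -mulrA ['X * q]mulrC mulrA !pevalD pevalMX IH pevalMX.
by rewrite mul_polyC linearZ /= scale_lfunE pevalC.
Qed.

Lemma peval_stable (S : {vspace V}) p :
  (forall x, x \in S -> T x \in S) -> forall x, x \in S -> peval p x \in S.
Proof.
move=> TS; elim/poly_ind: p => [|p c IH] x xS; first by rewrite peval0 mem0v.
by rewrite pevalD pevalMX pevalC memvD ?memvZ ?TS ?IH.
Qed.

Lemma peval_comm (f : {linear V -> V}) p x :
  (forall x, f (T x) = T (f x)) -> f (peval p x) = peval p (f x).
Proof.
move=> fT; elim/poly_ind: p x => [|p c IH] x; first by rewrite !peval0 linear0.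
by rewrite !pevalD !pevalMX !pevalC linearD linearZ fT IH.
Qed.

Lemma pevalXsubC a x : peval ('X - a%:P) x = T x - a *: x.
Proof. by rewrite pevalD -polyCN pevalX pevalC scaleNr. Qed.

Lemma peval_eig p a x : T x = a *: x -> peval p x = p.[a] *: x.
Proof.
move=> Tx; elim/poly_ind: p => [|p c IH]; first by rewrite peval0 horner0 scale0r.
by rewrite pevalD pevalMX pevalC IH linearZ /= Tx hornerMXaddC scalerDl scalerA.
Qed.

End PolynomialAction.

Section Trace.

Variables (K : fieldType) (V : vectType K).
Implicit Types (S : {vspace V}) (f g : V -> V).

(** The trace on S, in the coordinates of a basis of S; it is meaningful for maps
that preserve S. *)
Definition trS S (f : V -> V) :=
  \sum_(i < \dim S) coord (vbasis S) i (f (vbasis S)`_i).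

Lemma trS_basis S n (X : n.-tuple V) (f : {linear V -> V}) : basis_of S X ->
  (forall x, x \in S -> f x \in S) -> trS S f = \sum_(i < n) coord X i (f X`_i).
Proof.
move=> bX fS; rewrite /trS; set Y := vbasis S.
have YS (i : 'I_(\dim S)) : Y`_i \in S.
  by rewrite vbasis_mem // mem_nth ?size_tuple.
have XS (i : 'I_n) : X`_i \in S.
  by rewrite (basis_mem bX) // mem_nth ?size_tuple.
transitivity (\sum_(i < \dim S) \sum_(j < n) coord X j Y`_i * coord Y i (f X`_j)).
  apply: eq_bigr => i _; rewrite {1}(coord_basis bX (YS i)) linear_sum linear_sum.
  by apply: eq_bigr => j _; rewrite !linearZ.
rewrite exchange_big; apply: eq_bigr => j _ /=.
rewrite [in RHS](coord_vbasis (fS _ (XS j))) linear_sum.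
by apply: eq_bigr => i _; rewrite linearZ mulrC.
Qed.

Lemma trSC S (f g : {linear V -> V}) : (forall x, x \in S -> f x \in S) ->
  (forall x, x \in S -> g x \in S) -> trS S (f \o g) = trS S (g \o f).
Proof.
move=> fS gS; rewrite /trS; set Y := vbasis S.
have YS (i : 'I_(\dim S)) : Y`_i \in S.
  by rewrite vbasis_mem // mem_nth ?size_tuple.
transitivity (\sum_(i < \dim S) \sum_(j < \dim S)
    coord Y j (g Y`_i) * coord Y i (f Y`_j)).
  apply: eq_bigr => i _ /=; rewrite {1}(coord_vbasis (gS _ (YS i))) !linear_sum.
  by apply: eq_bigr => j _; rewrite !linearZ.
rewrite exchange_big; apply: eq_bigr => j _ /=.
rewrite [in RHS](coord_vbasis (fS _ (YS j))) !linear_sum.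
by apply: eq_bigr => i _; rewrite !linearZ mulrC.
Qed.

Lemma trS_ext S f g : (forall x, x \in S -> f x = g x) -> trS S f = trS S g.
Proof.
move=> fg; apply: eq_bigr => i _; rewrite fg //.
by rewrite vbasis_mem // mem_nth ?size_tuple.
Qed.

Lemma trSD S f g : trS S (fun x => f x + g x) = trS S f + trS S g.
Proof. by rewrite -big_split; apply: eq_bigr => i _; rewrite linearD. Qed.

Lemma trSZ S a f : trS S (fun x => a *: f x) = a * trS S f.
Proof. by rewrite big_distrr; apply: eq_bigr => i _; rewrite linearZ. Qed.

Lemma trSN S f : trS S (fun x => - f x) = - trS S f.
Proof. by rewrite -sumrN; apply: eq_bigr => i _; rewrite linearN. Qed.

Lemma trS_scalar S f a : (forall x, x \in S -> f x = a *: x) ->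
  trS S f = a *+ \dim S.
Proof.
move=> fS; rewrite (trS_ext fS) trSZ /trS (eq_bigr (fun=> 1)) => [|i _].
  by rewrite sumr_const card_ord mulr_natr.
by rewrite coord_free ?eqxx // (basis_free (vbasisP S)).
Qed.

End Trace.

(** * Generalized eigenspaces *)

Definition lprod (K : fieldType) (l : seq K) : {poly K} :=
  \prod_(a <- l) ('X - a%:P).

(** A sum of generalized eigenvectors of T with eigenvalues in P, expressed
through an annihilating product of linear factors: this form avoids any
exponent and any choice of eigenvalues, and it makes sense before T is known to
split. *)
Definition inspec (K : fieldType) (V : vectType K) (T : 'End(V))
    (P : pred K) (x : V) :=
  exists2 l, all P l & peval T (lprod l) x = 0.

Section Inspec.

Variables (K : fieldType) (V : vectType K) (T : 'End(V)).
Implicit Types (P Q : pred K) (l : seq K) (x y : V).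

Lemma lprod_cons (a : K) l : lprod (a :: l) = lprod l * ('X - a%:P).
Proof. by rewrite /lprod big_cons mulrC. Qed.

Lemma lprod_cat l1 l2 : lprod (l1 ++ l2) = lprod l1 * lprod l2.
Proof. by rewrite /lprod big_cat. Qed.

Lemma peval_lprod_cons a l x :
  peval T (lprod (a :: l)) x = peval T (lprod l) (T x - a *: x).
Proof. by rewrite lprod_cons pevalM pevalXsubC. Qed.

Lemma peval_lprod_nil x : peval T (lprod [::]) x = x.
Proof. by rewrite /lprod big_nil -[1]/(1%:P) pevalC scale1r. Qed.

Lemma peval_swap p q x : peval T p (peval T q x) = peval T q (peval T p x).
Proof. by rewrite -!pevalM mulrC. Qed.

Lemma coprimep_lprod l1 l2 : (forall a, a \in l1 -> a \notin l2) ->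
  coprimep (lprod l1) (lprod l2).
Proof.
move=> dis; elim: l2 dis => [|b l2 IH] dis.
  by rewrite /lprod [X in coprimep _ X]big_nil coprimep1.
rewrite lprod_cons coprimepMr IH /= => [|a /dis]; last first.
  by rewrite inE negb_or => /andP[].
rewrite coprimep_XsubC /lprod root_prod_XsubC.
by apply/negP => /dis; rewrite mem_head.
Qed.

Lemma peval_coprime p q x : coprimep p q ->
  exists u v, x = peval T (v * q) x + peval T (u * p) x.
Proof.
move=> /Bezout_eq1_coprimepP[[u v]] /= e; exists u, v.
by rewrite -pevalD addrC e -[1]/(1%:P) pevalC scale1r.
Qed.

Lemma inspec0 P : inspec T P 0.
Proof. by exists [::] => //; rewrite linear0. Qed.

Lemma inspecD P x y : inspec T P x -> inspec T P y -> inspec T P (x + y).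
Proof.
move=> [l Pl lx] [k Pk ky]; exists (l ++ k); first by rewrite all_cat Pl Pk.
rewrite lprod_cat linearD /= mulrC pevalM lx linear0 add0r.
by rewrite mulrC pevalM ky linear0.
Qed.

Lemma inspecZ P a x : inspec T P x -> inspec T P (a *: x).
Proof. by move=> [l Pl lx]; exists l => //; rewrite linearZ /= lx scaler0. Qed.

Lemma inspec_lin P a x y : inspec T P x -> inspec T P y -> inspec T P (a *: x + y).
Proof. by move=> Px Py; apply: inspecD => //; apply: inspecZ. Qed.

Lemma inspec_comm P (f : {linear V -> V}) x :
  (forall y, f (T y) = T (f y)) -> inspec T P x -> inspec T P (f x).
Proof.
by move=> fT [l Pl lx]; exists l => //; rewrite -peval_comm // lx linear0.
Qed.

Lemma inspec_peval P p x : inspec T P x -> inspec T P (peval T p x).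
Proof.
by apply: inspec_comm => y; have := peval_swap p 'X y; rewrite !pevalX.
Qed.

Lemma inspecW P Q x : subpred P Q -> inspec T P x -> inspec T Q x.
Proof. by move=> PQ [l Pl lx]; exists l => //; apply: sub_all Pl. Qed.

Lemma inspec_eig P a x : inspec T P x -> T x = a *: x -> x != 0 -> P a.
Proof.
move=> [l /allP Pl lx] Tx x0; move: lx; rewrite (peval_eig _ Tx) => /eqP.
rewrite scaler_eq0 (negbTE x0) orbF => /eqP la.
by apply: Pl; rewrite -root_prod_XsubC; apply/rootP.
Qed.

Lemma eig_inspec a x : T x = a *: x -> inspec T (pred1 a) x.
Proof.
move=> Tx; exists [:: a]; first by rewrite /= eqxx.
by rewrite peval_lprod_cons peval_lprod_nil Tx subrr.
Qed.

Lemma inspec_disjoint P Q x :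
  (forall a, P a -> ~~ Q a) -> inspec T P x -> inspec T Q x -> x = 0.
Proof.
move=> dis [l /allP Pl lx] [k /allP Qk kx].
have /peval_coprime-/(_ x)[u [v ->]] : coprimep (lprod l) (lprod k).
  by apply: coprimep_lprod => a /Pl/dis; apply: contra => /Qk.
by rewrite !pevalM lx kx !linear0 addr0.
Qed.

(** Bezout for the two coprime parts of the annihilating product; the projections
are polynomials in T, so they preserve every T-stable subspace. *)
Lemma inspec_filter l P x : peval T (lprod l) x = 0 ->
  exists p q, [/\ x = peval T p x + peval T q x,
    peval T (lprod (filter P l)) (peval T p x) = 0 &
    peval T (lprod (filter (predC P) l)) (peval T q x) = 0].
Proof.
move=> lx; set l1 := filter P l; set l2 := filter (predC P) l.
have /peval_coprime-/(_ x)[u [v e]] : coprimep (lprod l1) (lprod l2).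
  by apply: coprimep_lprod => a; rewrite !mem_filter /= => /andP[->].
have e12 : lprod l1 * lprod l2 = lprod l.
  rewrite -lprod_cat /lprod; apply: perm_big.
  by rewrite perm_filterC.
exists (v * lprod l2), (u * lprod l1); split => //.
  by rewrite -pevalM mulrCA pevalM e12 lx linear0.
by rewrite -pevalM mulrCA pevalM [_ * lprod l1]mulrC e12 lx linear0.
Qed.

(** An eigenvector in the quotient of S by Y, found without forming the quotient:
apply the linear factors of an annihilating product one after the other until
the vector falls into Y. *)
Lemma stable_eigenvector_mod (S Y : {vspace V}) l y :
    (forall x, x \in S -> T x \in S) -> y \in S -> y \notin Y ->
    peval T (lprod l) y \in Y ->
  exists a x, [/\ x \in S, x \notin Y & T x - a *: x \in Y].
Proof.
move=> TS; elim: l y => [|a l IH] y yS yY.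
  by rewrite peval_lprod_nil (negbTE yY).
rewrite peval_lprod_cons => lY; have [YTy|nY] := boolP (T y - a *: y \in Y).
  by exists a, y.
by apply: IH lY => //; rewrite memvB ?memvZ ?TS.
Qed.

End Inspec.

Section Spectrum.

Variables (K : numClosedFieldType) (V : vectType K) (T : 'End(V)).

(** The powers of T are linearly dependent, and the resulting polynomial splits. *)
Lemma split_annihilator : exists l, forall x, peval T (lprod l) x = 0.
Proof.
pose N := \dim {: 'End(V)}.
pose X := [tuple iter i (comp_lfun T) \1%VF | i < N.+1].
have nfX : ~~ free X.
  apply/negP => fX; have : (\dim <<X>> <= N)%N by rewrite dimvS ?subvf.
  by rewrite (eqP fX) size_tuple ltnn.
have [k kX [i ki]] : exists2 k : 'I_N.+1 -> K,
    \sum_(i < N.+1) k i *: X`_i = 0 & exists i, k i != 0.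
  apply: contrapT => nk; case/negP: nfX; apply/freeP => k kX i.
  by apply/eqP; apply: contrapT => /negP ki; case: nk; exists k => //; exists i.
pose p := \poly_(j < N.+1) k (inord j).
have p0 : p != 0.
  apply/eqP => /(congr1 (fun p : {poly K} => p`_i)).
  by rewrite coef_poly ltn_ord inord_val coef0 => /eqP; rewrite (negbTE ki).
have Tp x : peval T p x = 0.
  rewrite (@peval_wide _ _ _ N.+1) ?size_poly //.
  suff -> : \sum_(j < N.+1) p`_j *: iter j (comp_lfun T) \1%VF = 0.
    by rewrite zero_lfunE.
  rewrite -[RHS]kX; apply: eq_bigr => j _.
  by rewrite coef_poly ltn_ord inord_val nth_mktuple.
have [r rE] := closed_field_poly_normal p.
exists r => x; have := Tp x; rewrite rE linearZ scale_lfunE /= => /eqP.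
by rewrite scaler_eq0 lead_coef_eq0 (negbTE p0) => /eqP.
Qed.

Lemma inspec_split (P : pred K) x : exists p q,
  [/\ x = peval T p x + peval T q x, inspec T P (peval T p x) &
      inspec T (predC P) (peval T q x)].
Proof.
have [l lT] := split_annihilator.
have [p [q [e px qx]]] := inspec_filter P (lT x).
exists p, q; split=> //.
  by exists (filter P l) => //; apply: filter_all.
by exists (filter (predC P) l) => //; apply: filter_all.
Qed.

(** A property that is additive and holds for generalized eigenvectors holds
everywhere: peel off one eigenvalue at a time from an annihilating product. *)
Lemma geig_ind (Q : V -> Prop) : Q 0 ->
    (forall x y, Q x -> Q y -> Q (x + y)) ->
    (forall a x, inspec T (pred1 a) x -> Q x) -> forall x, Q x.
Proof.
move=> Q0 QD Qg x; have [l lT] := split_annihilator; move: {lT}(lT x).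
have [n le_n] := ubnP (size l); elim: n => // n IH in l le_n x *.
case: l le_n => [_|a l le_n]; first by rewrite peval_lprod_nil => ->.
move=> /(inspec_filter (pred1 a))[p [q [e px qx]]].
rewrite e; apply: QD.
  apply: (Qg a); exists (filter (pred1 a) (a :: l)) => //.
  exact: filter_all.
apply: (IH _ _ _ qx); rewrite /= eqxx /=; apply: leq_ltn_trans (le_n : (size l < n)%N).
by rewrite size_filter count_size.
Qed.

Lemma eigenvector_exists (S : {vspace V}) :
    (forall x, x \in S -> T x \in S) -> S != 0%VS ->
  exists a x, [/\ x \in S, x != 0 & T x = a *: x].
Proof.
move=> TS S0; have [l lT] := split_annihilator.
have nS : vpick S \notin 0%VS by rewrite memv0 vpick0.
have lS : peval T (lprod l) (vpick S) \in 0%VS by rewrite lT mem0v.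
have [a [x [xS]]] := stable_eigenvector_mod TS (memv_pick S) nS lS.
by rewrite !memv0 subr_eq0 => x0 /eqP Tx; exists a, x.
Qed.

(** Flags are built from the bottom, each new vector being an eigenvector modulo
the span of the previous ones. *)
Lemma triangular_basis (S : {vspace V}) d :
    (forall x, x \in S -> T x \in S) -> (d <= \dim S)%N ->
  exists (X : seq V) (a : seq K), [/\ size X = d, size a = d, free X,
     {subset X <= S} &
     forall i, (i < d)%N -> T X`_i - a`_i *: X`_i \in <<take i X>>%VS].
Proof.
move=> TS; elim: d => [|d IH] led.
  by exists [::], [::]; split=> //; rewrite nil_free.
have [X [a [sX sa fX XS TX]]] := IH (ltnW led).
have [y yS yX] : exists2 y, y \in S & y \notin <<X>>%VS.
  apply: contrapT => ny; move: led; apply/negP; rewrite -leqNgt -sX.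
  rewrite -(eqP fX) dimvS //; apply/subvP => y yS.
  by apply: contrapT => /negP yX; apply: ny; exists y.
have [l lT] := split_annihilator.
have lX : peval T (lprod l) y \in <<X>>%VS by rewrite lT mem0v.
have [b [x [xS xX Tx]]] := stable_eigenvector_mod TS yS yX lX.
exists (rcons X x), (rcons a b); split; rewrite ?size_rcons ?sX ?sa //.
- by rewrite (perm_free (introT permPl (perm_rcons _ _))) free_cons xX.
- by move=> z; rewrite mem_rcons inE => /orP[/eqP->//|/XS].
move=> i; rewrite ltnS leq_eqVlt => /orP[/eqP->|lti].
  by rewrite !nth_rcons sX sa ltnn eqxx -cats1 -sX take_size_cat.
by rewrite !nth_rcons sX sa lti -cats1 takel_cat ?sX ?(ltnW lti) ?TX.
Qed.

(** The list a is the diagonal of a triangular form of T on S. The third clause is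
the Cayley-Hamilton theorem on S; the last one says that the diagonal entries
are roots of every polynomial killing S. *)
Lemma trS_spectrum (S : {vspace V}) : (forall x, x \in S -> T x \in S) ->
  exists a : seq K, [/\ size a = \dim S,
    forall q, trS S (peval T q) = \sum_(c <- a) q.[c],
    forall x, x \in S -> peval T (lprod a) x = 0 &
    forall q, (forall x, x \in S -> peval T q x = 0) -> all (root q) a].
Proof.
move=> TS; have [X [a [/eqP sX sa]]] := triangular_basis TS (leqnn _).
pose Xt := Tuple sX; rewrite -[X]/(tval Xt) => fX XS TX.
have bX : basis_of S Xt.
  by rewrite basisEfree fX size_tuple leqnn andbT; apply/span_subvP.
have takeS i j : (i <= j)%N -> (<<take i Xt>> <= <<take j Xt>>)%VS.
  move=> ij; apply: sub_span => x.
  by rewrite -(subnKC ij) takeD mem_cat => ->.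
have Xtake i : (i < \dim S)%N -> Xt`_i \in <<take i.+1 Xt>>%VS.
  move=> lti; rewrite memv_span // (take_nth 0) ?size_tuple //.
  by rewrite mem_rcons mem_head.
have Ttake i x : (i <= \dim S)%N -> x \in <<take i Xt>>%VS -> T x \in <<take i Xt>>%VS.
  move=> lei; rewrite -[take i Xt]/(tval (in_tuple (take i Xt))).
  move=> /coord_span->; rewrite linear_sum memv_suml // => j _.
  rewrite linearZ memvZ //=.
  have ltj : (j < i)%N.
    by apply: leq_trans (ltn_ord j) _; rewrite size_take_min geq_minl.
  have ltjS := leq_trans ltj lei.
  rewrite nth_take // -[T _](subrK (a`_j *: Xt`_j)) memvD //.
    by apply: (subvP (takeS _ _ (ltnW ltj))); apply: TX.
  by rewrite memvZ // (subvP (takeS _ _ ltj)) ?Xtake.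
have qX q i : (i < \dim S)%N ->
    peval T q Xt`_i - q.[a`_i] *: Xt`_i \in <<take i Xt>>%VS.
  move=> lti; elim/poly_ind: q => [|q c IH].
    by rewrite peval0 horner0 scale0r subr0 mem0v.
  rewrite pevalD pevalMX pevalC hornerMXaddC scalerDl opprD addrACA subrr addr0.
  rewrite -scalerA; set u := peval T q _ in IH *.
  rewrite (_ : _ - _ = T (u - q.[a`_i] *: Xt`_i) +
    q.[a`_i] *: (T Xt`_i - a`_i *: Xt`_i)).
    by rewrite memvD ?memvZ ?Ttake ?TX // ltnW.
  have TZ b y : T (b *: y) = b *: T y by rewrite linearZ.
  by rewrite [T (_ - _)]linearB /= TZ scalerBr addrA subrK.
have coordq q (i : 'I_(\dim S)) : coord Xt i (peval T q Xt`_i) = q.[a`_i].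
  have := coord_span_take fX (qX q i (ltn_ord i)).
  rewrite linearB linearZ /= coord_free // eqxx mulr1 => /eqP.
  by rewrite subr_eq0 => /eqP.
(* Each factor T - a_i carries the span of the first i+1 vectors into the span of
   the first i. *)
have aX i x : (i <= \dim S)%N -> x \in <<take i Xt>>%VS ->
    peval T (lprod (take i a)) x = 0.
  elim: i x => [|i IH] x lti.
    by rewrite !take0 span_nil memv0 => /eqP->; rewrite linear0.
  rewrite (take_nth 0) ?size_tuple // -cats1 span_cat span_seq1.
  move=> /memv_addP[u uX [_ /vlineP[b ->] ->]].
  rewrite (take_nth 0) ?sa // -cats1 lprod_cat pevalM; apply: IH (ltnW lti) _.
  have TZ c z : T (c *: z) = c *: T z by rewrite linearZ.
  have -> : peval T (lprod [:: a`_i]) (u + b *: Xt`_i) =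
      (T u - a`_i *: u) + b *: (T Xt`_i - a`_i *: Xt`_i).
    rewrite peval_lprod_cons peval_lprod_nil linearD /= TZ scalerBr scalerDr.
    by rewrite opprD addrACA !scalerA mulrC.
  by rewrite memvD ?memvB ?memvZ ?Ttake ?TX // ltnW.
exists a; split=> // q.
- rewrite (trS_basis bX (fun x => peval_stable q TS (x := x))).
  rewrite [RHS](big_nth 0) big_mkord sa.
  by apply: eq_bigr => i _; rewrite -coordq.
- move=> qS; rewrite -[a]take_size; apply: aX; rewrite sa //.
  by rewrite take_oversize ?size_tuple // (span_basis bX).
move=> q0; apply/(all_nthP 0) => i; rewrite sa => lti; apply/rootP.
by rewrite -(coordq q (Ordinal lti)) q0 ?linear0 // XS // mem_nth ?size_tuple.
Qed.

(** Chinese remainders, one point at a time. *)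
Lemma interpolation_mod (s : seq K) n (c : K -> K) : uniq s ->
  exists p, forall a, a \in s -> ('X - a%:P) ^+ n %| p - (c a)%:P.
Proof.
elim: s => [|b s IH] /=; first by exists 0.
case/andP=> bs /IH[p pE].
pose q := lprod s ^+ n; pose r := ('X - b%:P) ^+ n.
have /Bezout_eq1_coprimepP[[u v] /= e] : coprimep q r.
  rewrite coprimep_expl // coprimep_expr // /lprod coprimep_XsubC.
  by rewrite root_prod_XsubC.
exists (p + ((c b)%:P - p) * u * q) => a; rewrite inE => /orP[/eqP->|aS].
  have -> : p + ((c b)%:P - p) * u * q - (c b)%:P = (p - (c b)%:P) * v * r.
    rewrite -[(p - _) * v * r]mulrA (_ : v * r = 1 - u * q); last first.
      by apply/eqP; rewrite eq_sym subr_eq addrC e.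
    by ring.
  by rewrite dvdp_mull.
rewrite addrAC dvdp_add ?pE // dvdp_mull // /q dvdp_exp2r //.
by rewrite dvdp_XsubCl /lprod root_prod_XsubC.
Qed.

(** A function c of the eigenvalues is realized by a polynomial in T acting as the
scalar c(a) on the whole generalized eigenspace of a: interpolate c modulo
high powers of the X - a. The choice c = conjugation is the main one; the
indicator function of an eigenvalue gives the homogeneous projections. *)
Lemma twist_poly (c : K -> K) : exists l p,
  [/\ forall x, peval T (lprod l) x = 0,
      forall a, a \in l -> p.[a] = c a
    & forall a x, inspec T (pred1 a) x -> peval T p x = c a *: x].
Proof.
(* The exponent is at least the multiplicity of each root, and is positive, so that
   congruence modulo (X - a)^n fixes the value at a. *)
have [l lT] := split_annihilator; pose n := (size l).+1.
have [p pE] := interpolation_mod n c (undup_uniq l).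
exists l, p; split=> // a.
  move=> al; have: ('X - a%:P) ^+ n %| p - (c a)%:P.
    by apply: pE; rewrite mem_undup.
  move=> /(dvdp_trans (dvdp_exp2l _ (ltn0Sn _))); rewrite expr1 dvdp_XsubCl.
  by rewrite /root !hornerE subr_eq0 => /eqP.
move=> x xa; apply/eqP; rewrite -subr_eq0; apply/eqP.
have -> : peval T p x - c a *: x = peval T (p - (c a)%:P) x.
  by rewrite pevalD -polyCN pevalC scaleNr.
apply: (@inspec_disjoint _ _ T (pred1 a) (predC1 a)); first by move=> b /= ->.
  exact: inspec_peval.
have [al|al] := boolP (a \in l); last first.
  exists l; last by rewrite peval_swap lT linear0.
  by apply/allP => b bl; apply: contraNneq al => <-.
have /dvdpP[q ->] := pE a (etrans (mem_undup _ _) al).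
exists (filter (predC1 a) l); first exact: filter_all.
rewrite -!pevalM; set k := filter _ _.
have: lprod l %| lprod k * (q * ('X - a%:P) ^+ n).
  have -> : lprod l = lprod (filter (pred1 a) l) * lprod k.
    by rewrite -lprod_cat /lprod; apply/perm_big; rewrite perm_sym perm_filterC.
  rewrite mulrC dvdp_mul // dvdp_mull //.
  rewrite /lprod (eq_big_seq (fun=> 'X - a%:P)); last first.
    by move=> b; rewrite mem_filter => /andP[/eqP->].
  rewrite big_const_seq iter_mulr_1 count_predT dvdp_exp2l //.
  by rewrite ltnW // ltnS size_filter count_size.
by move=> /dvdpP[r ->]; rewrite pevalM lT linear0.
Qed.

End Spectrum.

Section BilinearSpectrum.

Variables (K : fieldType) (V1 V2 V3 : vectType K).
Variables (T1 : 'End(V1)) (T2 : 'End(V2)) (T3 : 'End(V3)).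
Variables (S1 : {vspace V1}) (S2 : {vspace V2}).
Hypothesis T1S : forall x, x \in S1 -> T1 x \in S1.
Hypothesis T2S : forall y, y \in S2 -> T2 y \in S2.
Variable beta : V1 -> V2 -> V3.
Hypothesis beta_linl : forall y, linear (beta^~ y).
Hypothesis beta_linr : forall x, linear (beta x).
Hypothesis beta_der : forall x y, x \in S1 -> y \in S2 ->
  T3 (beta x y) = beta (T1 x) y + beta x (T2 y).

(** For generalized eigenvectors one would expand (T3 - a - b)^n (beta x y) by the
binomial formula; with lists of factors it is a double induction based on
(T3 - a - b) (beta x y) = beta ((T1 - a) x) y + beta x ((T2 - b) y). *)
Lemma inspec_bilinear (P Q R : pred K) x y :
    (forall a b, P a -> Q b -> R (a + b)) -> x \in S1 -> y \in S2 ->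
  inspec T1 P x -> inspec T2 Q y -> inspec T3 R (beta x y).
Proof.
move=> PQR xS yS [l Pl lx] [k Qk ky].
have bl a u v w : beta (u - a *: v) w = beta u w - a *: beta v w.
  by rewrite addrC -scaleNr beta_linl scaleNr addrC.
have br a u v w : beta w (u - a *: v) = beta w u - a *: beta w v.
  by rewrite addrC -scaleNr beta_linr scaleNr addrC.
have b0l v : beta 0 v = 0 by rewrite -[0](subrr 0) -{2}[0]scale1r bl scale1r subrr.
have b0r v : beta v 0 = 0 by rewrite -[0](subrr 0) -{2}[0]scale1r br scale1r subrr.
have [n] := ubnP (size l + size k).
elim: n => // n IH in l k x y xS yS Pl lx Qk ky *.
case: l Pl lx => [_|a l Pl lx].
  by rewrite peval_lprod_nil => -> _; rewrite b0l; exact: inspec0.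
case: k Qk ky => [_|b k Qk ky].
  by rewrite peval_lprod_nil => -> _; rewrite b0r; exact: inspec0.
rewrite /= addSn addnS !ltnS => le_n.
have /andP[Pa Pl'] := Pl; have /andP[Qb Qk'] := Qk.
have [r1 Rr1 r1x] : inspec T3 R (beta (T1 x - a *: x) y).
  apply: (IH l (b :: k)) => //; first by rewrite memvB ?memvZ ?T1S.
    by rewrite -peval_lprod_cons.
  by rewrite /= addnS.
have [r2 Rr2 r2x] : inspec T3 R (beta x (T2 y - b *: y)).
  apply: (IH (a :: l) k) => //; first by rewrite memvB ?memvZ ?T2S.
  by rewrite -peval_lprod_cons.
exists ((a + b) :: r1 ++ r2); first by rewrite /= all_cat PQR ?Rr1.
rewrite peval_lprod_cons lprod_cat.
have -> : T3 (beta x y) - (a + b) *: beta x y =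
    beta (T1 x - a *: x) y + beta x (T2 y - b *: y).
  by rewrite bl br beta_der // scalerDl opprD addrACA.
by rewrite linearD /= !pevalM r2x linear0 addr0 peval_swap r1x linear0.
Qed.

End BilinearSpectrum.

Section FormSpectrum.

Variables (K : fieldType) (V1 V2 : vectType K).
Variables (T1 : 'End(V1)) (T2 : 'End(V2)) (c : K) (beta : V1 -> V2 -> K).
Variables (S1 : {vspace V1}) (S2 : {vspace V2}).
Hypothesis T1S : forall x, x \in S1 -> T1 x \in S1.
Hypothesis T2S : forall y, y \in S2 -> T2 y \in S2.
Hypothesis beta_linl : forall y, linear (beta^~ y : V1 -> K^o).
Hypothesis beta_linr : forall x, linear (beta x : V2 -> K^o).
Hypothesis beta_der : forall x y, x \in S1 -> y \in S2 ->
  beta (T1 x) y + beta x (T2 y) = c * beta x y.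

(** The case of [inspec_bilinear] where T3 is the multiplication by c on the
scalars: a nonzero value would be an eigenvector for c. *)
Lemma form_orthogonal (P Q : pred K) x y :
    (forall a b, P a -> Q b -> a + b != c) -> x \in S1 -> y \in S2 ->
  inspec T1 P x -> inspec T2 Q y -> beta x y = 0.
Proof.
move=> PQ xS yS Px Qy; pose T3 : 'End(K^o) := c *: \1%VF.
have T3E (t : K^o) : T3 t = c *: t by rewrite scale_lfunE id_lfunE.
have der u v : u \in S1 -> v \in S2 ->
    T3 (beta u v : K^o) = (beta (T1 u) v : K^o) + beta u (T2 v).
  by move=> uS vS; rewrite T3E beta_der.
have := @inspec_bilinear _ _ _ K^o T1 T2 T3 S1 S2 T1S T2S beta beta_linl
  beta_linr der P Q (predC1 c) x y PQ xS yS Px Qy.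
move=> /inspec_eig/(_ (T3E _)) H; apply/eqP/negPn/negP => /H /=.
by rewrite eqxx.
Qed.

End FormSpectrum.

(** * The Killing form *)

Section LieBasics.

Variables (K : fieldType) (L : lieVectType K).
Implicit Types (x y z t : L) (U V W : {vspace L}).

Definition ad x : 'End(L) := linfun (lie x).

Lemma adE x y : ad x y = lie x y.
Proof. by rewrite lfunE. Qed.

Lemma lie0r x : lie x 0 = 0. Proof. exact: linear0. Qed.
Lemma lie0l x : lie 0 x = 0. Proof. by rewrite lieC lie0r oppr0. Qed.
Lemma lieDr x y z : lie x (y + z) = lie x y + lie x z. Proof. exact: linearD. Qed.
Lemma lieNr x y : lie x (- y) = - lie x y. Proof. exact: linearN. Qed.
Lemma lieZr a x y : lie x (a *: y) = a *: lie x y. Proof. exact: linearZ. Qed.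
Lemma lieBl x y z : lie (x - y) z = lie x z - lie y z.
Proof. by rewrite lieDl lieNl. Qed.

Lemma jacobi x y z : lie x (lie y z) = lie (lie x y) z + lie y (lie x z).
Proof.
apply/eqP; rewrite -subr_eq0 opprD -(lie_jacobi x y z) -addrA; apply/eqP.
congr (_ + _); rewrite addrC; congr (_ + _).
  by rewrite [RHS]lieC.
by rewrite [lie z x]lieC lieNr.
Qed.

Lemma lie_suml I (r : seq I) (F : I -> L) z :
  lie (\sum_(i <- r) F i) z = \sum_(i <- r) lie (F i) z.
Proof. by elim/big_rec2: _ => [|i x y _ <-]; rewrite ?lie0l ?lieDl. Qed.

Lemma mem_lie_prodv U V x y : x \in U -> y \in V -> lie x y \in lie_prodv U V.
Proof.
move=> xU yV; rewrite (coord_vbasis xU) lie_suml memv_suml // => i _.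
rewrite (coord_vbasis yV) linear_sum /= memv_suml // => j _.
rewrite lieZl lieZr !memvZ // memv_span //.
by apply: allpairs_f; rewrite mem_nth ?size_tuple.
Qed.

Lemma lie_prodv_ind U V (P : L -> Prop) : P 0 ->
    (forall a x y, P x -> P y -> P (a *: x + y)) ->
    (forall x y, x \in U -> y \in V -> P (lie x y)) ->
  forall x, x \in lie_prodv U V -> P x.
Proof.
move=> P0 Plin PUV x; have [W WP] := vspace_of_pred P0 Plin.
suff sW : (lie_prodv U V <= W)%VS by move=> /(subvP sW)/WP.
apply/span_subvP => _ /allpairsP[[u v] [/= /vbasis_mem uU /vbasis_mem vV ->]].
exact/WP/PUV.
Qed.

Lemma sub_lie_prodv U V W :
  (forall x y, x \in U -> y \in V -> lie x y \in W) -> (lie_prodv U V <= W)%VS.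
Proof.
move=> UVW; apply/subvP; apply: lie_prodv_ind => //; first exact: mem0v.
by move=> a x y xW yW; rewrite memvD ?memvZ.
Qed.

Lemma lie_prodvS U1 U2 V1 V2 : (U1 <= U2)%VS -> (V1 <= V2)%VS ->
  (lie_prodv U1 V1 <= lie_prodv U2 V2)%VS.
Proof.
move=> sU sV; apply: sub_lie_prodv => x y xU yV.
by rewrite mem_lie_prodv ?(subvP sU) ?(subvP sV).
Qed.

(** The Killing form. *)
Definition kf x y := trS {:L} (fun t => lie x (lie y t)).

Lemma kfC x y : kf x y = kf y x.
Proof.
by apply: (@trSC _ _ _ (lie x) (lie y)) => t _; apply: memvf.
Qed.

Lemma kf_linr x : linear (kf x : L -> K^o).
Proof.
move=> a y z; have : kf x (a *: y + z) = a * kf x y + kf x z; last by [].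
rewrite /kf -trSZ -trSD; apply: trS_ext => t _.
by rewrite lieDl lieZl linearD linearZ.
Qed.

Lemma kf_linl y : linear (kf^~ y : L -> K^o).
Proof. by move=> a x z /=; rewrite !(kfC _ y) kf_linr. Qed.

HB.instance Definition _ x :=
  GRing.isLinear.Build K L K^o _ (kf x : L -> K^o) (kf_linr x).

Lemma kf0r x : kf x 0 = 0. Proof. exact: linear0. Qed.
Lemma kf0l x : kf 0 x = 0. Proof. by rewrite kfC kf0r. Qed.
Lemma kfDr x y z : kf x (y + z) = kf x y + kf x z. Proof. exact: linearD. Qed.
Lemma kfDl x y z : kf (x + y) z = kf x z + kf y z.
Proof. by rewrite !(kfC _ z) kfDr. Qed.
Lemma kfZr a x y : kf x (a *: y) = a * kf x y. Proof. exact: linearZ. Qed.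
Lemma kfZl a x y : kf (a *: x) y = a * kf x y.
Proof. by rewrite !(kfC _ y) kfZr. Qed.
Lemma kfNr x y : kf x (- y) = - kf x y. Proof. exact: linearN. Qed.
Lemma kfNl x y : kf (- x) y = - kf x y.
Proof. by rewrite !(kfC _ y) kfNr. Qed.

Definition tr_ad (D : 'End(L)) z := trS {:L} (fun t => D (lie z t)).

Lemma tr_ad_linear D : linear (tr_ad D : L -> K^o).
Proof.
move=> a y z; have : tr_ad D (a *: y + z) = a * tr_ad D y + tr_ad D z; last by [].
rewrite /tr_ad -trSZ -trSD; apply: trS_ext => t _.
by rewrite lieDl lieZl linearD linearZ.
Qed.

HB.instance Definition _ D :=
  GRing.isLinear.Build K L K^o _ (tr_ad D : L -> K^o) (tr_ad_linear D).

(** Since ad (D x) = [D, ad x], both sides are the trace of [D, ad x] o ad y, up to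
a cyclic permutation. With D = ad x this is the invariance of the Killing form. *)
Lemma tr_ad_lie D x y : lie_derivation D -> tr_ad D (lie x y) = kf (D x) y.
Proof.
move=> derD; have cyc : trS {:L} (fun t => D (lie y (lie x t))) =
    trS {:L} (fun t => lie x (D (lie y t))).
  by apply: (@trSC _ _ _ (D \o lie y) (lie x)) => t _; apply: memvf.
transitivity (trS {:L} (fun t => D (lie x (lie y t)))
    - trS {:L} (fun t => D (lie y (lie x t)))).
  rewrite -trSN -trSD; apply: trS_ext => t _.
  by rewrite jacobi linearD addrK.
rewrite cyc -trSN -trSD; apply: trS_ext => t _.
by rewrite derD addrK.
Qed.

Lemma ad_derivation x : lie_derivation (ad x).
Proof. by move=> y z; rewrite !adE jacobi. Qed.

Lemma kf_inv x y z : kf (lie x y) z = kf x (lie y z).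
Proof.
have -> : kf x (lie y z) = tr_ad (ad x) (lie y z).
  by apply: trS_ext => t _; rewrite adE.
by rewrite tr_ad_lie ?adE //; apply: ad_derivation.
Qed.

Lemma inspec_lie z (P Q R : pred K) x y :
    (forall a b, P a -> Q b -> R (a + b)) ->
  inspec (ad z) P x -> inspec (ad z) Q y -> inspec (ad z) R (lie x y).
Proof.
move=> PQR; apply: (@inspec_bilinear _ _ _ _ _ _ _ fullv fullv) PQR _ _ => //.
- by move=> *; apply: memvf.
- by move=> *; apply: memvf.
- exact: lie_linearl.
- by move=> u; apply: lie_linearr.
- by move=> u v _ _; rewrite !adE jacobi.
- exact: memvf.
exact: memvf.
Qed.

End LieBasics.

(** * Engel's theorem *)

Section Engel.

Variables (K : fieldType) (L : lieVectType K).
Implicit Types (x y : L) (U V W I : {vspace L}).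

Definition lie_closed U := forall x y, x \in U -> y \in U -> lie x y \in U.

Lemma iter_prodvS n U1 U2 V1 V2 : (U1 <= U2)%VS -> (V1 <= V2)%VS ->
  (iter n (lie_prodv U1) V1 <= iter n (lie_prodv U2) V2)%VS.
Proof. by move=> sU sV; elim: n => //= n IH; apply: lie_prodvS. Qed.

Lemma prodv_full_decr U i :
  (iter i.+1 (lie_prodv U) fullv <= iter i (lie_prodv U) fullv)%VS.
Proof. by rewrite iterSr iter_prodvS ?subvf. Qed.

(** Apply elements of U to y as long as the result stays outside U. *)
Lemma normalizing_vector U I n y : lie_ideal I -> (U <= I)%VS ->
    y \in I -> y \notin U -> (iter n (lie_prodv U) <[y]> <= U)%VS ->
  exists x, [/\ x \in I, x \notin U & forall k, k \in U -> lie k x \in U].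
Proof.
move=> idI sUI; elim: n y => [|n IH] y yI yU.
  by rewrite /= -memvE (negbTE yU).
move=> sU; have [norm|] := pselect (forall k, k \in U -> lie k y \in U).
  by exists y.
move=> /existsNP[k /not_implyP[kU /negP kyU]].
apply: (IH (lie k y)) => //; first exact: idI.
apply: subv_trans sU; rewrite iterSr iter_prodvS //.
by rewrite -memvE mem_lie_prodv ?memv_line.
Qed.

(** On each quotient of the filtration of L by the iterates of ad U, an element of
U + <x> acts as a multiple of ad x; hence M such factors descend one step. *)
Lemma extend_nil_action U x M i : lie_closed U ->
    (forall k, k \in U -> lie k x \in U) ->
    (forall t, iter M (lie x) t = 0) ->
  (iter (i * M) (lie_prodv (U + <[x]>)) fullv <= iter i (lie_prodv U) fullv)%VS.
Proof.
move=> clU norm xM; pose F i := iter i (lie_prodv U) fullv.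
have xF j f : f \in F j -> lie x f \in F j.
  elim: j f => [|j IH] f; first by rewrite !memvf.
  elim/lie_prodv_ind: f / => [|a u v xu xv|k f kU fF].
  - by rewrite lie0r mem0v.
  - by rewrite lieDr lieZr memvD ?memvZ.
  by rewrite jacobi memvD ?mem_lie_prodv ?IH // lieC memvN norm.
have xiF j n f : f \in F j -> iter n (lie x) f \in F j.
  by move=> fF; elim: n => //= n IH; apply: xF.
elim: i => [|i IH]; first by rewrite subvf.
rewrite mulSn iterD; set W := iter (i * M) _ _ in IH *.
have sj j w : w \in iter j (lie_prodv (U + <[x]>)) W ->
    exists f f', [/\ f \in F i, f' \in F i.+1 & w = iter j (lie x) f + f'].
  elim: j w => [|j IHj] w.
    by move=> wW; exists w, 0; rewrite mem0v addr0 (subvP IH).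
  have itZ a n u v : iter n (lie x) (a *: u + v) =
      a *: iter n (lie x) u + iter n (lie x) v.
    by elim: n => //= n ->; rewrite lieDr lieZr.
  have it0 n : iter n (lie x) 0 = 0 by elim: n => //= n ->; rewrite lie0r.
  elim/lie_prodv_ind: w / => [|a u v [f [f' [fF f'F ->]]] [h [h' [hF h'F ->]]]|].
  - exists 0, 0; rewrite !mem0v addr0; split=> //.
  - exists (a *: f + h), (a *: f' + h'); rewrite !memvD ?memvZ //.
    by split=> //; rewrite itZ scalerDr addrACA.
  move=> _ w /memv_addP[k kU [_ /vlineP[a ->] ->]] /IHj[f [f' [fF f'F ->]]].
  exists (a *: f), (lie k (iter j (lie x) f + f') + a *: lie x f'); split.
  - by rewrite memvZ.
  - rewrite memvD ?memvZ ?xF // mem_lie_prodv // memvD ?xiF //.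
    exact: (subvP (prodv_full_decr _ _)).
  have -> : iter j.+1 (lie x) (a *: f) = a *: iter j.+1 (lie x) f.
    by rewrite -[a *: f]addr0 itZ it0 addr0.
  rewrite lieDl [lie (a *: x) _]lieZl [lie x (_ + _)]lieDr scalerDr.
  by rewrite addrCA addrA.
apply/subvP => w /sj[f [f' [_ f'F ->]]].
by rewrite xM add0r.
Qed.

(** Jacobson's form of Engel's theorem: among the subalgebras U of I for which all
long products of adjoint maps vanish, choose one of maximal dimension. A vector
of I normalizing U but outside it would give a larger one. *)
Theorem engel_solvable I : lie_ideal I ->
    (forall x, x \in I -> exists n, forall t, iter n (lie x) t = 0) ->
  lie_solvable I.
Proof.
move=> idI nilI.
pose p d := `[< exists U, [/\ \dim U = d, (U <= I)%VS, lie_closed U &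
  exists N, iter N (lie_prodv U) fullv = 0%VS] >].
have p0 : exists d, p d.
  exists 0%N; apply/asboolP; exists 0%VS; rewrite dimv0 sub0v.
  split=> // [x y|]; first by rewrite !memv0 => /eqP-> _; rewrite lie0l.
  exists 1%N; apply/eqP; rewrite /= -subv0; apply: sub_lie_prodv => x y.
  by rewrite !memv0 => /eqP-> _; rewrite lie0l.
have pb d : p d -> (d <= \dim I)%N.
  by move=> /asboolP[U [<- sUI _ _]]; apply: dimvS.
case: (ex_maxnP p0 pb) => d /asboolP[U [dU sUI clU [N UN]]] dmax.
have sIU : (I <= U)%VS.
  apply/subvP => y yI; apply: contrapT => /negP yU.
  have : (iter N (lie_prodv U) <[y]> <= U)%VS.
    by apply: subv_trans (sub0v U); rewrite -UN iter_prodvS ?subvf.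
  move=> /(normalizing_vector idI sUI yI yU)[x [xI xU norm]].
  have [M xM] := nilI x xI; have sU' : (U + <[x]> <= I)%VS.
    by rewrite subv_add sUI -memvE.
  have : p (\dim (U + <[x]>)).
    apply/asboolP; exists (U + <[x]>)%VS; split=> //.
      move=> y1 y2 /memv_addP[u uU [_ /vlineP[a ->] ->]].
      move=> /memv_addP[v vU [_ /vlineP[b ->] ->]].
      apply: (subvP (addvSl _ _)).
      rewrite lieDl !lieDr !lieZl !lieZr liexx !scaler0 addr0.
      have xv : lie x v \in U by rewrite lieC memvN norm.
      by rewrite !memvD ?memvZ //; [apply: clU | apply: norm].
    exists (N * M)%N; apply/eqP; rewrite -subv0 -UN.
    exact: extend_nil_action.
  move=> /dmax; rewrite -dU => led; case/negP: xU.
  have /eqP-> : U == (U + <[x]>)%VS by rewrite eqEdim addvSl.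
  by rewrite (subvP (addvSr _ _)) ?memv_line.
exists N; apply/eqP; rewrite -subv0 -UN.
suff: (iter N (fun V => lie_prodv V V) I <= I)%VS /\
  (iter N (fun V => lie_prodv V V) I <= iter N (lie_prodv U) fullv)%VS by case.
elim: N {UN} => [|n [IH1 IH2]] /=; first by rewrite subvf.
split; last by rewrite lie_prodvS // (subv_trans IH1).
by apply: sub_lie_prodv => x y _ /(subvP IH1); apply: idI.
Qed.

End Engel.

(** The last nonzero term of the derived series of a solvable ideal is an abelian
ideal. *)
Lemma semisimple_of_abelian_ideals (K : fieldType) (L : lieVectType K) :
    (forall A : {vspace L}, lie_ideal A -> lie_prodv A A = 0%VS -> A = 0%VS) ->
  lie_semisimple L.
Proof.
move=> ab I idI [n]; elim: n I idI => [|n IH] I idI //.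
rewrite iterSr => /IH FI; apply: ab => //; apply: FI => x y.
elim/lie_prodv_ind: y / => [|a u v xu xv|u v uI vI].
- by rewrite lie0r mem0v.
- by rewrite lieDr lieZr memvD ?memvZ.
by rewrite jacobi memvD ?mem_lie_prodv // idI.
Qed.

(** * Conjugated derivations and Cartan's criterion *)

Section ConjugateDerivation.

Variables (K : numClosedFieldType) (L : lieVectType K).
Implicit Types (x y z t : L) (U V W I : {vspace L}) (D : 'End(L)).

Definition ad_stable z U := forall x, x \in U -> lie z x \in U.

(** The bracket of the generalized eigenspaces of a and b lies in that of a + b. *)
Lemma twist_derivation z (c : K -> K) p :
    (forall a b, c (a + b) = c a + c b) ->
    (forall a x, inspec (ad z) (pred1 a) x -> peval (ad z) p x = c a *: x) ->
  lie_derivation (peval (ad z) p).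
Proof.
move=> cD pc x y; set D := peval _ p.
elim/(@geig_ind _ _ (ad z)): x => [|x1 x2 e1 e2|a x xa].
- by rewrite linear0 !lie0l linear0 add0r.
- by rewrite lieDl [D (x1 + x2)]linearD lieDl linearD /= e1 e2 lieDl addrACA.
elim/(@geig_ind _ _ (ad z)): y => [|y1 y2 e1 e2|b y yb].
- by rewrite !lie0r [D 0]linear0 lie0r addr0.
- by rewrite lieDr [D (y1 + y2)]linearD lieDr [D (_ + _)]linearD /= e1 e2 lieDr addrACA.
have xy : inspec (ad z) (pred1 (a + b)) (lie x y).
  by apply: inspec_lie xa yb => u v /= /eqP-> /eqP->.
by rewrite /D (pc _ _ xy) (pc _ _ xa) (pc _ _ yb) cD scalerDl lieZl lieZr.
Qed.

(** What is retained of the conjugate of ad z: it preserves the ad z-stable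
subspaces and has there the conjugate trace. *)
Definition conjugate_of_ad z D := lie_derivation D /\
  forall S, ad_stable z S ->
    (forall x, x \in S -> D x \in S) /\ trS S D = (trS S (lie z))^*.

Lemma conjugate_of_ad_exists z : exists D (s : seq K),
  [/\ conjugate_of_ad z D, kf z z = \sum_(a <- s) a ^+ 2,
      tr_ad D z = \sum_(a <- s) a * a^* &
      forall t, peval (ad z) (lprod s) t = 0].
Proof.
have [l [p [lT pl pE]]] := twist_poly (ad z) Num.conj.
have zS S : ad_stable z S -> forall x, x \in S -> ad z x \in S.
  by move=> zS x /zS; rewrite adE.
have ls a : all (root (lprod l)) a -> forall b, b \in a -> p.[b] = b^*.
  by move=> /allP la b /la; rewrite /lprod root_prod_XsubC => /pl.
have [s [_ trs sT rs]] :=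
  trS_spectrum (S := fullv) (T := ad z) (fun x _ => memvf (ad z x)).
exists (peval (ad z) p), s; split=> [|||t]; last by rewrite sT ?memvf.
- split; first by apply: twist_derivation pE => a b; rewrite rmorphD.
  move=> S /zS TS; split; first exact: peval_stable.
  have [a [_ tra _ ra]] := trS_spectrum TS.
  have -> : trS S (lie z) = trS S (peval (ad z) 'X).
    by apply: trS_ext => x _; rewrite pevalX adE.
  rewrite !tra rmorph_sum; apply: eq_big_seq => b ba.
  by rewrite hornerX (ls a) // ra // => x _; rewrite lT.
- transitivity (trS {:L} (peval (ad z) ('X * 'X))).
    by apply: trS_ext => t _; rewrite pevalM !pevalX !adE.
  by rewrite trs; apply: eq_bigr => a _; rewrite !hornerE expr2.
transitivity (trS {:L} (peval (ad z) (p * 'X))).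
  by apply: trS_ext => t _; rewrite pevalM pevalX adE.
rewrite trs; apply: eq_big_seq => a aS.
by rewrite hornerM hornerX (ls s) // 1?mulrC // rs // => x _; rewrite lT.
Qed.

Lemma nilpotent_of_zero_spectrum z (s : seq K) :
    (forall a, a \in s -> a = 0) ->
    (forall t, peval (ad z) (lprod s) t = 0) ->
  exists n, forall t, iter n (lie z) t = 0.
Proof.
move=> s0 sT; exists (size s) => t.
suff -> : iter (size s) (lie z) t = peval (ad z) (lprod s) t by [].
elim: s t s0 {sT} => [|a s IH] t s0.
  by rewrite peval_lprod_nil.
rewrite peval_lprod_cons -IH => [|b bs]; last by apply: s0; rewrite inE bs orbT.
by rewrite [size _]/= iterSr adE (s0 _ (mem_head _ _)) scale0r subr0.
Qed.

(** For z = sum [x_i, y_i] with x_i in N, the trace of D o ad z is the sum of the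
kf (D x_i) y_i, which vanish; for the conjugate D it is also the sum of the
|a|^2 over the eigenvalues a of ad z. *)
Lemma bracket_radical_nilpotent N z : lie_ideal N ->
    (forall x y, x \in N -> kf x y = 0) -> z \in lie_prodv N fullv ->
  exists n, forall t, iter n (lie z) t = 0.
Proof.
move=> idN kN zN; have [D [s [[derD DS] _ trD sT]]] := conjugate_of_ad_exists z.
have [DN _] := DS N (fun x xN => idN z x xN).
have : tr_ad D z = 0.
  elim/lie_prodv_ind: z / zN {DS trD sT} => [|a x y Px Py|x y xN _].
  - exact: linear0.
  - by rewrite (tr_ad_linear D a x y) Px Py /= scaler0 addr0.
  by rewrite tr_ad_lie // kN // DN.
rewrite trD => /eqP; rewrite psumr_eq0 => [/allP s0|a _]; last exact: mul_conjC_ge0.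
apply: nilpotent_of_zero_spectrum sT => a /s0.
by rewrite /= mul_conjC_eq0 => /eqP.
Qed.

(** Cartan's criterion: the brackets of the radical of kf with L form an ideal of
ad-nilpotent elements, which is solvable by Engel's theorem, hence zero. *)
Theorem kf_nondegenerate : lie_semisimple L ->
  forall x, (forall y, kf x y = 0) -> x = 0.
Proof.
move=> ss; pose P x := forall y, kf x y = 0.
have P0 : P 0 by move=> y; rewrite kf0l.
have Plin a x y : P x -> P y -> P (a *: x + y).
  by move=> Px Py t; rewrite kfDl kfZl Px Py mulr0 addr0.
have [N NP] := vspace_of_pred P0 Plin.
have idN : lie_ideal N.
  by move=> x y /NP Py; apply/NP => t; rewrite lieC kfNl kf_inv Py oppr0.
pose M := lie_prodv N fullv.
have sMN : (M <= N)%VS.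
  by apply: sub_lie_prodv => x y xN _; rewrite lieC memvN idN.
have idM : lie_ideal M.
  by move=> x y /(subvP sMN) yN; rewrite lieC memvN mem_lie_prodv ?memvf.
have /(ss _ idM) M0 : lie_solvable M.
  apply: engel_solvable => // x xM.
  by apply: (bracket_radical_nilpotent idN _ xM) => u v /NP.
have /(ss _ idN) N0 : lie_solvable N.
  exists 1%N; apply/eqP; rewrite -subv0 -M0 /=.
  by rewrite lie_prodvS ?subvf.
by move=> x Px; apply/eqP; rewrite -memv0 -N0; apply/NP.
Qed.

(** The map L -> L^* defined by kf is injective, hence surjective. *)
Lemma kf_represent (phi : L -> K) : (forall x, (forall y, kf x y = 0) -> x = 0) ->
  linear (phi : L -> K^o) -> exists v, forall x, kf x v = phi x.
Proof.
move=> nd philin.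
pose F0 (v : L) : 'Hom(L, K^o) := linfun (kf v : L -> K^o).
have F0E v x : F0 v x = kf v x by rewrite lfunE.
have F0lin : linear F0.
  move=> a u v; apply/lfunP => x; rewrite add_lfunE scale_lfunE !F0E.
  by rewrite kfDl kfZl.
pose F0l := GRing.isLinear.Build K L 'Hom(L, K^o) _ F0 F0lin.
pose F : {linear L -> 'Hom(L, K^o)} := HB.pack F0 F0l.
have kerF : lker (linfun F) == 0%VS.
  apply/lker0P => u v; rewrite !lfunE /= => /lfunP e.
  apply/eqP; rewrite -subr_eq0; apply/eqP/nd => y.
  by rewrite kfDl kfNl -!F0E e subrr.
have imF : limg (linfun F) = fullv.
  apply/eqP; rewrite eqEdim subvf limg_dim_eq ?(eqP kerF) ?capv0 //=.
  by rewrite !dimvf /dim /= muln1.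
pose phil := GRing.isLinear.Build K L K^o _ (phi : L -> K^o) philin.
pose phiL : {linear L -> K^o} := HB.pack (phi : L -> K^o) phil.
have /memv_imgP[v _ e] : linfun phiL \in limg (linfun F) by rewrite imF memvf.
exists v => x; rewrite kfC -F0E; move/lfunP: e => /(_ x).
by rewrite !lfunE.
Qed.

Lemma inspec_filter_full (T : 'End(L)) l (P : pred K) x :
    (forall t, peval T (lprod l) t = 0) -> inspec T P x ->
  peval T (lprod (filter P l)) x = 0.
Proof.
move=> lT Px; apply: (@inspec_disjoint _ _ T P (predC P)) => [a /= ->//||].
  exact: inspec_peval.
exists (filter (predC P) l); first exact: filter_all.
rewrite -pevalM -lprod_cat -(lT x) /lprod; congr (peval _ _ _).
by apply/perm_big; rewrite perm_catC perm_filterC.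
Qed.

Lemma kf_orthogonal z (P Q : pred K) x y :
    (forall a b, P a -> Q b -> a + b != 0) ->
  inspec (ad z) P x -> inspec (ad z) Q y -> kf x y = 0.
Proof.
move=> PQ; apply: (@form_orthogonal _ _ _ _ _ 0 _ fullv fullv) PQ _ _;
  rewrite ?memvf // => *; rewrite ?memvf //.
- exact: kf_linl.
- exact: kf_linr.
by rewrite !adE mul0r -kf_inv lieC kfNl addNr.
Qed.

(** Let M be the space generated by X under ad V. Because ad U kills X and [U, V]
lies in H, M is also stable under ad U, so z, a sum of brackets of U and V, has
trace zero on M. But all eigenvalues of z on M are positive: M = 0. *)
Lemma annihilated_positive_eq0 (U V X H : {vspace L}) z :
    (forall u v, u \in U -> v \in V -> lie u v \in H) ->
    (forall h v, h \in H -> v \in V -> lie h v \in V) ->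
    (forall h x, h \in H -> x \in X -> lie h x \in X) ->
    (forall u x, u \in U -> x \in X -> lie u x = 0) ->
    z \in lie_prodv U V ->
    (forall v, v \in V -> inspec (ad z) (fun a => 0 <= a) v) ->
    (forall x, x \in X -> inspec (ad z) (fun a => 0 < a) x) ->
  X = 0%VS.
Proof.
move=> UVH HV HX UX zUV posV posX.
(* M is defined as the smallest subspace containing X and stable under V. *)
pose st M := (X <= M)%VS /\ forall v m, v \in V -> m \in M -> lie v m \in M.
pose p d := `[< exists2 M, \dim M = d & st M >].
have p0 : exists d, p d.
  by exists (\dim {:L}); apply/asboolP; exists fullv => //; split=> *;
    rewrite ?subvf ?memvf.
case: (ex_minnP p0) => d /asboolP[M dM [sXM VM]] dmin.
have Mmin W : st W -> (M <= W)%VS.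
  move=> [sXW VW]; have /dmin : p (\dim (M :&: W)).
    apply/asboolP; exists (M :&: W)%VS => //; split; first by rewrite subv_cap sXM.
    by move=> v m vV /memv_capP[mM mW]; rewrite memv_cap VM ?VW.
  rewrite -dM => le; have /eqP <- : (M :&: W)%VS == M by rewrite eqEdim capvSl.
  exact: capvSr.
have posM x : x \in M -> inspec (ad z) (fun a => 0 < a) x.
  have [W WP] := vspace_of_pred (inspec0 (ad z) (fun a => 0 < a))
     (fun a x y => @inspec_lin _ _ (ad z) (fun a => 0 < a) a x y).
  suff sMW : (M <= W)%VS by move=> /(subvP sMW)/WP.
  apply: Mmin; split; first by apply/subvP => t /posX/WP.
  move=> v m /posV Pv /WP Pm; apply/WP; apply: inspec_lie Pv Pm => a b.
  exact: ltr_wpDl.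
have [HM UM] : (forall h m, h \in H -> m \in M -> lie h m \in M) /\
    (forall u m, u \in U -> m \in M -> lie u m \in M).
  pose Q m := [/\ m \in M, forall h, h \in H -> lie h m \in M &
    forall u, u \in U -> lie u m \in M].
  have Q0 : Q 0 by split=> *; rewrite ?lie0r mem0v.
  have Qlin a x y : Q x -> Q y -> Q (a *: x + y).
    move=> [x1 x2 x3] [y1 y2 y3]; split=> [|h hH|u uU].
    - by rewrite memvD ?memvZ.
    - by rewrite lieDr lieZr memvD ?memvZ ?x2 ?y2.
    by rewrite lieDr lieZr memvD ?memvZ ?x3 ?y3.
  have [W WQ] := vspace_of_pred Q0 Qlin.
  have sMW : (M <= W)%VS.
    apply: Mmin; split.
      apply/subvP => x xX; apply/WQ; split; first exact: (subvP sXM).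
        by move=> h hH; apply/(subvP sXM)/HX.
      by move=> u uU; rewrite UX ?mem0v.
    move=> v m vV /WQ[mM HmM UmM]; apply/WQ; split; first exact: VM.
      move=> h hH; rewrite jacobi memvD //; first by apply: VM => //; apply: HV.
      by apply: VM => //; apply: HmM.
    move=> u uU; rewrite jacobi memvD //; first by apply/HmM/UVH.
    by apply: VM => //; apply: UmM.
  by split=> x m xH /(subvP sMW)/WQ[]; auto.
have trz : trS M (lie z) = 0.
  elim/lie_prodv_ind: z / zUV {posV posX posM} => [|a x y Px Py|u v uU vV].
  - by rewrite (trS_scalar (a := 0)) ?mul0rn // => t _; rewrite lie0l scale0r.
  - rewrite (trS_ext (g := fun t => a *: lie x t + lie y t)) => [|t _].
      by rewrite trSD trSZ Px Py mulr0 addr0.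
    by rewrite lieDl lieZl.
  rewrite (trS_ext (g := fun t => lie u (lie v t) + - lie v (lie u t))).
    rewrite trSD trSN; apply/eqP; rewrite subr_eq0; apply/eqP.
    by apply: (@trSC _ _ _ (lie u) (lie v)) => t tM; [apply: UM | apply: VM].
  by move=> t _; rewrite jacobi addrK.
have zM x : x \in M -> ad z x \in M.
  move=> xM; rewrite adE; apply: HM => //.
  by apply: (subvP (sub_lie_prodv UVH)).
have [s [sz trs _ rs]] := trS_spectrum zM.
have [l lT] := split_annihilator (ad z).
have /allP spos : all (fun a : K => 0 < a) s.
  have /rs : forall x, x \in M ->
      peval (ad z) (lprod (filter (fun a => 0 < a) l)) x = 0.
    by move=> x /posM; apply: inspec_filter_full.
  move=> /allP ra; apply/allP => a /ra.
  by rewrite /lprod root_prod_XsubC mem_filter => /andP[].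
have : \sum_(a <- s) a = 0.
  rewrite -[RHS]trz (trS_ext (g := peval (ad z) 'X)) => [|t _]; last first.
    by rewrite pevalX adE.
  by rewrite trs; apply: eq_bigr => a _; rewrite hornerX.
rewrite big_seq => /eqP; rewrite psumr_eq0 => [/allP s0|a /spos/ltW //].
apply/eqP; rewrite -subv0; suff <- : M = 0%VS by [].
apply/eqP; rewrite -dimv_eq0 -sz; case: (s) s0 spos => // a s' s0 spos.
have := s0 a (mem_head _ _); rewrite mem_head /= => /eqP a0.
by have := spos a (mem_head _ _); rewrite a0 ltxx.
Qed.

(** Let a run over the eigenvalues of ad z. The hypothesis says that the sum of the
|a|^2 is the conjugate of the sum of the a^2; so these sums agree, and the sum of
the |a - conj a|^2 is zero. *)
Lemma real_spectrum_of_conjugate z :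
    (forall D, conjugate_of_ad z D -> tr_ad D z = (kf z z)^*) ->
  [/\ 0 <= kf z z, forall x, inspec (ad z) (fun a => a \is Num.real) x &
      kf z z = 0 -> exists n, forall t, iter n (lie z) t = 0].
Proof.
have [D [s [cD -> trD sT]]] := conjugate_of_ad_exists z.
move=> /(_ D cD); rewrite trD => e.
have S2ge0 : 0 <= \sum_(a <- s) a * a^* by apply: sumr_ge0 => a _; apply: mul_conjC_ge0.
have S12 : \sum_(a <- s) a ^+ 2 = \sum_(a <- s) a * a^*.
  apply: (can_inj (@conjCK K)); rewrite -e.
  by apply/esym/CrealP; apply: ger0_real.
split; first by rewrite S12.
  move=> x; exists s => //; apply/allP => a aS.
  have : \sum_(b <- s) (b - b^*) * (b - b^*)^* = 0.
    transitivity (\sum_(b <- s) ((b * b^* + b * b^*) - (b ^+ 2 + (b ^+ 2)^*))).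
      by apply: eq_bigr => b _; rewrite rmorphB rmorphXn /= conjCK; ring.
    rewrite sumrB !big_split /= -rmorph_sum /= S12.
    by rewrite (CrealP _) ?subrr // ger0_real.
  move=> /eqP; rewrite psumr_eq0 => [/allP/(_ a aS)|b _]; last exact: mul_conjC_ge0.
  by rewrite /= mul_conjC_eq0 subr_eq0 eq_sym => /eqP/CrealP.
rewrite S12 => /eqP; rewrite psumr_eq0 => [/allP s0|a _]; last exact: mul_conjC_ge0.
apply: nilpotent_of_zero_spectrum sT => a /s0.
by rewrite /= mul_conjC_eq0 => /eqP.
Qed.

End ConjugateDerivation.

(** * Pairings of subspaces *)

Section Pairing.

Variables (K : fieldType) (V : vectType K) (b : V -> V -> K).
Hypothesis b_linl : forall y, linear (b^~ y : V -> K^o).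

Lemma formBl (x y z : V) : b (x - y) z = b x z - b y z.
Proof.
have := b_linl z (-1) y x; rewrite /= scaleN1r [- y + x]addrC => ->.
by rewrite -[_ *: _]/(-1 * b y z) mulN1r addrC.
Qed.

Lemma form0l (y : V) : b 0 y = 0.
Proof. by rewrite -[0](subrr 0) formBl subrr. Qed.

Lemma formDl (x y z : V) : b (x + y) z = b x z + b y z.
Proof. by have := b_linl z 1 x y; rewrite /= !scale1r. Qed.

Lemma formZl a (x z : V) : b (a *: x) z = a * b x z.
Proof. by have := b_linl z a x 0; rewrite /= addr0 => ->; rewrite form0l addr0. Qed.

Lemma formNl (x z : V) : b (- x) z = - b x z.
Proof. by rewrite -scaleN1r formZl mulN1r. Qed.

(** A map into A that encodes the restriction of b x to A: its coordinates are the
values of b x on a basis of A. *)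
Definition riesz (A : {vspace V}) (x : V) : V :=
  \sum_(i < \dim A) b x (vbasis A)`_i *: (vbasis A)`_i.

Lemma riesz_linear A : linear (riesz A).
Proof.
move=> a x y; rewrite /riesz scaler_sumr -big_split; apply: eq_bigr => i _.
by rewrite formDl formZl scalerDl scalerA.
Qed.

Lemma riesz_mem A x : riesz A x \in A.
Proof.
apply: memv_suml => i _.
by rewrite memvZ // vbasis_mem // mem_nth ?size_tuple.
Qed.

Hypothesis b_linr : forall x, linear (b x : V -> K^o).

Lemma form_sumr I (r : seq I) (F : I -> V) c x :
  b x (\sum_(i <- r) c i *: F i) = \sum_(i <- r) c i * b x (F i).
Proof.
elim: r => [|i r IH].
  rewrite !big_nil -[0 in LHS](subrr (0 : V)) addrC -scaleN1r.
  by rewrite (b_linr x (-1) 0 0) /= scaleN1r addNr.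
by rewrite !big_cons (b_linr x) IH.
Qed.

Lemma riesz_eq A x x' : riesz A x = riesz A x' ->
  forall y, y \in A -> b x y = b x' y.
Proof.
move=> e y yA; have fA := basis_free (vbasisP A).
rewrite (coord_vbasis yA) !form_sumr; apply: eq_bigr => i _; congr (_ * _).
have := congr1 (coord (vbasis A) i) e.
by rewrite /riesz !(coord_sum_free (fun j => b _ (vbasis A)`_j)).
Qed.

(** By the hypothesis on C, [riesz A] is injective on C. *)
Lemma pairing_image (A C : {vspace V}) :
    (forall x, x \in C -> (forall y, y \in A -> b x y = 0) -> x = 0) ->
  (\dim C <= \dim A)%N /\ (\dim C = \dim A -> forall x, exists2 c, c \in C &
     forall y, y \in A -> b c y = b x y).
Proof.
move=> nd; pose Fm := GRing.isLinear.Build K V V _ (riesz A) (riesz_linear A).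
pose F : {linear V -> V} := HB.pack (riesz A) Fm.
have FE x : linfun F x = riesz A x by rewrite lfunE.
have kerF : (C :&: lker (linfun F) = 0)%VS.
  apply/eqP; rewrite -subv0; apply/subvP => x /memv_capP[xC].
  rewrite memv_ker FE => /eqP Fx; rewrite memv0; apply/eqP/nd => // y yA.
  have F0 : riesz A 0 = 0.
    by rewrite /riesz big1 // => i _; rewrite form0l scale0r.
  by rewrite (@riesz_eq A x 0) ?form0l // Fx F0.
have dF := limg_dim_eq kerF.
have sF : (linfun F @: C <= A)%VS.
  by apply/subvP => _ /memv_imgP[x _ ->]; rewrite FE riesz_mem.
split; first by rewrite -dF dimvS.
move=> e x; have imF : (linfun F @: C)%VS = A.
  by apply/eqP; rewrite eqEdim sF dF e leqnn.
have := riesz_mem A x; rewrite -{2}imF => /memv_imgP[c cC].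
by rewrite FE => /esym/riesz_eq bc; exists c.
Qed.

Lemma dim_pairing (A C : {vspace V}) :
    (forall x, x \in C -> (forall y, y \in A -> b x y = 0) -> x = 0) ->
  (\dim C <= \dim A)%N.
Proof. by case/pairing_image. Qed.

End Pairing.

Lemma inspec_and (K : fieldType) (V : vectType K) (T : 'End(V)) (P Q : pred K) x :
  inspec T P x -> inspec T Q x -> inspec T (predI P Q) x.
Proof.
move=> [l Pl lx] Qx; have [p [q [e px qx]]] := inspec_filter Q lx.
have q0 : peval T q x = 0.
  apply: (@inspec_disjoint _ _ T Q (predC Q)) => [a /= ->//||].
    exact: inspec_peval.
  by exists (filter (predC Q) l) => //; apply: filter_all.
exists (filter Q l); last by rewrite e q0 addr0.
by apply/allP => a; rewrite mem_filter => /andP[Qa /(allP Pl) /= ->].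
Qed.

(** * Graded semisimple Lie algebras and their degree -1 part *)

Lemma graded_ind (K : fieldType) (L : lieVectType K) (gr : int -> {vspace L})
    (gradedL : graded_lie (fun p => gr p)) (Q : L -> Prop) :
    (forall x y, Q x -> Q y -> Q (x + y)) ->
  (forall p x, x \in gr p -> Q x) -> forall x, Q x.
Proof.
move=> QD Qgr x; have [s [f [fgr ->]]] := graded_span gradedL x.
elim: s => [|p s IH]; first by rewrite big_nil; apply: (Qgr 0); apply: mem0v.
by rewrite big_cons; apply: QD IH; apply: (Qgr p); apply: fgr.
Qed.

Section Graded.

Variables (K : numClosedFieldType) (L : lieVectType K) (gr : int -> {vspace L}).
Variable (E : L).
Hypothesis gradedL : graded_lie (fun p => gr p).
Hypothesis transL : transitive_gla (fun p => gr p).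
Hypothesis ssL : lie_semisimple L.
Hypothesis E0 : E \in gr 0.
Hypothesis Egr : forall p x, x \in gr p -> lie E x = p%:~R *: x.

Implicit Types (p q : int) (x y z A : L) (U W S I J : {vspace L}).

Lemma gr_lie p q x y : x \in gr p -> y \in gr q -> lie x y \in gr (p + q).
Proof. exact: (graded_lieP gradedL). Qed.

(** The projection on degree p is a polynomial in ad E, so it preserves the ad
E-stable subspaces, in particular the ideals. *)
Lemma gr_projection p : exists P : {poly K},
  [/\ forall x, peval (ad E) P x \in gr p,
      forall x, lie E x = p%:~R *: x -> peval (ad E) P x = x &
      forall q x, q != p -> x \in gr q -> peval (ad E) P x = 0].
Proof.
have [_ [P [_ _ Pc]]] := twist_poly (ad E) (fun a => (a == p%:~R)%:R).
have PE q x : lie E x = q%:~R *: x -> peval (ad E) P x = (q == p)%:R *: x.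
  move=> Ex; rewrite (Pc q%:~R) ?eqr_int //.
  by apply: eig_inspec; rewrite adE.
exists P; split=> [x|x /PE->|q x /negbTE qp /Egr/PE->].
- elim/(graded_ind gradedL): x => [x y Px Py|q x xq]; first by rewrite linearD memvD.
  rewrite (PE _ _ (Egr xq)); case: (eqVneq q p) => [<-|_]; first by rewrite scale1r.
  by rewrite scale0r mem0v.
- by rewrite eqxx scale1r.
by rewrite qp scale0r.
Qed.

Lemma eig_gr p x : lie E x = p%:~R *: x -> x \in gr p.
Proof. by have [P [Pgr P1 _]] := gr_projection p => /P1 <-. Qed.

(** A nonzero ad E-stable subspace contains an eigenvector of ad E, and eigenvectors
of ad E are homogeneous. *)
Lemma stable_homogeneous S : ad_stable E S ->
  (forall p x, x \in S -> x \in gr p -> x = 0) -> S = 0%VS.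
Proof.
move=> ES S0; apply/eqP/negPn/negP => nS.
have aS x : x \in S -> ad E x \in S by rewrite adE; apply: ES.
have [a [x [xS x0 Ex]]] := eigenvector_exists aS nS.
have: inspec (ad E) (fun a => `[< exists p : int, a = p%:~R >]) x.
  elim/(graded_ind gradedL): (x) => [u v|p u up]; first exact: inspecD.
  apply: inspecW (eig_inspec (a := p%:~R) _); last by rewrite adE (Egr up).
  by move=> c /= /eqP->; apply/asboolP; exists p.
move=> /inspec_eig/(_ Ex x0)/asboolP[p ap].
move: x0; rewrite (S0 p x) ?eqxx //; apply: eig_gr.
by rewrite -ap -Ex adE.
Qed.

Lemma kf_gr p q x y : x \in gr p -> y \in gr q -> p + q != 0 -> kf x y = 0.
Proof.
move=> xp yq pq; have : (p + q)%:~R * kf x y = 0.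
  have := kf_inv x E y; rewrite (Egr yq) kfZr lieC (Egr xp) kfNl kfZl.
  by rewrite intrD mulrDl => <-; rewrite subrr.
by move=> /eqP; rewrite mulf_eq0 intr_eq0 (negbTE pq) => /eqP.
Qed.

Lemma kf_nd x : (forall y, kf x y = 0) -> x = 0.
Proof. exact: kf_nondegenerate. Qed.

Lemma kf_gr_nd p q x : x \in gr p -> p + q = 0 ->
  (forall y, y \in gr q -> kf x y = 0) -> x = 0.
Proof.
move=> xp pq0 xq; apply: kf_nd; apply: (graded_ind gradedL) => [y z|r y yr].
  by rewrite kfDr => -> ->; rewrite addr0.
have [rq|rq] := eqVneq r q; first by apply: xq; rewrite -rq.
by apply: kf_gr xp yr _; rewrite -pq0 (inj_eq (addrI p)).
Qed.

Definition g0set : set L := [set A | A \in gr 0]%classic.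

Local Notation submod := (submodule g0set (gr (-1))).
Local Notation irrmod := (irreducible_module g0set).

(** The element of degree 0 representing A |-> - tr (A | U). The condition is put on
all derivations D, and not only on the inner ones ad A, in order to apply it to
the conjugate of ad z; for sums of brackets of U with L_1 it holds by
[tr_ad_lie]. *)
Definition trace_dual U z := z \in gr 0 /\
  forall D : 'End(L), lie_derivation D -> (forall x, x \in U -> D x \in U) ->
    tr_ad D z = - trS U D.

(** The coordinates on U are represented by kf, and elements of U only see the degree
1 component of the representing vectors. *)
Lemma dual_family U : (U <= gr (-1))%VS -> exists v : 'I_(\dim U) -> L,
  (forall i, v i \in gr 1) /\
  forall i u, u \in U -> kf u (v i) = coord (vbasis U) i u.
Proof.
move=> sU; suff vE i : exists v, v \in gr 1 /\
    forall u, u \in U -> kf u v = coord (vbasis U) i u.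
  by have [v vP] := choice vE; exists v; split=> i; have [] := vP i.
have [w wE] : exists w, forall x, kf x w = coord (vbasis U) i x.
  apply: (kf_represent kf_nd) => a x y; exact: linearP.
have [P [Pgr P1 P0]] := gr_projection 1.
exists (peval (ad E) P w); split=> // u /(subvP sU) ug; rewrite -wE.
elim/(graded_ind gradedL): (w) => [x y e1 e2|p x xp].
  by rewrite linearD !kfDr /= e1 e2.
have [p1|p1] := eqVneq p 1; first by rewrite P1 // -p1 (Egr xp).
rewrite (P0 p) // kf0r (kf_gr ug xp) //.
by rewrite addrC subr_eq0.
Qed.

Lemma trace_dual_of_family U (v : 'I_(\dim U) -> L) : (U <= gr (-1))%VS ->
    (forall i, v i \in gr 1) ->
    (forall i u, u \in U -> kf u (v i) = coord (vbasis U) i u) ->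
  trace_dual U (- \sum_(i < \dim U) lie (vbasis U)`_i (v i)).
Proof.
move=> sU vgr vE.
have uU (i : 'I_(\dim U)) : (vbasis U)`_i \in U.
  by rewrite vbasis_mem // mem_nth ?size_tuple.
split.
  rewrite memvN memv_suml // => i _.
  by rewrite -[0 : int](addNr 1) gr_lie ?(subvP sU) ?uU.
move=> D derD DU; have tr_adN t : tr_ad D (- t) = - tr_ad D t by apply: linearN.
rewrite tr_adN; congr (- _); have tr_adS (f : 'I_(\dim U) -> L) :
  tr_ad D (\sum_i f i) = \sum_i tr_ad D (f i) by apply: linear_sum.
rewrite tr_adS; by apply: eq_bigr => i _; rewrite /= tr_ad_lie // vE // DU.
Qed.

Section OneModule.

Variable U : {vspace L}.
Hypothesis Umod : submod U.

Let sU : (U <= gr (-1))%VS. Proof. by case: Umod. Qed.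
Let UA A x : A \in gr 0 -> x \in U -> lie A x \in U.
Proof. by case: Umod => _; apply. Qed.

Lemma trace_dual_exists : exists z, trace_dual U z.
Proof.
have [v [vgr vE]] := dual_family sU.
by exists (- \sum_(i < \dim U) lie (vbasis U)`_i (v i)); apply: trace_dual_of_family.
Qed.

Variable z : L.
Hypothesis zU : trace_dual U z.

Lemma trace_dual_kf A : A \in gr 0 -> kf A z = - trS U (lie A).
Proof.
move=> A0; have [_ /(_ (ad A) (@ad_derivation _ _ A))] := zU.
have -> : tr_ad (ad A) z = kf A z by apply: trS_ext => t _; rewrite adE.
move=> ->; first by congr (- _); apply: trS_ext => t _; rewrite adE.
by move=> x xU; rewrite adE UA.
Qed.

Lemma trace_dual_unique z' : trace_dual U z' -> z' = z.
Proof.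
move=> [z'0 z'E]; have [z0 zE] := zU; apply/eqP; rewrite -subr_eq0; apply/eqP.
apply: (@kf_gr_nd 0 0); rewrite ?memvB ?addr0 // => A A0.
have derA := @ad_derivation _ _ A.
have aU x : x \in U -> ad A x \in U by move=> xU; rewrite adE UA.
have kE t : tr_ad (ad A) t = kf A t by apply: trS_ext => u _; rewrite adE.
by rewrite kfDl kfNl !(kfC _ A) -!kE z'E // zE // subrr.
Qed.

(** The trace on U vanishes on commutators. *)
Lemma trace_dual_central A : A \in gr 0 -> lie A z = 0.
Proof.
move=> A0; have z0 : z \in gr 0 by case: zU.
apply: (@kf_gr_nd 0 0); rewrite ?gr_lie ?addr0 //.
  by rewrite -[X in gr X](addr0 0) gr_lie.
move=> C C0; rewrite lieC kfNl kf_inv kfC.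
have AC0 : lie A C \in gr 0 by rewrite -[X in gr X](addr0 0) gr_lie.
rewrite trace_dual_kf // opprK.
rewrite (trS_ext (g := fun t => lie A (lie C t) + - lie C (lie A t))).
  rewrite trSD trSN; apply/eqP; rewrite subr_eq0; apply/eqP.
  by apply: (@trSC _ _ _ (lie A) (lie C)) => t tU; apply: UA.
by move=> t _; rewrite jacobi addrK.
Qed.

(** E acts as -1 on U. *)
Lemma trace_dual_E : kf E z = (\dim U)%:R.
Proof.
rewrite trace_dual_kf // (trS_scalar (a := -1)); last first.
  by move=> x /(subvP sU)/Egr; rewrite mulrN1z.
by rewrite mulNrn opprK.
Qed.

Lemma trace_dual_conj z' D : z' \in gr 0 -> conjugate_of_ad z' D ->
  tr_ad D z = (kf z' z)^*.
Proof.
move=> z'0 [derD /(_ U (fun x xU => UA z'0 xU))[DU trD]].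
by have [_ ->] := zU; rewrite // trD trace_dual_kf // rmorphN.
Qed.

End OneModule.

(** E commutes with z, so ad E o ad z is nilpotent as well. *)
Lemma gr0_nilpotent_kfE z n : z \in gr 0 -> (forall t, iter n (lie z) t = 0) ->
  kf E z = 0.
Proof.
move=> z0 zn; have Ez t : lie E (lie z t) = lie z (lie E t).
  by rewrite jacobi (Egr z0) scale0r lie0l add0r.
pose T : 'End(L) := (ad E \o ad z)%VF.
have TE t : T t = lie E (lie z t) by rewrite comp_lfunE !adE.
have TS x : x \in fullv -> T x \in fullv by rewrite !memvf.
have [s [_ trs _ rs]] := trS_spectrum TS.
have Ezm m t : lie E (iter m (lie z) t) = iter m (lie z) (lie E t).
  by elim: m => //= m IH; rewrite Ez IH.
have Tn m t : peval T 'X^m t = iter m (lie z) (iter m (lie E) t).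
  elim: m t => [|m IH] t.
    by rewrite expr0 -[1]/(1%:P) pevalC scale1r.
  by rewrite exprS pevalM pevalX TE IH Ez Ezm.
have /rs/allP s0 : forall x, x \in fullv -> peval T 'X^n x = 0.
  by move=> x _; rewrite Tn zn.
transitivity (trS {:L} (peval T 'X)).
  by apply: trS_ext => t _; rewrite pevalX TE.
rewrite trs big_seq big1 // => a /s0; rewrite /root hornerXn hornerX.
by rewrite expf_eq0 => /andP[_ /eqP].
Qed.

Lemma exists_irreducible W : submod W -> W <> 0%VS ->
  exists U, [/\ submod U, (U <= W)%VS & irrmod U].
Proof.
move=> [sW WA] W0.
pose p d := `[< exists U, [/\ \dim U = d, U <> 0%VS, submod U & (U <= W)%VS] >].
have p0 : exists d, p d by exists (\dim W); apply/asboolP; exists W.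
case: (ex_minnP p0) => d /asboolP[U [dU U0 [sU UA] sUW]] dmin.
exists U; split=> //; split=> // S [sSU SA].
have [->|/eqP S0] := eqVneq S 0%VS; [by left | right].
apply/eqP; rewrite eqEdim sSU dU; apply: dmin; apply/asboolP; exists S.
by split=> //; [split=> //; apply: subv_trans sSU sU | apply: subv_trans sSU sUW].
Qed.

Lemma schur U z : submod U -> irrmod U -> z \in gr 0 ->
    (forall A, A \in gr 0 -> lie A z = 0) ->
  exists c, forall u, u \in U -> lie z u = c *: u.
Proof.
move=> [sU UA] [/eqP U0 Uirr] z0 cz.
have zU x : x \in U -> ad z x \in U by rewrite adE; apply: UA.
have [c [x [xU x0 zx]]] := eigenvector_exists zU U0; rewrite adE in zx.
pose P y := y \in U /\ lie z y = c *: y.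
have P0 : P 0 by rewrite /P mem0v lie0r scaler0.
have Plin a y t : P y -> P t -> P (a *: y + t).
  move=> [yU zy] [tU zt]; split; first by rewrite memvD ?memvZ.
  by rewrite lieDr lieZr zy zt scalerDr !scalerA mulrC.
have [S SP] := vspace_of_pred P0 Plin; exists c => u uU.
have [|S0|SU] := Uirr S; last by have /SP[] : u \in S by rewrite SU.
  split; first by apply/subvP => y /SP[].
  move=> A y A0 /SP[yU zy]; apply/SP; split; first exact: UA.
  by rewrite jacobi (_ : lie z A = 0) ?lie0l ?add0r ?zy ?lieZr // lieC cz ?oppr0.
have : x \in S by apply/SP.
by rewrite S0 memv0 (negbTE x0).
Qed.

Lemma spectral_submodule z (P : pred K) : z \in gr 0 ->
    (forall A, A \in gr 0 -> lie A z = 0) ->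
  exists2 N, submod N & forall x, x \in N <-> x \in gr (-1) /\ inspec (ad z) P x.
Proof.
move=> z0 cz; pose Q x := x \in gr (-1) /\ inspec (ad z) P x.
have Q0 : Q 0 by split; [apply: mem0v | apply: inspec0].
have Qlin a x y : Q x -> Q y -> Q (a *: x + y).
  move=> [x1 x2] [y1 y2]; split; first by rewrite memvD ?memvZ.
  exact: inspec_lin.
have [N NQ] := vspace_of_pred Q0 Qlin; exists N => //.
split; first by apply/subvP => x /NQ[].
move=> A x A0 /NQ[xg xP]; apply/NQ; split.
  by rewrite -[-1 : int]add0r gr_lie.
apply: (inspec_comm (f := lie A)) xP => y.
by rewrite !adE [RHS]jacobi [lie z A]lieC cz // oppr0 lie0l add0r.
Qed.

Lemma gr_stable z p x : z \in gr 0 -> x \in gr p -> ad z x \in gr p.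
Proof. by move=> z0 xp; rewrite adE -[p]add0r gr_lie. Qed.

(** The action of z on U is by Schur's lemma a scalar -a, and
a dim U = kf z z > 0: if kf z z were zero, z would be nilpotent, which
[trace_dual_E] excludes. By [annihilated_positive_eq0] the positive part of L_1
has no vector orthogonal to U; hence it is dual to U, and by duality the
negative part of L_{-1} is U. *)
Lemma irreducible_trace_dual U : submod U -> irrmod U -> exists z a,
  [/\ [/\ trace_dual U z, 0 < a & kf z z = a *+ \dim U],
      forall u, u \in U -> lie z u = - a *: u,
      forall x, inspec (ad z) (fun c => c \is Num.real) x &
      forall x, x \in gr (-1) -> inspec (ad z) (fun c => c < 0) x -> x \in U].
Proof.
move=> Umod Uirr; have [sU UA] := Umod; have [U0 _] := Uirr.
have [z zU] := trace_dual_exists Umod; have [z0 _] := zU.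
have cz A : A \in gr 0 -> lie A z = 0 by apply: trace_dual_central Umod _ zU _.
have [kz_ge0 zreal znil] : [/\ 0 <= kf z z,
    forall x, inspec (ad z) (fun a => a \is Num.real) x &
    kf z z = 0 -> exists n, forall t, iter n (lie z) t = 0].
  by apply: real_spectrum_of_conjugate => D; apply: trace_dual_conj Umod _ zU _ _ _.
have dU : (0 < \dim U)%N by rewrite lt0n dimv_eq0; apply/eqP.
have [c zc] := schur Umod Uirr z0 cz; pose a := - c.
have kzE : kf z z = a *+ \dim U.
  by rewrite (trace_dual_kf Umod) // (trS_scalar zc) mulNrn.
have a_gt0 : 0 < a.
  have: 0 < kf z z.
    rewrite lt_def kz_ge0 andbT; apply/eqP => /znil[n zn].
    have := gr0_nilpotent_kfE z0 zn; rewrite (trace_dual_E Umod) // => /eqP.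
    by rewrite pnatr_eq0 eqn0Ngt dU.
  by rewrite kzE pmulrn_lgt0.
have zu u : u \in U -> lie z u = - a *: u by rewrite opprK; apply: zc.
exists z, a; split=> //.
have uspec u : u \in U -> inspec (ad z) (pred1 (- a)) u.
  by move=> uU; apply: eig_inspec; rewrite adE zu.
(* V is the positive part of L_1 with respect to z. The dual family can be chosen
   in V, since vectors of L_1 in the other eigenspaces are orthogonal to U. *)
pose PV v := v \in gr 1 /\ inspec (ad z) (fun c => 0 < c) v.
have PV0 : PV 0 by split; [apply: mem0v | apply: inspec0].
have PVlin d x y : PV x -> PV y -> PV (d *: x + y).
  move=> [x1 x2] [y1 y2]; split; first by rewrite memvD ?memvZ.
  exact: inspec_lin.
have [V VP] := vspace_of_pred PV0 PVlin.
have posV v : v \in gr 1 -> exists w, [/\ w \in V, v - w \in gr 1,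
    inspec (ad z) (predC (fun c => 0 < c)) (v - w) &
    forall u, u \in U -> kf u w = kf u v].
  move=> v1; have [p [q [e pv qv]]] := inspec_split (ad z) (fun c => 0 < c) v.
  have ev : v - peval (ad z) p v = peval (ad z) q v by rewrite {1}e addrC addKr.
  have p1 : peval (ad z) p v \in gr 1 by apply: peval_stable v1 => x; apply: gr_stable.
  exists (peval (ad z) p v); rewrite ev; split=> //; first by apply/VP.
    by rewrite -ev memvB.
  move=> u uU; rewrite {2}e kfDr [X in _ + X](kf_orthogonal _ (uspec u uU) qv) ?addr0 //.
  move=> r s /= /eqP-> s0; apply: contraNneq s0 => /eqP.
  by rewrite addrC subr_eq0 => /eqP->.
have [w [wV wE]] : exists w : 'I_(\dim U) -> L, (forall i, w i \in V) /\
    forall i u, u \in U -> kf u (w i) = coord (vbasis U) i u.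
  have [v [v1 vE]] := dual_family sU.
  have wE i : exists w, w \in V /\ forall u, u \in U -> kf u w = coord (vbasis U) i u.
    have [w [wV _ _ wv]] := posV _ (v1 i); exists w; split=> // u uU.
    by rewrite wv // vE.
  by have [w wP] := choice wE; exists w; split=> i; have [] := wP i.
have w1 i : w i \in gr 1 by have /VP[] := wV i.
have uiU (i : 'I_(\dim U)) : (vbasis U)`_i \in U.
  by rewrite vbasis_mem // mem_nth ?size_tuple.
have zUV : z \in lie_prodv U V.
  rewrite -(trace_dual_unique Umod zU (trace_dual_of_family sU w1 wE)).
  by rewrite memvN memv_suml // => i _; rewrite mem_lie_prodv.
pose PX x := x \in V /\ forall u, u \in U -> kf u x = 0.
have PX0 : PX 0 by split=> [|u _]; rewrite ?mem0v ?kf0r.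
have PXlin d x y : PX x -> PX y -> PX (d *: x + y).
  move=> [x1 x2] [y1 y2]; split=> [|u uU]; first by rewrite memvD ?memvZ.
  by rewrite kfDr kfZr x2 // y2 // mulr0 addr0.
have [X XP] := vspace_of_pred PX0 PXlin.
have VA A v : A \in gr 0 -> v \in V -> lie A v \in V.
  move=> A0 /VP[v1 vp]; apply/VP; split; first by rewrite -[1 : int]add0r gr_lie.
  apply: (inspec_comm (f := lie A)) vp => y.
  by rewrite !adE [RHS]jacobi [lie z A]lieC cz // oppr0 lie0l add0r.
have X0 : X = 0%VS.
  apply: (annihilated_positive_eq0 (U := U) (V := V) (H := gr 0) (z := z)) => //.
  - move=> u v /(subvP sU) ug /VP[v1 _].
    by rewrite -[0 : int](addNr 1) gr_lie.
  - move=> A x A0 /XP[xV xU]; apply/XP; split; first exact: VA.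
    by move=> u uU; rewrite -kf_inv lieC kfNl xU ?oppr0 // UA.
  - move=> u x uU /XP[/VP[x1 _] xU].
    apply: (@kf_gr_nd 0 0); rewrite ?addr0 //.
      by rewrite -[0 : int](addNr 1) gr_lie // (subvP sU).
    by move=> A A0; rewrite kfC -kf_inv xU // UA.
  - by move=> v /VP[_]; apply: inspecW => r /ltW.
  by move=> x /XP[/VP[]].
(* With X = 0, the family w is a basis of V; subtracting from x its component
   along U leaves a vector orthogonal to V, and to the rest of L_1 for reasons
   of eigenvalues. *)
move=> x xg xneg; pose x' := x - \sum_(i < \dim U) kf x (w i) *: (vbasis U)`_i.
have sumU : \sum_(i < \dim U) kf x (w i) *: (vbasis U)`_i \in U.
  by rewrite memv_suml // => i _; rewrite memvZ.
have fU := basis_free (vbasisP U).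
have x'w i : kf x' (w i) = 0.
  rewrite /x' kfDl kfNl (wE _ _ sumU).
  by rewrite (coord_sum_free (fun j => kf x (w j))) // subrr.
have x'g : x' \in gr (-1) by rewrite memvB // (subvP sU).
have x'neg : inspec (ad z) (fun c => c < 0) x'.
  apply: inspecD => //; rewrite -scaleN1r; apply: inspecZ.
  by apply: inspecW (uspec _ sumU) => d /= /eqP->; rewrite oppr_lt0.
suff x'0 : x' = 0 by move/eqP: x'0; rewrite subr_eq0 => /eqP->.
apply: (@kf_gr_nd (-1) 1) => // v v1.
have [t [tV _ tneg tE]] := posV v v1.
rewrite -[v](subrK t) kfDr (kf_orthogonal _ x'neg tneg) ?add0r; last first.
  move=> r s /= r0; apply: contra => /eqP e.
  by rewrite -(addKr r s) e addr0 oppr_gt0.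
have -> : t = \sum_(i < \dim U) kf (vbasis U)`_i t *: w i.
  apply/eqP; rewrite -subr_eq0 -memv0 -X0; apply/XP; split.
    by rewrite memvB // memv_suml // => i _; rewrite memvZ.
  move=> u uU; rewrite kfDr kfNr; apply/eqP; rewrite subr_eq0; apply/eqP.
  rewrite {1}(coord_vbasis uU) kfC [LHS](linear_sum (kf t)) /=.
  have -> : kf u (\sum_(i < \dim U) kf (vbasis U)`_i t *: w i) =
    \sum_(i < \dim U) kf u (kf (vbasis U)`_i t *: w i) by apply: linear_sum.
  by apply: eq_bigr => i _; rewrite !kfZr wE // mulrC kfC.
have -> : kf x' (\sum_(i < \dim U) kf (vbasis U)`_i t *: w i) =
    \sum_(i < \dim U) kf x' (kf (vbasis U)`_i t *: w i) by apply: linear_sum.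
by rewrite big1 // => i _; rewrite kfZr x'w mulr0.
Qed.

(** * Conformal forms on the degree -1 part *)

Section Conformal.

Variable b : L -> L -> K.
Hypothesis b_linl : forall y, linear (b^~ y : L -> K^o).
Hypothesis b_linr : forall x, linear (b x : L -> K^o).
Hypothesis b_sym : forall x y, x \in gr (-1) -> y \in gr (-1) -> b x y = b y x.
Hypothesis b_nd : forall x, x \in gr (-1) ->
  (forall y, y \in gr (-1) -> b x y = 0) -> x = 0.
Hypothesis b_co : forall A, A \in gr 0 -> co_on (gr (-1)) b (lie A).

Lemma conformal_orthogonal z eta (P Q : pred K) x y : z \in gr 0 ->
    (forall x y, x \in gr (-1) -> y \in gr (-1) ->
       b (lie z x) y + b x (lie z y) = eta * b x y) ->
    (forall c d, P c -> Q d -> c + d != eta) ->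
    x \in gr (-1) -> y \in gr (-1) ->
  inspec (ad z) P x -> inspec (ad z) Q y -> b x y = 0.
Proof.
move=> z0 zeta PQ xg yg.
apply: (@form_orthogonal _ _ _ (ad z) (ad z) eta b (gr (-1)) (gr (-1))) PQ _ _ => //.
- by move=> t; apply: gr_stable.
- by move=> t; apply: gr_stable.
by move=> u v ug vg; rewrite !adE zeta.
Qed.

(** Conformal maps preserve orthogonality. *)
Lemma ortho_submodule U W : submod U -> submod W ->
  exists2 N, submod N & forall x, x \in N <->
    x \in U /\ forall w, w \in W -> b x w = 0.
Proof.
move=> [sU UA] [sW WA]; pose Q x := x \in U /\ forall w, w \in W -> b x w = 0.
have Q0 : Q 0 by split=> [|w _]; rewrite ?mem0v ?(form0l b_linl).
have Qlin a x y : Q x -> Q y -> Q (a *: x + y).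
  move=> [x1 x2] [y1 y2]; split=> [|w wW]; first by rewrite memvD ?memvZ.
  by rewrite (formDl b_linl) (formZl b_linl) x2 // y2 // mulr0 addr0.
have [N NQ] := vspace_of_pred Q0 Qlin; exists N => //; split.
  by apply/subvP => x /NQ[/(subvP sU)].
move=> A x A0 /NQ[xU xW]; apply/NQ; split=> [|w wW]; first exact: UA.
have [eta /(_ x w (subvP sU _ xU) (subvP sW _ wW))] := b_co A0.
by rewrite !xW ?WA // mulr0 addr0.
Qed.

Lemma spectral_split z (P : pred K) x : z \in gr 0 -> x \in gr (-1) ->
  exists p q : L, [/\ x = p + q, p \in gr (-1), q \in gr (-1),
     inspec (ad z) P p & inspec (ad z) (predC P) q].
Proof.
move=> z0 xg; have [p [q [e px qx]]] := inspec_split (ad z) P x.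
exists (peval (ad z) p x), (peval (ad z) q x); split=> //.
  by apply: peval_stable xg => t; apply: gr_stable.
by apply: peval_stable xg => t; apply: gr_stable.
Qed.

Lemma real_nonneg (c : K) : c \is Num.real -> ~~ (c < 0) -> 0 <= c.
Proof. by move=> cR; rewrite real_ltNge ?real0 // negbK. Qed.

(** The spectrum of z is real and its negative part on L_{-1} is contained in U. *)
Lemma irreducible_split U z : z \in gr 0 ->
    (forall x, inspec (ad z) (fun c => c \is Num.real) x) ->
    (forall x, x \in gr (-1) -> inspec (ad z) (fun c => c < 0) x -> x \in U) ->
  forall x, x \in gr (-1) -> exists p q : L, [/\ x = p + q, p \in U,
    inspec (ad z) (fun c => c < 0) p, q \in gr (-1) & inspec (ad z) (fun c => 0 <= c) q].
Proof.
move=> z0 zreal zU x xg.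
have [p [q [-> pg qg ps qs]]] := spectral_split (fun c => c < 0) z0 xg.
exists p, q; split=> //; first exact: zU.
apply: inspecW (inspec_and (zreal q) qs) => c /= /andP[].
exact: real_nonneg.
Qed.

Section Dichotomy.

Variables (U : {vspace L}) (z : L) (a eta : K).
Hypothesis Umod : submod U.
Hypothesis Uirr : irrmod U.
Hypothesis zU : trace_dual U z.
Hypothesis a_gt0 : 0 < a.
Hypothesis zu : forall u, u \in U -> lie z u = - a *: u.
Hypothesis zreal : forall x, inspec (ad z) (fun c => c \is Num.real) x.
Hypothesis zneg : forall x, x \in gr (-1) ->
  inspec (ad z) (fun c => c < 0) x -> x \in U.
Hypothesis z_eta : forall x y, x \in gr (-1) -> y \in gr (-1) ->
  b (lie z x) y + b x (lie z y) = eta * b x y.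

Let sU : (U <= gr (-1))%VS. Proof. by case: Umod. Qed.
Let z0 : z \in gr 0. Proof. by case: zU. Qed.
Let cz A : A \in gr 0 -> lie A z = 0.
Proof. exact: trace_dual_central Umod _ zU _. Qed.
Let uspec u : u \in U -> inspec (ad z) (pred1 (- a)) u.
Proof. by move=> uU; apply: eig_inspec; rewrite adE zu. Qed.

(** On vectors u, v of U with b u v <> 0 the conformal factor of z is -2a; then a
vector in the nonnegative part of z is orthogonal to everything. *)
Lemma nonisotropic_irreducible u v : u \in U -> v \in U -> b u v != 0 ->
  gr (-1) = U.
Proof.
move=> uU vU buv; have etaE : eta = - a - a.
  apply/eqP; rewrite eq_sym -subr_eq0; apply/eqP.
  have := z_eta (subvP sU _ uU) (subvP sU _ vU).
  rewrite (zu uU) (zu vU) (formZl b_linl).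
  have -> : b u (- a *: v) = - a * b u v.
    have [ug vg] := (subvP sU _ uU, subvP sU _ vU).
    by rewrite (b_sym ug (memvZ _ vg)) (formZl b_linl) (b_sym vg ug).
  by rewrite -mulrDl => /(mulIf buv)->; rewrite subrr.
apply/eqP; rewrite eqEsubv sU andbT; apply/subvP => x xg.
have [p [q [-> pU pneg qg qpos]]] := irreducible_split z0 zreal zneg xg.
suff -> : q = 0 by rewrite addr0.
apply: b_nd => // y yg.
have [s [t [-> sU' sneg tg tpos]]] := irreducible_split z0 zreal zneg yg.
have sg := subvP sU _ sU'.
rewrite (b_sym qg (memvD sg tg)) (formDl b_linl).
rewrite (conformal_orthogonal z0 z_eta _ sg qg (uspec sU') qpos).
  rewrite add0r; apply: (conformal_orthogonal z0 z_eta _ tg qg tpos qpos).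
  move=> c d c0 d0; rewrite etaE; apply: contraTneq (addr_ge0 c0 d0) => ->.
  by rewrite -real_ltNge ?real0 ?rpredB ?rpredN ?gtr0_real // -opprD oppr_lt0 addr_gt0.
move=> c d /= /eqP-> d0; rewrite etaE (inj_eq (addrI _)).
by apply: contraTneq d0 => ->; rewrite lt_geF // oppr_lt0.
Qed.

Hypothesis Uiso : totally_isotropic b U.

Let beta := eta + a.

(** As z is -a on U, only its eigenspace for eta + a can be paired with U. *)
Lemma pair_U x (P : pred K) u : u \in U -> x \in gr (-1) ->
  inspec (ad z) P x -> (forall d, P d -> d != beta) -> b u x = 0.
Proof.
move=> uU xg xP Pb; apply: (conformal_orthogonal z0 z_eta _ _ _ (uspec uU) xP).
- move=> c d /= /eqP-> /Pb; apply: contra => /eqP e.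
  by rewrite /beta -e; apply/eqP; ring.
- exact: (subvP sU).
exact: xg.
Qed.

(** The space W is the generalized eigenspace of z for eta + a, which is paired
perfectly with U. A nonzero submodule of W is still paired faithfully with U, as U
is irreducible; so it has the dimension of U and is all of W. *)
Lemma dual_module_exists : 0 <= beta /\ exists W,
  [/\ submod W, irrmod W, \dim W = \dim U,
      forall x, x \in W <-> x \in gr (-1) /\ inspec (ad z) (pred1 beta) x &
      forall w, w \in W -> lie z w = beta *: w].
Proof.
have [W Wmod WP] := spectral_submodule (pred1 beta) z0 cz.
have [u uU u0] : exists2 u, u \in U & u != 0.
  by exists (vpick U); rewrite ?memv_pick // vpick0; case: Uirr => /eqP.
have [y yg buy] : exists2 y, y \in gr (-1) & b u y != 0.
  apply: contrapT => ny; case/eqP: u0; apply: b_nd; first exact: (subvP sU).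
  by move=> y yg; apply/eqP/negPn/negP => buy; apply: ny; exists y.
have [p [q [ey pU pneg qg qpos]]] := irreducible_split z0 zreal zneg yg.
have buq : b u q != 0.
  have ug := subvP sU _ uU; have pg := subvP sU _ pU.
  move: buy; rewrite ey (b_sym ug (memvD pg qg)) (formDl b_linl).
  by rewrite [b p u]Uiso // add0r b_sym.
have beta_ge0 : 0 <= beta.
  apply: contraNT buq => nb; apply/eqP; apply: (pair_U uU qg qpos) => d d0.
  by apply: contraNneq nb => <-.
have betaU : - a != beta.
  by apply: contraTneq beta_ge0 => <-; rewrite lt_geF // oppr_lt0.
(* W is orthogonal to all the eigenspaces of z other than U. *)
have WU w : w \in W -> (forall u, u \in U -> b w u = 0) -> w = 0.
  move=> /WP[wg ws] wU; apply: b_nd => // x xg.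
  have [s [t [-> sU' _ tg tpos]]] := irreducible_split z0 zreal zneg xg.
  have sg := subvP sU _ sU'.
  rewrite (b_sym wg (memvD sg tg)) (formDl b_linl) (b_sym sg wg) wU // add0r.
  apply: (conformal_orthogonal z0 z_eta _ tg wg tpos ws) => c d c0 /= /eqP->.
  rewrite -subr_eq0 (_ : _ - eta = c + a) /beta; last by ring.
  by rewrite gt_eqF // ltr_wpDl.
have W_neq0 : W <> 0%VS.
  move=> W0; case/negP: buq.
  have [p1 [q1 [-> p1g q1g p1s q1s]]] := spectral_split (pred1 beta) z0 qg.
  have : p1 \in W by apply/WP.
  rewrite W0 memv0 => /eqP->; rewrite add0r.
  by rewrite (pair_U uU q1g q1s).
have dWU : (\dim W <= \dim U)%N.
  by apply: (dim_pairing b_linl b_linr) => x xW xU; apply: WU.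
have Wirr S : submodule g0set W S -> S <> 0%VS -> (\dim U <= \dim S)%N.
  move=> [sSW SA] S0; have Smod : submod S.
    by split=> //; apply: subv_trans sSW _; case: Wmod.
  have [N Nmod NP] := ortho_submodule Umod Smod.
  have [_ /(_ N)] := Uirr.
  have NU : submodule g0set U N.
    by split; [apply/subvP => x /NP[] | case: Nmod].
  move=> /(_ NU)[N0|NU']; last first.
    case: S0; apply/eqP; rewrite -subv0; apply/subvP => w wS.
    rewrite memv0; apply/eqP/WU => [|v vU]; first exact: (subvP sSW).
    have /NP[_ /(_ w wS)] : v \in N by rewrite NU'.
    have [/subvP sSg _] := Smod.
    by rewrite (b_sym (subvP sU _ vU) (sSg _ wS)).
  apply: (dim_pairing b_linl b_linr) => x xU xS.
  by apply/eqP; rewrite -memv0 -N0; apply/NP.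
split=> //; exists W; split=> //.
- split=> // S SW; have [->|/eqP S0] := eqVneq S 0%VS; [by left | right].
  apply/eqP; rewrite eqEdim (leq_trans dWU) ?Wirr // andbT.
  by case: SW.
- apply/eqP; rewrite eqn_leq dWU Wirr //.
  by split=> //; case: Wmod.
move=> w wW; have Wi : irrmod W.
  split=> // S SW; have [->|/eqP S0] := eqVneq S 0%VS; [by left | right].
  apply/eqP; rewrite eqEdim (leq_trans dWU) ?Wirr // andbT.
  by case: SW.
have [c zc] := schur Wmod Wi z0 cz.
suff cb : c = beta by rewrite -cb zc.
have W0 : vpick W != 0 by rewrite vpick0; apply/eqP.
have pW := memv_pick W; have /WP[_ ps] := pW.
by have /= /eqP := inspec_eig ps (etrans (adE _ _) (zc _ pW)) W0.
Qed.

End Dichotomy.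

(** It remains to see that the orthogonal complement T of U + W vanishes. On T both
z = z_U and y = z_W have nonnegative eigenvalues, while their conformal factors
are sums of two such eigenvalues when T <> 0. For x = z + y this gives
kf x x = - (eta + eta') dim U <= 0; but x has a real spectrum, so kf x x = 0 and x
is nilpotent, whereas kf E x = dim U + dim W. *)
Theorem conformal_decomposition : gr (-1) <> 0%VS -> irrmod (gr (-1)) \/
  exists U W z c d, [/\ submod U /\ submod W, irrmod U /\ irrmod W,
    gr (-1) = (U + W)%VS /\ (U :&: W = 0)%VS,
    totally_isotropic b U /\ totally_isotropic b W &
    [/\ z \in gr 0, c != d, forall u, u \in U -> lie z u = c *: u &
        forall w, w \in W -> lie z w = d *: w]].
Proof.
move=> g0; have gmod : submod (gr (-1)).
  split=> // A x A0 xg; by rewrite -[-1 : int]add0r gr_lie.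
have [U [Umod _ Uirr]] := exists_irreducible gmod g0.
have [z [a [[zU a_gt0 kz] zu zreal zneg]]] := irreducible_trace_dual Umod Uirr.
have [z0 _] := zU; have [sU _] := Umod.
have [eta z_eta] := b_co z0.
have [Uiso|] := pselect (totally_isotropic b U); last first.
  move=> nU; left; suff -> : gr (-1) = U by [].
  have [u [v [uU vU buv]]] : exists u v, [/\ u \in U, v \in U & b u v != 0].
    apply: contrapT => nb; apply: nU => u v uU vU; apply/eqP/negPn/negP => buv.
    by apply: nb; exists u, v.
  exact: (nonisotropic_irreducible Umod zU a_gt0 zu zreal zneg z_eta uU vU buv).
right.
have [beta_ge0 [W [Wmod Wirr dW WP zw]]] :=
  dual_module_exists Umod Uirr zU a_gt0 zu zreal zneg z_eta Uiso.
set beta := eta + a in beta_ge0 WP zw.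
have UW0 : (U :&: W = 0)%VS.
  apply/eqP; rewrite -subv0; apply/subvP => x /memv_capP[xU xW].
  rewrite memv0; have : (beta + a) *: x == 0.
    by rewrite scalerDl -(zw _ xW) (zu _ xU) scaleNr addNr.
  by rewrite scaler_eq0 gt_eqF // ltr_wpDl.
have W_neq0 : W <> 0%VS by case: Wirr.
have sW : (W <= gr (-1))%VS by case: Wmod.
have Wiso : totally_isotropic b W.
  move=> x y xW yW; have /WP[xg xs] := xW; have /WP[yg ys] := yW.
  apply: (conformal_orthogonal z0 z_eta _ xg yg xs ys) => c d /= /eqP-> /eqP->.
  rewrite -subr_eq0 (_ : _ - eta = beta + a) /beta; last by ring.
  by rewrite gt_eqF // ltr_wpDl.
exists U, W, z, (- a), beta; split=> //; last first.
  split=> //; apply: contraTneq beta_ge0 => <-.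
  by rewrite lt_geF // oppr_lt0.
split=> //.
have cz A : A \in gr 0 -> lie A z = 0 by apply: trace_dual_central Umod _ zU _.
(* T is the sum of the generalized eigenspaces of z other than U and W. *)
have [T Tmod TP] := spectral_submodule (fun c => (0 <= c) && (c != beta)) z0 cz.
have gUWT x : x \in gr (-1) ->
    exists u w t, [/\ x = u + w + t, u \in U, w \in W & t \in T].
  move=> xg; have [p [q [-> pU _ qg qpos]]] := irreducible_split z0 zreal zneg xg.
  have [w [t [eq wg tg ws ts]]] := spectral_split (pred1 beta) z0 qg.
  exists p, w, t; rewrite eq addrA; split=> //; first by apply/WP.
  apply/TP; split=> //; have qs := qpos.
  have tpos : inspec (ad z) (fun c => 0 <= c) t.
    have -> : t = q - w by rewrite eq addrC addKr.
    apply: inspecD => //; rewrite -scaleN1r; apply: inspecZ.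
    by apply: inspecW ws => c /= /eqP->.
  by apply: inspecW (inspec_and tpos ts) => c.
suff T0 : T = 0%VS.
  apply/eqP; rewrite eqEsubv subv_add sU sW !andbT; apply/subvP => x.
  move=> /gUWT[u [w [t [-> uU wW]]]]; rewrite T0 memv0 => /eqP->.
  by rewrite addr0 memv_add.
apply/eqP/negPn/negP => T0.
have Tdual : exists t t', [/\ t \in T, t' \in T & b t t' != 0].
  apply: contrapT => nb; case/eqP: T0; apply/eqP; rewrite -subv0.
  apply/subvP => t tT; rewrite memv0; have /TP[tg ts] := tT.
  apply/eqP/b_nd => // _ /gUWT[u [w [t' [-> uU wW t'T]]]].
  have ug := subvP sU _ uU; have /WP[wg ws] := wW; have /TP[t'g _] := t'T.
  rewrite (b_sym tg (memvD (memvD ug wg) t'g)) !(formDl b_linl).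
  rewrite (pair_U Umod zU zu z_eta uU tg ts) => [|c /andP[] //].
  rewrite add0r (conformal_orthogonal z0 z_eta _ wg tg ws ts) ?add0r.
    by apply/eqP/negPn/negP => b0; apply: nb; exists t', t.
  move=> c d /= /eqP-> /andP[d0 _].
  rewrite -subr_eq0 (_ : _ - eta = d + a) /beta; last by ring.
  by rewrite gt_eqF // ltr_wpDl.
have [t [t' [tT t'T btt']]] := Tdual.
have /TP[tg ts] := tT; have /TP[t'g t's] := t'T.
have eta_ge0 : 0 <= eta.
  apply: contraNT btt' => neta; apply/eqP.
  apply: (conformal_orthogonal z0 z_eta _ tg t'g ts t's) => c d /andP[c0 _] /andP[d0 _].
  by apply: contraNneq neta => <-; rewrite addr_ge0.
have [y [a' [[yW a'_gt0 ky] yw yreal yneg]]] := irreducible_trace_dual Wmod Wirr.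
have [y0 _] := yW; have [eta' y_eta] := b_co y0.
have cy A : A \in gr 0 -> lie A y = 0 by apply: trace_dual_central Wmod _ yW _.
have TW0 x : x \in T -> x \in W -> x = 0.
  move=> /TP[xg xs] /WP[_ xs']; apply: inspec_disjoint xs xs' => c /=.
  by case/andP.
have Tpos x : x \in T -> inspec (ad y) (fun c => 0 <= c) x.
  move=> xT; have /TP[xg _] := xT.
  have [p [q [e pneg qneg]]] := inspec_split (ad y) (fun c => c < 0) x.
  have yT v : v \in T -> ad y v \in T by rewrite adE; case: Tmod => _; apply.
  have pT : peval (ad y) p x \in T by apply: peval_stable xT.
  have /TP[pg _] := pT.
  rewrite e (TW0 _ pT (yneg _ pg pneg)) add0r.
  apply: inspecW (inspec_and (yreal _) qneg) => c /= /andP[].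
  exact: real_nonneg.
have eta'_ge0 : 0 <= eta'.
  apply: contraNT btt' => neta; apply/eqP.
  apply: (conformal_orthogonal y0 y_eta _ tg t'g (Tpos _ tT) (Tpos _ t'T)) => c d c0 d0.
  by apply: contraNneq neta => <-; rewrite addr_ge0.
(* The scalar of y on U is read off from a pair with b u w <> 0. *)
have [c yu] := schur Umod Uirr y0 cy.
have cE : c = eta' + a'.
  have [u [w [uU wW buw]]] : exists u w, [/\ u \in U, w \in W & b u w != 0].
    apply: contrapT => nb; have : vpick U != 0 by rewrite vpick0; case: Uirr => /eqP.
    case/eqP; have pU := memv_pick U; have pg := subvP sU _ pU.
    apply: b_nd => // _ /gUWT[u [w [s [-> uU wW sT]]]].
    have ug := subvP sU _ uU; have wg := subvP sW _ wW; have /TP[sg ss] := sT.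
    rewrite (b_sym pg (memvD (memvD ug wg) sg)) !(formDl b_linl) [b u _]Uiso //.
    rewrite add0r (b_sym sg pg).
    rewrite (pair_U Umod zU zu z_eta pU sg ss) => [|d /andP[] //].
    rewrite addr0 (b_sym wg pg); apply/eqP/negPn/negP => b0; apply: nb.
    by exists (vpick U), w.
  have := y_eta u w (subvP sU _ uU) (subvP sW _ wW).
  rewrite yu // yw // (formZl b_linl).
  have -> : b u (- a' *: w) = - a' * b u w.
    have ug := subvP sU _ uU; have wg := subvP sW _ wW.
    by rewrite (b_sym ug (memvZ _ wg)) (formZl b_linl) (b_sym wg ug).
  by rewrite -mulrDl => /(mulIf buw) <-; rewrite subrK.
pose x := z + y.
have x0 : x \in gr 0 by rewrite memvD.
have kzy : kf z y = - beta *+ \dim U.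
  by rewrite (trace_dual_kf Wmod) // (trS_scalar zw) dW mulNrn.
have kyz : kf y z = - (eta' + a') *+ \dim U.
  by rewrite (trace_dual_kf Umod) // (trS_scalar yu) cE mulNrn.
have kx : kf x x = - (eta + eta') *+ \dim U.
  rewrite /x kfDl !kfDr kz ky kzy kyz dW -!mulrnDl; congr (_ *+ _).
  by rewrite /beta; ring.
have [] : [/\ 0 <= kf x x,
    forall v, inspec (ad x) (fun a => a \is Num.real) v &
    kf x x = 0 -> exists n, forall v, iter n (lie x) v = 0].
  apply: real_spectrum_of_conjugate => D cD.
  have -> : tr_ad D x = tr_ad D z + tr_ad D y by apply: linearD.
  rewrite (trace_dual_conj Umod zU x0 cD) (trace_dual_conj Wmod yW x0 cD).
  by rewrite -rmorphD -kfDr.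
move=> kx_ge0 _ xnil.
have /xnil[n xn] : kf x x = 0.
  apply: le_anti; rewrite kx_ge0 andbT kx mulNrn oppr_le0 mulrn_wge0 //.
  exact: addr_ge0.
have := gr0_nilpotent_kfE x0 xn.
rewrite /x kfDr (trace_dual_E Umod) // (trace_dual_E Wmod) // -natrD => /eqP.
by rewrite pnatr_eq0 addn_eq0 dimv_eq0; case: Uirr => /eqP/negbTE->.
Qed.

(** The Killing complement J of I commutes with I, so the intersection of I and J
is abelian and hence zero. *)
Lemma ideal_complement I : lie_ideal I -> exists J, [/\ lie_ideal J,
    forall x y, x \in I -> y \in J -> kf x y = 0 /\ lie x y = 0,
    forall x, x \in I -> x \in J -> x = 0 &
    forall x, exists i j, [/\ i \in I, j \in J & x = i + j]].
Proof.
move=> idI; pose P x := forall y, y \in I -> kf x y = 0.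
have P0 : P 0 by move=> y _; rewrite kf0l.
have Plin a x y : P x -> P y -> P (a *: x + y).
  by move=> Px Py t tI; rewrite kfDl kfZl Px ?Py // mulr0 addr0.
have [J JP] := vspace_of_pred P0 Plin.
have idJ : lie_ideal J.
  move=> x y /JP Py; apply/JP => t tI.
  by rewrite lieC kfNl kf_inv Py ?oppr0 // idI.
have IJ x y : x \in I -> y \in J -> kf x y = 0 /\ lie x y = 0.
  move=> xI yJ; have /JP Py := yJ; split; first by rewrite kfC Py.
  apply: kf_nd => t; rewrite kf_inv kfC kf_inv Py // idI //.
have IJ0 x : x \in I -> x \in J -> x = 0.
  move=> xI xJ; have idX : lie_ideal (I :&: J)%VS.
    by move=> u v /memv_capP[vI vJ]; rewrite memv_cap idI // idJ.
  suff X0 : (I :&: J)%VS = 0%VS by apply/eqP; rewrite -memv0 -X0 memv_cap xI.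
  apply: ssL => //; exists 1%N; apply/eqP; rewrite -subv0 /=.
  apply: sub_lie_prodv => u v /memv_capP[uI _] /memv_capP[_ vJ].
  by rewrite memv0 (IJ u v uI vJ).2.
exists J; split=> // x.
have [_ /(_ erefl x)[i iI ix]] := pairing_image (@kf_linl _ L) (@kf_linr _ L)
  (fun x xI xk => IJ0 x xI ((JP x).2 xk)).
exists i, (x - i); split=> //; last by rewrite addrC subrK.
by apply/JP => y yI; rewrite kfDl kfNl ix // subrr.
Qed.

Lemma ideal_graded I J p x :
    lie_ideal I -> lie_ideal J ->
    (forall x, exists i j, [/\ i \in I, j \in J & x = i + j]) ->
    x \in gr p ->
  exists i j, [/\ i \in I /\ i \in gr p, j \in J /\ j \in gr p & x = i + j].
Proof.
move=> idI idJ dec xp; have [i [j [iI jJ e]]] := dec x.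
have [P [Pgr P1 _]] := gr_projection p.
exists (peval (ad E) P i), (peval (ad E) P j); rewrite !Pgr; split.
- by split=> //; apply: peval_stable iI => t; rewrite adE; apply: idI.
- by split=> //; apply: peval_stable jJ => t; rewrite adE; apply: idJ.
by rewrite -linearD /= -e P1 // (Egr xp).
Qed.

(** Transitivity propagates the vanishing from degree -1 to all degrees p >= 0, and
the Killing form then carries it to the negative degrees. *)
Lemma ideal_degree_m1 I J :
    lie_ideal I -> lie_ideal J ->
    (forall x y, x \in I -> y \in J -> kf x y = 0) ->
    (forall x, exists i j, [/\ i \in I, j \in J & x = i + j]) ->
    (forall x, x \in I -> x \in gr (-1) -> x = 0) -> I = 0%VS.
Proof.
move=> idI idJ IJ dec I1.
have nE (n : nat) : n.+1%:Z - 1 = n%:Z by rewrite intS addrAC subrr add0r.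
have Ipos (n : nat) x : x \in I -> x \in gr (n%:Z - 1) -> x = 0.
  elim: n x => [|n IH] x xI xg; first by apply: I1 => //; rewrite sub0r in xg.
  apply: (@transL (n.+1%:Z - 1)) => //.
  move=> y yg; apply: IH; first by rewrite lieC memvN idI.
  have := gr_lie xg yg; by rewrite nE.
have IP p x : 0 <= p -> x \in I -> x \in gr p -> x = 0.
  case: p => // n _ xI xg; apply: (Ipos n.+1) => //.
  by rewrite nE.
apply: stable_homogeneous => [x xI|p x xI xg]; first exact: idI.
have [p0|p0] := leP 0 p; first exact: IP p0 xI xg.
apply: (@kf_gr_nd p (- p)); rewrite ?subrr // => y yg.
have [i [j [[iI ig] [jJ _] ->]]] := ideal_graded idI idJ dec yg.
rewrite kfDr [kf x j]IJ // addr0 (IP (- p) i) ?kf0r //.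
by rewrite oppr_ge0 ltW.
Qed.

(** The element z acts on U and W by distinct scalars, so every submodule is the sum
of its intersections with U and W. *)
Lemma submodule_classification U W z c d S :
    irrmod U -> irrmod W -> gr (-1) = (U + W)%VS ->
    z \in gr 0 -> c != d -> (forall u, u \in U -> lie z u = c *: u) ->
    (forall w, w \in W -> lie z w = d *: w) ->
    submod U -> submod W -> submod S ->
  [\/ S = 0%VS, S = U, S = W | S = gr (-1)].
Proof.
move=> [_ Uirr] [_ Wirr] gUW z0 cd zu zw [_ UA] [_ WA] [sS SA].
have smc (V : {vspace L}) : (forall A x, A \in gr 0 -> x \in V -> lie A x \in V) ->
    submodule g0set V (S :&: V).
  move=> VA; split; first exact: capvSr.
  by move=> A x A0 /memv_capP[xS xV]; rewrite memv_cap SA ?VA.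
have Sdec x : x \in S -> exists u w, [/\ u \in S, u \in U, w \in S, w \in W & x = u + w].
  move=> xS; have := subvP sS _ xS; rewrite gUW => /memv_addP[u uU [w wW xE]].
  have cd0 : c - d != 0 by rewrite subr_eq0.
  have uS : u \in S.
    have : (c - d)^-1 *: (lie z x - d *: x) \in S.
      by rewrite memvZ // memvB ?memvZ ?SA.
    rewrite xE lieDr (zu _ uU) (zw _ wW) [d *: (u + w)]scalerDr opprD addrACA.
    rewrite subrr addr0.
    by rewrite -scalerBl scalerA mulVf // scale1r.
  exists u, w; split=> //.
  have -> : w = x - u by rewrite xE addrC addKr.
  by rewrite memvB.
have [SU|SU] := Uirr _ (smc U UA); have [SW|SW] := Wirr _ (smc W WA).
- apply: Or41; apply/eqP; rewrite -subv0; apply/subvP => x.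
  move=> /Sdec[u [w [uS uU wS wW ->]]].
  have : u \in (S :&: U)%VS by rewrite memv_cap uS.
  have : w \in (S :&: W)%VS by rewrite memv_cap wS.
  by rewrite SU SW => w0 u0; rewrite memvD.
- apply: Or43; apply/eqP; rewrite eqEsubv -{2}SW capvSl andbT.
  apply/subvP => x /Sdec[u [w [uS uU wS wW ->]]].
  have : u \in (S :&: U)%VS by rewrite memv_cap uS.
  by rewrite SU memv0 => /eqP->; rewrite add0r.
- apply: Or42; apply/eqP; rewrite eqEsubv -{2}SU capvSl andbT.
  apply/subvP => x /Sdec[u [w [uS uU wS wW ->]]].
  have : w \in (S :&: W)%VS by rewrite memv_cap wS.
  by rewrite SW memv0 => /eqP->; rewrite addr0.
apply: Or44; apply/eqP; rewrite eqEsubv sS gUW subv_add.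
by rewrite -{1}SU -SW !capvSl.
Qed.

(** An element i of I_0 kills J_{-1}. For x in I_{-1} and r in J_{-1} conformality
reads b [i, x] r = eta b x r, and since I_{-1} is isotropic, [i, x] = eta x. Thus
L_0 acts on I_{-1} by scalars, and irreducibility makes it one-dimensional. *)
Lemma isotropic_ideal_abelian I J : lie_ideal I -> lie_ideal J ->
    (forall x y, x \in I -> y \in J -> kf x y = 0 /\ lie x y = 0) ->
    (forall x, exists i j, [/\ i \in I, j \in J & x = i + j]) ->
    totally_isotropic b (I :&: gr (-1)) -> irrmod (I :&: gr (-1)) ->
  forall x y, x \in I -> x \in gr (-1) -> y \in I -> y \in gr (-1) -> lie x y = 0.
Proof.
move=> idI idJ IJ dec iso [_ irr] x y xI xg yI yg.
have [->|x0] := eqVneq x 0; first by rewrite lie0l.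
have scal A : A \in gr 0 -> exists c, lie A x = c *: x.
  move=> A0; have [i [j [[iI i0] [jJ j0] ->]]] := ideal_graded idI idJ dec A0.
  have jx : lie j x = 0 by rewrite lieC (IJ x j xI jJ).2 oppr0.
  have [eta etaE] := b_co i0; exists eta; rewrite lieDl jx addr0.
  have ix_g : lie i x \in gr (-1) by rewrite -[-1 : int]add0r gr_lie.
  apply/eqP; rewrite -subr_eq0; apply/eqP/b_nd; first by rewrite memvB ?memvZ.
  move=> t tg; have [s [r [[sI sg] [rJ rg] ->]]] := ideal_graded idI idJ dec tg.
  have ix_I : lie i x \in I by rewrite lieC memvN idI.
  have dI : lie i x - eta *: x \in (I :&: gr (-1))%VS.
    by rewrite memv_cap !memvB ?memvZ.
  have dg : lie i x - eta *: x \in gr (-1) by case/memv_capP: dI.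
  rewrite (b_sym dg (memvD sg rg)) (formDl b_linl) [b s _]iso ?add0r //; last first.
    by rewrite memv_cap sI.
  rewrite (b_sym rg dg) (formBl b_linl) (formZl b_linl).
  have := etaE x r xg rg; rewrite (IJ i r iI rJ).2.
  have -> : b x 0 = 0.
    by rewrite (b_sym xg (mem0v _)) (form0l b_linl).
  by rewrite addr0 => ->; rewrite subrr.
have [|x00|lx] := irr <[x]>%VS.
- split; first by rewrite -memvE memv_cap xI.
  by move=> A _ /scal[c Ax] /vlineP[a ->]; rewrite lieZr Ax memvZ ?memvZ ?memv_line.
- by case/eqP: x0; apply/eqP; rewrite -memv0 -x00 memv_line.
have : y \in <[x]>%VS by rewrite lx memv_cap yI.
by move=> /vlineP[a ->]; rewrite lieZr liexx scaler0.
Qed.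

Theorem conformal_simple :
  (exists x y, [/\ x \in gr (-1), y \in gr (-1) & lie x y <> 0]) -> lie_simple L.
Proof.
move=> [x0 [y0 [x0g y0g xy0]]]; split; first by exists x0, y0.
have g0 : gr (-1) <> 0%VS.
  by move=> g0; apply: xy0; move: x0g; rewrite g0 memv0 => /eqP->; rewrite lie0l.
move=> I idI; have [J [idJ IJ IJ0 dec]] := ideal_complement idI.
have JI x y : x \in J -> y \in I -> kf x y = 0 /\ lie x y = 0.
  by move=> xJ yI; rewrite kfC lieC (IJ y x yI xJ).1 (IJ y x yI xJ).2 oppr0.
have ced x : exists j i, [/\ j \in J, i \in I & x = j + i].
  by have [i [j [iI jJ ->]]] := dec x; exists j, i; rewrite addrC.
have [I1|nI1] := pselect (forall x, x \in I -> x \in gr (-1) -> x = 0).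
  left; apply: ideal_degree_m1 idI idJ _ dec I1 => x y xI yJ.
  by case: (IJ x y xI yJ).
have [J1|nJ1] := pselect (forall x, x \in J -> x \in gr (-1) -> x = 0).
  right; have J0 : J = 0%VS.
    apply: ideal_degree_m1 idJ idI _ ced J1 => x y xJ yI.
    by case: (JI x y xJ yI).
  apply/eqP; rewrite eqEsubv subvf; apply/subvP => x _.
  have [i [j [iI + ->]]] := dec x.
  by rewrite J0 memv0 => /eqP->; rewrite addr0.
have mod1 S : lie_ideal S -> submod (S :&: gr (-1)).
  move=> idS; split; first exact: capvSr.
  move=> A x A0 /memv_capP[xS xg]; rewrite memv_cap idS //.
  by rewrite -[-1 : int]add0r gr_lie.
have nz S : ~ (forall x, x \in S -> x \in gr (-1) -> x = 0) ->
    (S :&: gr (-1))%VS <> 0%VS.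
  move=> nS S0; apply: nS => x xS xg; apply/eqP.
  by rewrite -memv0 -S0 memv_cap xS.
have nI := nz _ nI1; have nJ := nz _ nJ1.
have full S S' : (forall x, x \in S -> x \in S' -> x = 0) ->
    (S' :&: gr (-1))%VS <> 0%VS -> (S :&: gr (-1))%VS <> gr (-1).
  move=> SS nS' e; apply: nS'; apply/eqP; rewrite -subv0; apply/subvP => x.
  move=> /memv_capP[xS']; rewrite -e => /memv_capP[xS _].
  by rewrite (SS x) // mem0v.
have fI := full _ _ IJ0 nJ.
have fJ := full _ _ (fun x xJ xI => IJ0 x xI xJ) nI.
exfalso; have [[_ irr]|] := conformal_decomposition g0.
  by have [] := irr _ (mod1 I idI).
move=> [U [W [z [c [d [[Um Wm] [Ui Wi] [gUW _] [Uiso Wiso] [z0 cd zu zw]]]]]]].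
have good S : lie_ideal S -> (S :&: gr (-1))%VS <> 0%VS ->
    (S :&: gr (-1))%VS <> gr (-1) ->
    totally_isotropic b (S :&: gr (-1)) /\ irrmod (S :&: gr (-1)).
  move=> idS nS fS.
  by have [//|->|->|//] :=
    submodule_classification Ui Wi gUW z0 cd zu zw Um Wm (mod1 S idS).
have [isoI irrI] := good I idI nI fI; have [isoJ irrJ] := good J idJ nJ fJ.
apply: xy0.
have [i [j [[iI ig] [jJ jg] ->]]] := ideal_graded idI idJ dec x0g.
have [k [l [[kI kg] [lJ lg] ->]]] := ideal_graded idI idJ dec y0g.
rewrite lieDl !lieDr (IJ i l iI lJ).2 (JI j k jJ kI).2 addr0 add0r.
rewrite (isotropic_ideal_abelian idI idJ IJ dec isoI irrI iI ig kI kg) add0r.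
exact: (isotropic_ideal_abelian idJ idI JI ced isoJ irrJ jJ jg lJ lg).
Qed.

End Conformal.

End Graded.

(** * Contragredient modules from isotropic splittings *)

Section Contragredient.

Variables (K : fieldType) (L : lieVectType K) (b : L -> L -> K).
Hypothesis b_linl : forall y, linear (b^~ y : L -> K^o).
Hypothesis b_linr : forall x, linear (b x : L -> K^o).

Lemma contragredient_of_pairing (Q : set L) (W1 W2 : {vspace L}) :
    (forall A x, Q A -> x \in W1 -> lie A x \in W1) ->
    (forall A x, Q A -> x \in W2 -> lie A x \in W2) ->
    (forall A x y, Q A -> x \in W1 -> y \in W2 -> b (lie A x) y + b x (lie A y) = 0) ->
    (forall x, x \in W1 -> (forall y, y \in W2 -> b x y = 0) -> x = 0) ->
    (forall y, y \in W2 -> (forall x, x \in W1 -> b x y = 0) -> y = 0) ->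
  contragredient Q W1 W2.
Proof.
move=> QW1 QW2 Qb nd1 nd2.
pose f (x : subvs_of W1) (y : subvs_of W2) : K^o := b (vsval x) (vsval y).
have f_lin x : linear (f x) by move=> a u v; rewrite /f linearP /= b_linr.
pose fl x := GRing.isLinear.Build K (subvs_of W2) K^o _ (f x) (f_lin x).
pose F (x : subvs_of W1) : 'Hom(subvs_of W2, K^o) :=
  linfun (HB.pack (f x) (fl x) : {linear subvs_of W2 -> K^o}).
have FE x y : F x y = f x y by rewrite lfunE.
have F_lin : linear F.
  move=> a u v; apply/lfunP => y; rewrite add_lfunE scale_lfunE !FE /f.
  by rewrite linearP /= b_linl.
pose Fl := GRing.isLinear.Build K (subvs_of W1) 'Hom(subvs_of W2, K^o) _ F F_lin.
pose phi := linfun (HB.pack F Fl : {linear subvs_of W1 -> 'Hom(subvs_of W2, K^o)}).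
have phiE x y : phi x y = b (vsval x) (vsval y) by rewrite lfunE /= FE.
have ker0 : lker phi == 0%VS.
  apply/lker0P => u v /lfunP e; apply/val_inj/eqP; rewrite -subr_eq0; apply/eqP.
  apply: nd1 => [|y yW]; first by rewrite memvB ?subvsP.
  rewrite (formBl b_linl); have := e (vsproj W2 y); rewrite !phiE vsprojK // => ->.
  by rewrite subrr.
have dW : \dim W1 = \dim W2.
  apply/eqP; rewrite eqn_leq; apply/andP; split.
    exact: (dim_pairing b_linl b_linr).
  by apply: (@dim_pairing _ _ (fun x y => b y x) b_linr b_linl).
have imphi : limg phi = fullv.
  apply/eqP; rewrite eqEdim subvf limg_dim_eq ?(eqP ker0) ?capv0 //=.
  by rewrite !dimvf /dim /= muln1 dW.
exists phi; split.
  exists (phi^-1)%VF; first exact: lker0_lfunK.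
  by move=> u; rewrite limg_lfunVK // imphi memvf.
move=> A QA x y; rewrite !phiE /res_act !vsprojK; last first.
- by apply: QW1 => //; apply: subvsP.
- by apply: QW2 => //; apply: subvsP.
by apply/eqP; rewrite -addr_eq0 Qb ?subvsP.
Qed.

(** Each of two complementary isotropic subspaces is the dual of the other with
respect to b. *)
Lemma contragredient_of_isotropic (Q : set L) (W W1 W2 : {vspace L}) :
    (forall A x, Q A -> x \in W1 -> lie A x \in W1) ->
    (forall A x, Q A -> x \in W2 -> lie A x \in W2) ->
    (forall A, Q A -> so_on W b (lie A)) ->
    (forall x y, x \in W -> y \in W -> b x y = b y x) ->
    (forall x, x \in W -> (forall y, y \in W -> b x y = 0) -> x = 0) ->
    W = (W1 + W2)%VS -> totally_isotropic b W1 -> totally_isotropic b W2 ->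
  contragredient Q W1 W2.
Proof.
move=> QW1 QW2 so bC nd eW iso1 iso2.
have s1 x : x \in W1 -> x \in W by rewrite eW; apply: (subvP (addvSl _ _)).
have s2 x : x \in W2 -> x \in W by rewrite eW; apply: (subvP (addvSr _ _)).
apply: contragredient_of_pairing => //.
- by move=> A x y QA xW yW; apply: (so A QA); [apply: s1 | apply: s2].
- move=> x xW xb; apply: nd => [|y]; first exact: s1.
  rewrite eW => /memv_addP[u uW [v vW ->]].
  rewrite (bC _ _ (s1 _ xW) (memvD (s1 _ uW) (s2 _ vW))) (formDl b_linl) iso1 //.
  by rewrite add0r (bC _ _ (s2 _ vW) (s1 _ xW)) xb.
move=> y yW yb; apply: nd => [|x]; first exact: s2.
rewrite eW => /memv_addP[u uW [v vW ->]].
rewrite (bC _ _ (s2 _ yW) (memvD (s1 _ uW) (s2 _ vW))) (formDl b_linl) yb // add0r.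
by rewrite iso2.
Qed.

End Contragredient.

(** * The degree derivation *)

(** Sums over lists of pairs (degree, vector), where a degree may be repeated, are
regrouped by degree; with such lists the sum of two decompositions is a
concatenation. *)
Lemma group_pairs (V : zmodType) (W : eqType) (l : seq (int * W)) (F : int * W -> V) :
  \sum_(u <- l) F u =
    \sum_(p <- undup (map fst l)) \sum_(u <- l | u.1 == p) F u.
Proof.
rewrite (exchange_big_dep xpredT) //= big_seq [RHS]big_seq.
apply: eq_bigr => u ul; have us : u.1 \in undup (map fst l).
  by rewrite mem_undup map_f.
rewrite -big_filter; have -> : [seq p <- undup (map fst l) | u.1 == p] = [:: u.1].
  have := filter_pred1_uniq (undup_uniq _) us => <-.
  by apply: eq_filter => p; rewrite /= eq_sym.
by rewrite big_seq1.
Qed.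

Section DegreeDerivation.

Variables (K : fieldType) (L : lieVectType K) (gr : int -> {vspace L}).
Hypothesis gradedL : graded_lie (fun p => gr p).

Lemma graded_pairs_eq0 (l : seq (int * L)) : (forall u, u \in l -> u.2 \in gr u.1) ->
  \sum_(u <- l) u.2 = 0 -> \sum_(u <- l) u.1%:~R *: u.2 = 0.
Proof.
move=> lgr l0; pose s := undup (map fst l).
pose f p := \sum_(u <- l | u.1 == p) u.2.
have fgr p : f p \in gr p.
  rewrite /f big_seq_cond memv_suml // => u /andP[ul /eqP <-].
  exact: lgr.
have f0 : \sum_(p <- s) f p = 0 by rewrite -group_pairs.
rewrite group_pairs big1_seq // => p /andP[_ ps].
transitivity (p%:~R *: f p).
  by rewrite scaler_sumr; apply: eq_bigr => u /eqP->.
by rewrite (graded_direct gradedL (undup_uniq _) fgr f0 ps) scaler0.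
Qed.

(** The relation between a sum of homogeneous vectors x_p and the sum of the p x_p
is linear and, by directness, functional. *)
Lemma degree_endomorphism : exists D : 'End(L),
  forall p x, x \in gr p -> D x = p%:~R *: x.
Proof.
pose Q x y := exists l : seq (int * L), [/\ forall u, u \in l -> u.2 \in gr u.1,
  x = \sum_(u <- l) u.2 & y = \sum_(u <- l) u.1%:~R *: u.2].
have QD x y x' y' : Q x y -> Q x' y' -> Q (x + x') (y + y').
  move=> [l [lgr -> ->]] [k [kgr -> ->]]; exists (l ++ k); rewrite !big_cat.
  by split=> // u; rewrite mem_cat => /orP[/lgr|/kgr].
have QZ a x y : Q x y -> Q (a *: x) (a *: y).
  move=> [l [lgr -> ->]]; exists [seq (u.1, a *: u.2) | u <- l].
  rewrite !big_map !scaler_sumr; split=> //.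
    by move=> _ /mapP[u ul ->]; rewrite memvZ ?lgr.
  by apply: eq_bigr => u _; rewrite !scalerA mulrC.
have Q1 p x : x \in gr p -> Q x (p%:~R *: x).
  move=> xp; exists [:: (p, x)]; rewrite !big_seq1; split=> // u.
  by rewrite inE => /eqP->.
have Q0 y : Q 0 y -> y = 0.
  by move=> [l [lgr /esym l0 ->]]; apply: graded_pairs_eq0.
have Quniq x y y' : Q x y -> Q x y' -> y = y'.
  move=> Qy /(QZ (-1)) Qy'; have := QD _ _ _ _ Qy Qy'.
  by rewrite !scaleN1r subrr => /Q0/eqP; rewrite subr_eq0 => /eqP.
have Qex x : exists y, Q x y.
  move: x; apply: (graded_ind gradedL) => [x y [x' Qx] [y' Qy]|p x xp].
    by exists (x' + y'); apply: QD.
  by exists (p%:~R *: x); apply: Q1.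
have [D DQ] := choice Qex.
have D_lin : linear D.
  by move=> a x y; apply: Quniq (DQ _) _; apply: QD => //; apply: QZ.
pose Dl := GRing.isLinear.Build K L L _ D D_lin.
exists (linfun (HB.pack D Dl : {linear L -> L})) => p x xp.
by rewrite lfunE /=; apply: Quniq (DQ x) (Q1 _ _ xp).
Qed.

Lemma degree_derivation (D : 'End(L)) :
  (forall p x, x \in gr p -> D x = p%:~R *: x) -> lie_derivation D.
Proof.
move=> Dgr x y.
apply: (graded_ind gradedL (Q := fun x => D (lie x y) = lie (D x) y + lie x (D y))) x.
  move=> x x' e e'; have -> : D (x + x') = D x + D x' by apply: linearD.
  rewrite !lieDl; have -> : D (lie x y + lie x' y) = D (lie x y) + D (lie x' y).
    exact: linearD.
  by rewrite e e' addrACA.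
move=> p x xp.
apply: (graded_ind gradedL (Q := fun y => D (lie x y) = lie (D x) y + lie x (D y))) y.
  move=> y y' e e'; have -> : D (y + y') = D y + D y' by apply: linearD.
  rewrite !lieDr; have -> : D (lie x y + lie x y') = D (lie x y) + D (lie x y').
    exact: linearD.
  by rewrite e e' addrACA.
move=> q y yq; rewrite (Dgr _ _ xp) (Dgr _ _ yq) (Dgr (p + q)).
  by rewrite lieZl lieZr -scalerDl intrD.
exact: (graded_lieP gradedL).
Qed.

End DegreeDerivation.

(** * Complexification *)

Section Complexification.

Variables (R : realType) (g : lieVectType R).
Implicit Types (x y : g) (z w : cplx g).

Lemma cplx_lieE z w :
  lie z w = (lie z.1 w.1 - lie z.2 w.2, lie z.1 w.2 + lie z.2 w.1) :> cplx g.
Proof. by []. Qed.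

Lemma cplx_lie_inl x w : lie (cplx_in x : cplx g) w = (lie x w.1, lie x w.2) :> cplx g.
Proof. by rewrite cplx_lieE /= !lie0l subr0 addr0. Qed.

Lemma cplx_scaler (a : R) z : (a%:C)%C *: z = (a *: z.1, a *: z.2) :> cplx g.
Proof. by rewrite cplx_scaleE /= !scale0r subr0 addr0. Qed.

Lemma cplx_scalei z : ('i)%C *: z = (- z.2, z.1) :> cplx g.
Proof. by rewrite cplx_scaleE /= !scale0r !scale1r sub0r add0r. Qed.

Lemma cplx_oppE z : - z = (- z.1, - z.2) :> cplx g. Proof. by []. Qed.

Lemma intr_complex (p : int) : (p%:~R : R[i]) = ((p%:~R : R)%:C)%C.
Proof. by rewrite rmorph_int. Qed.

Lemma cplx_graded (gr : int -> {vspace g}) : graded_lie (fun p => gr p) ->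
  graded_lie (L := cplx g) (fun p => cplxv (gr p)).
Proof.
move=> gg; split.
- move=> p; split; first exact: mem0v.
  by move=> a z w zp wp; rewrite memvD ?memvZ.
- move=> z; have [s [f [fgr e1]]] := graded_span gg z.1.
  have [t [h [hgr e2]]] := graded_span gg z.2.
  pose l := [seq (p, cplx_in (f p) : cplx g) | p <- s] ++
    [seq (p, ('i)%C *: (cplx_in (h p) : cplx g)) | p <- t].
  exists (undup (map fst l)), (fun p => \sum_(u <- l | u.1 == p) u.2).
  rewrite -(group_pairs l (fun u => u.2)) /l big_cat !big_map; split.
    move=> p; rewrite big_seq_cond; apply: memv_suml => u.
    rewrite mem_cat => /andP[/orP[]/mapP[q _ ->] /= /eqP <-].
      by rewrite memv_cplx fgr mem0v.
    by rewrite memvZ // memv_cplx hgr mem0v.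
  rewrite -scaler_sumr; case: z e1 e2 => z1 z2 /= -> ->.
  have cplx_in_sum r (k : int -> g) : \sum_(p <- r) (cplx_in (k p) : cplx g) =
      cplx_in (\sum_(p <- r) k p).
    elim: r => [|p r IH]; first by rewrite !big_nil.
    by rewrite !big_cons IH cplx_addE /= addr0.
  by rewrite !cplx_in_sum cplx_scalei cplx_addE /= oppr0 addr0 add0r.
- move=> s f us fgr sf p ps.
  have sum12 r : \sum_(q <- r) f q = (\sum_(q <- r) (f q).1, \sum_(q <- r) (f q).2).
    elim: r => [|q r IH]; first by rewrite !big_nil.
    by rewrite !big_cons IH cplx_addE.
  have f1 q : (f q).1 \in gr q by have := fgr q; rewrite memv_cplx => /andP[].
  have f2 q : (f q).2 \in gr q by have := fgr q; rewrite memv_cplx => /andP[].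
  move: sf; rewrite sum12 => -[sf1 sf2].
  have e1 := graded_direct gg us f1 sf1 ps; have e2 := graded_direct gg us f2 sf2 ps.
  by case: (f p) e1 e2 => /= ? ? -> ->.
move=> p q z w; rewrite !memv_cplx cplx_lieE => /andP[z1 z2] /andP[w1 w2] /=.
by rewrite memvB ?memvD //; apply: (graded_lieP gg).
Qed.

(** For an abelian ideal A of the complexification, the real parts of its elements
form an ideal AR of g. The bracket of x and x' in AR is the real part of an
element lying in both A and its conjugate, and the real parts of two such
elements commute; so AR is solvable, and zero. *)
Lemma cplx_semisimple : lie_semisimple g -> lie_semisimple (cplx g).
Proof.
move=> ss; apply: semisimple_of_abelian_ideals => A idA abA.
have ab z w : z \in A -> w \in A -> lie z w = 0.
  by move=> zA wA; apply/eqP; rewrite -memv0 -abA mem_lie_prodv.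
pose P x := exists y, ((x, y) : cplx g) \in A.
have [AR ARP] : exists U : {vspace g}, forall x, x \in U <-> P x.
  apply: vspace_of_pred; first by exists 0; apply: mem0v.
  move=> a x y [x' xA] [y' yA]; exists (a *: x' + y').
  by have := memvD (memvZ (a%:C)%C xA) yA; rewrite cplx_scaler.
pose Q t := exists s, ((t, s) : cplx g) \in A /\ ((t, - s) : cplx g) \in A.
have Q0 : Q 0 by exists 0; rewrite oppr0 !mem0v.
have Qlin a x y : Q x -> Q y -> Q (a *: x + y).
  move=> [x' [xA xA']] [y' [yA yA']]; exists (a *: x' + y'); split.
    by have := memvD (memvZ (a%:C)%C xA) yA; rewrite cplx_scaler.
  have := memvD (memvZ (a%:C)%C xA') yA'; rewrite cplx_scaler cplx_addE /=.
  by rewrite scalerN opprD.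
have [C CP] := vspace_of_pred Q0 Qlin.
have idAR : lie_ideal AR.
  move=> x y /ARP[y' yA]; apply/ARP; exists (lie x y').
  by have := idA (cplx_in x) _ yA; rewrite cplx_lie_inl.
have AR0 : AR = 0%VS.
  apply: ss => //; exists 2%N; apply/eqP; rewrite -subv0 /=.
  apply: (subv_trans (y := lie_prodv C C)).
    have sC : (lie_prodv AR AR <= C)%VS.
      apply: sub_lie_prodv => x x' /ARP[y xA] /ARP[y' xA'].
      have e1 : lie y y' = lie x x'.
        have /(congr1 fst)/eqP := ab _ _ xA xA'.
        by rewrite cplx_lieE /= subr_eq0 eq_sym => /eqP.
      have e2 : lie x y' = - lie y x'.
        have /(congr1 snd)/eqP := ab _ _ xA xA'.
        by rewrite cplx_lieE /= addr_eq0 => /eqP.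
      have half t : (2^-1 : R) *: (t + t) = t.
        by rewrite -mulr2n -scaler_nat scalerA mulVf ?scale1r // pnatr_eq0.
      apply/CP; exists (lie y x'); split.
        have : - ((2^-1 : R)%:C)%C *: lie ((x', - y') : cplx g) ((x, y) : cplx g) \in A.
          by rewrite memvZ // idA.
        rewrite scaleNr cplx_scaler cplx_lieE cplx_oppE /= lieNl opprK.
        rewrite [lie x' x]lieC [lie y' y]lieC e1 [lie x' y]lieC lieNl.
        by rewrite [lie y' x]lieC opprK e2 -!opprD !scalerN !half !opprK.
      have : ((2^-1 : R)%:C)%C *: lie ((x, - y) : cplx g) ((x', y') : cplx g) \in A.
        by rewrite memvZ // idA.
      rewrite cplx_scaler cplx_lieE /= lieNl opprK e1 lieNl e2 half.
      by rewrite -opprD scalerN half.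
    exact: lie_prodvS.
  apply: sub_lie_prodv => t t' /CP[s [ts ts']] /CP[s' [ts1 ts1']].
  have /(congr1 fst) := ab _ _ ts ts1; have /(congr1 fst) := ab _ _ ts ts1'.
  rewrite !cplx_lieE /= lieNr opprK => p0 m0; rewrite memv0.
  have : (2 : R) *: lie t t' = 0.
    rewrite scaler_nat mulr2n -[RHS](addr0 (0 : g)) -{1}p0 -m0.
    by rewrite addrACA subrr addr0.
  by move=> /eqP; rewrite scaler_eq0 pnatr_eq0.
apply/eqP; rewrite -subv0; apply/subvP => -[x y] zA; rewrite memv0.
have /eqP x0 : x == 0 by rewrite -memv0 -AR0; apply/ARP; exists y.
have /eqP y0 : - y == 0.
  rewrite -memv0 -AR0; apply/ARP; exists x.
  by have := memvZ ('i)%C zA; rewrite cplx_scalei.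
by rewrite x0 -[y]opprK y0 oppr0.
Qed.

Lemma cplx_transitive (gr : int -> {vspace g}) : transitive_gla (fun p => gr p) ->
  transitive_gla (L := cplx g) (fun p => cplxv (gr p)).
Proof.
move=> tr p [x y] p0; rewrite memv_cplx => /andP[/= xp yp] xy0.
have xy (w : g) : w \in gr (-1) -> lie x w = 0 /\ lie y w = 0.
  move=> wg; have /xy0 : (cplx_in w : cplx g) \in cplxv (gr (-1)).
    by rewrite memv_cplx wg mem0v.
  by rewrite cplx_lieE /= !lie0r subr0 add0r => -[].
rewrite (tr p x p0 xp (fun (w : g) wg => (xy w wg).1)).
by rewrite (tr p y p0 yp (fun (w : g) wg => (xy w wg).2)).
Qed.

Section Form.

Variables (b : g -> g -> R) (W : {vspace g}).
Hypothesis b_linl : forall y, linear (b^~ y : g -> R^o).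
Hypothesis b_linr : forall x, linear (b x : g -> R^o).

Lemma cplx_form_sym : (forall x y, x \in W -> y \in W -> b x y = b y x) ->
  forall z w, z \in cplxv W -> w \in cplxv W -> cplx_form b z w = cplx_form b w z.
Proof.
move=> bC z w; rewrite !memv_cplx => /andP[z1 z2] /andP[w1 w2].
rewrite /cplx_form (bC _ _ z1 w1) (bC _ _ z2 w2) (bC _ _ z1 w2) (bC _ _ z2 w1).
by rewrite [b w.2 z.1 + _]addrC.
Qed.

Lemma cplx_form_linl w : linear ((cplx_form b)^~ w : cplx g -> R[i]^o).
Proof.
move=> [a c] z t; rewrite /cplx_form cplx_scaleE cplx_addE /=.
rewrite !(formDl b_linl) !(formNl b_linl) !(formZl b_linl).
apply/eqP; rewrite eq_complex /=; apply/andP; split; apply/eqP; ring.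
Qed.

Lemma cplx_form_linr z : linear (cplx_form b z : cplx g -> R[i]^o).
Proof.
have dr := formDl (b := fun x y => b y x) b_linr.
have zr := formZl (b := fun x y => b y x) b_linr.
have nr := formNl (b := fun x y => b y x) b_linr.
move=> [a c] w t; rewrite /cplx_form cplx_scaleE cplx_addE /=.
rewrite !dr !nr !zr.
apply/eqP; rewrite eq_complex /=; apply/andP; split; apply/eqP; ring.
Qed.

Lemma cplx_form_nd :
    (forall x, x \in W -> (forall y, y \in W -> b x y = 0) -> x = 0) ->
  forall z, z \in cplxv W -> (forall w, w \in cplxv W -> cplx_form b z w = 0) ->
    z = 0.
Proof.
move=> nd [x y]; rewrite memv_cplx => /andP[/= xW yW] z0.
have xy (w : g) : w \in W -> b x w = 0 /\ b y w = 0.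
  move=> wW; have /z0 : (cplx_in w : cplx g) \in cplxv W by rewrite memv_cplx wW mem0v.
  have b0 t : b t 0 = 0 by apply: (form0l (b := fun x y => b y x) b_linr).
  by rewrite /cplx_form /= !b0 subr0 add0r => -[].
rewrite (nd x xW (fun (w : g) wW => (xy w wW).1)).
by rewrite (nd y yW (fun (w : g) wW => (xy w wW).2)).
Qed.

(** The extended form is complex bilinear, so the infinitesimal isometries
complexify. *)
Lemma cplx_form_so (A : cplx g) : so_on W b (lie A.1) -> so_on W b (lie A.2) ->
  so_on (cplxv W) (cplx_form b) (lie A).
Proof.
move=> so1 so2 z w; rewrite !memv_cplx => /andP[z1 z2] /andP[w1 w2].
have dr := formDl (b := fun x y => b y x) b_linr.
have nr := formNl (b := fun x y => b y x) b_linr.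
have s1 u v : u \in W -> v \in W -> b u (lie A.1 v) = - b (lie A.1 u) v.
  by move=> uW vW; apply/eqP; rewrite -addr_eq0 addrC so1.
have s2 u v : u \in W -> v \in W -> b u (lie A.2 v) = - b (lie A.2 u) v.
  by move=> uW vW; apply/eqP; rewrite -addr_eq0 addrC so2.
rewrite /cplx_form cplx_lieE [lie A w]cplx_lieE /=.
rewrite !dr !nr !(formDl b_linl) !(formNl b_linl) !s1 // !s2 //.
apply/eqP; rewrite eq_complex /=; apply/andP; split; apply/eqP; ring.
Qed.

Lemma cplx_form_co (A : cplx g) : co_on W b (lie A.1) -> co_on W b (lie A.2) ->
  co_on (cplxv W) (cplx_form b) (lie A).
Proof.
move=> [e co1] [f co2]; exists (e +i* f)%C => z w.
rewrite !memv_cplx => /andP[z1 z2] /andP[w1 w2].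
have dr := formDl (b := fun x y => b y x) b_linr.
have nr := formNl (b := fun x y => b y x) b_linr.
have s1 u v : u \in W -> v \in W -> b u (lie A.1 v) = e * b u v - b (lie A.1 u) v.
  by move=> uW vW; rewrite -co1 // addrC addKr.
have s2 u v : u \in W -> v \in W -> b u (lie A.2 v) = f * b u v - b (lie A.2 u) v.
  by move=> uW vW; rewrite -co2 // addrC addKr.
rewrite /cplx_form cplx_lieE [lie A w]cplx_lieE /=.
rewrite !dr !nr !(formDl b_linl) !(formNl b_linl) !s1 // !s2 //.
apply/eqP; rewrite eq_complex /=; apply/andP; split; apply/eqP; ring.
Qed.

End Form.

End Complexification.

(** * The prolongation of a conformal fundamental graded Lie algebra *)

Section Prolongation.

Variables (R : realType) (m : lieVectType R) (mgr : int -> {vspace m}).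
Variable B : {biscalar (subvs_of (mgr (-1)))}.
Variables (g : lieVectType R) (ggr : int -> {vspace g}).
Variables (iota : 'Hom(m, g)) (tau : 'Hom('End(m), g)).
Hypothesis cfm : conformal_fgla B.
Hypothesis prol : is_prolongation B (fun p => ggr p) iota tau.

Let fgla := cfgla_fgla cfm.
Let np := prol_nonpos prol.
Let gg := prol_graded prol.

Local Notation b := (transport_form B iota).
Local Notation g0 := ([set A | A \in ggr 0]%classic : set g).
Local Notation hg0 :=
  ([set A | A \in ggr 0 /\ so_on (ggr (-1)) b (lie A)]%classic : set g).

Lemma iotaK : cancel iota (iota^-1)%VF.
Proof. by apply: lker0_lfunK; apply/lker0P; apply: (nonpos_iota_inj np). Qed.

Lemma gr_m1P y : y \in ggr (-1) <-> exists2 x, x \in mgr (-1) & y = iota x.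
Proof. exact: (nonpos_neg np (p := -1)). Qed.

Lemma transport_formE x y : b (iota x) (iota y) = ext_form B x y.
Proof. by rewrite /transport_form !iotaK. Qed.

Lemma transport_linl y : linear (b^~ y : g -> R^o).
Proof. by move=> a u v; rewrite /transport_form /ext_form !linearP /= linearPl. Qed.

Lemma transport_linr x : linear (b x : g -> R^o).
Proof. by move=> a u v; rewrite /transport_form /ext_form !linearP. Qed.

Lemma transport_sym x y : b x y = b y x.
Proof. exact: cfgla_sym cfm _ _. Qed.

Lemma transport_nd x : x \in ggr (-1) ->
  (forall y, y \in ggr (-1) -> b x y = 0) -> x = 0.
Proof.
move=> /gr_m1P[x0 x0g ->] x0b; suff -> : x0 = 0 by rewrite linear0.
rewrite -(vsprojK x0g) (_ : vsproj _ x0 = 0) ?linear0 //.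
apply: (cfgla_nondeg cfm) => y.
have := x0b (iota (vsval y)); rewrite transport_formE /ext_form vsvalK; apply.
by apply/gr_m1P; exists (vsval y) => //; apply: subvsP.
Qed.

Lemma transport_co A : A \in ggr 0 -> co_on (ggr (-1)) b (lie A).
Proof.
move=> /(nonpos_zero np)[D cD ->]; have [eta etaE] := cder_co cD.
exists eta => _ _ /gr_m1P[x xg ->] /gr_m1P[y yg ->].
by rewrite !(nonpos_lie_zero_neg np) // !transport_formE etaE.
Qed.

Lemma gr_m1_neq0 : ggr (-1) <> 0%VS.
Proof.
move=> g0; apply: (fgla_neq0 fgla); apply/eqP; rewrite -subv0; apply/subvP => x xg.
have : iota x \in ggr (-1) by apply/gr_m1P; exists x.
by rewrite g0 !memv0 => /eqP ix; rewrite -(iotaK x) ix linear0.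
Qed.

(** Otherwise m_{-1} would be a subalgebra, hence all of m, and m_{-2} would be
zero. *)
Lemma gr_m1_nonabelian :
  exists x y, [/\ x \in ggr (-1), y \in ggr (-1) & lie x y <> 0].
Proof.
apply: contrapT => ab; have mab x y : x \in mgr (-1) -> y \in mgr (-1) -> lie x y = 0.
  move=> xg yg; apply: contrapT => xy; apply: ab; exists (iota x), (iota y).
  split; [by apply/gr_m1P; exists x | by apply/gr_m1P; exists y |].
  rewrite -(nonpos_lie_neg np) => e; apply: xy.
  by rewrite -(iotaK (lie x y)) e linear0.
have full : mgr (-1) = fullv.
  by apply: (fgla_gen fgla) => // x y xg yg; rewrite mab // mem0v.
apply: (cfgla_neq0 cfm); apply/eqP; rewrite -subv0; apply/subvP => x xg.
have x1 : x \in mgr (-1) by rewrite full memvf.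
(* x - x = 0 is a decomposition of 0 into components of degrees -1 and -2. *)
pose f (p : int) := if p == -1 then x else if p == -2 then - x else 0.
have := graded_direct (fgla_graded fgla) (s := [:: -1; -2]) (f := f) erefl.
move=> /(_ _ _ (-1)); rewrite memv0 /f /= => -> //.
  by move=> p; case: eqP => [->//|_]; case: eqP => [->|_]; rewrite ?memvN ?mem0v.
by rewrite !big_cons big_nil /= addr0 subrr.
Qed.

(** The degree derivation of m is conformal with factor -2, so it defines an element
of g_0. It acts correctly in negative degrees, and in degree p >= 0 by induction
on p and transitivity. *)
Lemma characteristic_element : exists2 E, E \in ggr 0 &
  forall p x, x \in ggr p -> lie E x = p%:~R *: x.
Proof.
have [D Dgr] := degree_endomorphism (fgla_graded fgla).
have cD : conf_derivation B D.
  split.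
  - exact: (degree_derivation (fgla_graded fgla) Dgr).
  - by move=> p _ x xp; rewrite (Dgr _ _ xp) memvZ.
  exists (- 2) => x y xg yg; rewrite (Dgr _ _ xg) (Dgr _ _ yg) /ext_form !linearZ /=.
  by rewrite linearZl_LR /= mulrN1z; ring.
exists (tau D); first by apply/(nonpos_zero np); exists D.
have Eneg (p : int) x : p < 0 -> x \in ggr p -> lie (tau D) x = p%:~R *: x.
  move=> p0 /(nonpos_neg np p0)[y yp ->].
  by rewrite (nonpos_lie_zero_neg np) // (Dgr _ _ yp) linearZ.
have E0 : tau D \in ggr 0 by apply/(nonpos_zero np); exists D.
have nE (n : nat) : n.+1%:Z - 1 = n%:Z by rewrite intS addrAC subrr add0r.
have Epos (n : nat) x : x \in ggr (n%:Z - 1) -> lie (tau D) x = (n%:Z - 1)%:~R *: x.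
  elim: n x => [|n IH] x xg; first by apply: Eneg.
  apply/eqP; rewrite -subr_eq0; apply/eqP.
  apply: (prol_transitive prol (p := n.+1%:Z - 1)) => //.
    rewrite memvB ?memvZ //.
    by have := graded_lieP gg E0 xg; rewrite add0r.
  move=> y yg; have xy := graded_lieP gg xg yg.
  have {}xy : lie x y \in ggr (n%:Z - 1) by move: xy; rewrite nE.
  rewrite lieBl lieZl.
  have -> : lie (lie (tau D) x) y = lie (tau D) (lie x y) - lie x (lie (tau D) y).
    by rewrite jacobi addrK.
  rewrite IH // (Eneg (-1)) // lieZr -!scalerBl nE.
  rewrite (_ : _ - _ = 0) ?scale0r // intrD; ring.
move=> p x xp; have [p0|p0] := ltP p 0; first exact: Eneg.
case: p p0 xp => // n _ xp.
by have := Epos n.+1 x; rewrite nE => ->.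
Qed.

Lemma g0set_cplx : g0set (L := cplx g) (fun p => cplxv (ggr p)) =
  cplx_set g0.
Proof.
apply/seteqP; split=> A /=; rewrite /g0set /cplx_set /= memv_cplx.
  by move=> /andP[].
by move=> [-> ->].
Qed.

Hypothesis ssg : lie_semisimple g.

Local Notation gC := (fun p => cplxv (ggr p)).
Local Notation bC := (cplx_form b).
Local Notation modC := (submodule (cplx_set g0) (gC (-1))).
Local Notation irrC := (irreducible_module (cplx_set g0)).

Lemma cplx_characteristic_element : exists2 E : cplx g, E \in gC 0 &
  forall p (z : cplx g), z \in gC p -> lie E z = p%:~R *: z.
Proof.
have [E E0 Egr] := characteristic_element.
exists (cplx_in E); first by rewrite memv_cplx E0 mem0v.
move=> p z; rewrite memv_cplx => /andP[z1 z2].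
by rewrite cplx_lie_inl (Egr _ _ z1) (Egr _ _ z2) intr_complex cplx_scaler.
Qed.

Lemma cplx_transport_co (A : cplx g) : A \in gC 0 -> co_on (gC (-1)) bC (lie A).
Proof.
rewrite memv_cplx => /andP[A1 A2].
by apply: (cplx_form_co transport_linl transport_linr); apply: transport_co.
Qed.

Lemma cplx_gr_m1_neq0 : gC (-1) <> 0%VS.
Proof.
move=> g0; apply: gr_m1_neq0; apply/eqP; rewrite -subv0; apply/subvP => x xg.
have : (cplx_in x : cplx g) \in gC (-1) by rewrite memv_cplx xg mem0v.
by rewrite g0 !memv0 => /eqP[->].
Qed.

Lemma cplx_transport_sym : forall z w : cplx g,
  z \in gC (-1) -> w \in gC (-1) -> bC z w = bC w z.
Proof. by apply: cplx_form_sym => x y _ _; apply: transport_sym. Qed.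

Lemma cplx_transport_nd : forall z : cplx g, z \in gC (-1) ->
  (forall w, w \in gC (-1) -> bC z w = 0) -> z = 0.
Proof. exact: (cplx_form_nd transport_linr transport_nd). Qed.

Lemma cplx_prolongation_simple : lie_simple (cplx g).
Proof.
have [E E0 Egr] := cplx_characteristic_element.
apply: (conformal_simple (cplx_graded gg) (cplx_transitive (prol_transitive prol))
  (cplx_semisimple ssg) E0 Egr (cplx_form_linl transport_linl)
  (cplx_form_linr transport_linr) cplx_transport_sym cplx_transport_nd
  cplx_transport_co).
have [x [y [xg yg xy]]] := gr_m1_nonabelian.
exists (cplx_in x), (cplx_in y); rewrite !memv_cplx xg yg mem0v; split=> //.
by rewrite cplx_lie_inl => -[].
Qed.

Lemma cplxv_ideal (I : {vspace g}) : lie_ideal I -> lie_ideal (cplxv I).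
Proof.
move=> idI z w; rewrite !memv_cplx cplx_lieE => /andP[w1 w2] /=.
by rewrite memvB ?memvD ?idI.
Qed.

Lemma cplxv0 (I : {vspace g}) : cplxv I = 0%VS -> I = 0%VS.
Proof.
move=> I0; apply/eqP; rewrite -subv0; apply/subvP => x xI.
have : (cplx_in x : cplx g) \in cplxv I by rewrite memv_cplx xI mem0v.
by rewrite I0 !memv0 => /eqP[->].
Qed.

Lemma cplxv_inj (I J : {vspace g}) : cplxv I = cplxv J -> I = J.
Proof.
move=> e; apply/vspaceP => x.
have : ((cplx_in x : cplx g) \in cplxv I) = (cplx_in x \in cplxv J) by rewrite e.
by rewrite !memv_cplx !mem0v !andbT.
Qed.

Lemma prolongation_simple : lie_simple g.
Proof.
have [_ sim] := cplx_prolongation_simple; split.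
  by have [x [y [_ _ xy]]] := gr_m1_nonabelian; exists x, y.
move=> I /cplxv_ideal/sim[/cplxv0->|full]; [by left | right].
apply/vspaceP => x; have : (cplx_in x : cplx g) \in cplxv I by rewrite full memvf.
by rewrite memv_cplx memvf => /andP[].
Qed.

(** The conclusion of [conformal_decomposition] and [submodule_classification] when
the complexified module is reducible. *)
Definition isotropic_splitting (W1 W2 : {vspace cplx g}) :=
  [/\ modC W1 /\ modC W2, irrC W1 /\ irrC W2,
      gC (-1) = (W1 + W2)%VS /\ (W1 :&: W2 = 0)%VS,
      totally_isotropic bC W1 /\ totally_isotropic bC W2 &
      forall S, modC S -> [\/ S = 0%VS, S = W1, S = W2 | S = gC (-1)]].

Lemma isotropic_splittingC W1 W2 :
  isotropic_splitting W1 W2 -> isotropic_splitting W2 W1.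
Proof.
move=> [[m1 m2] [i1 i2] [eW W0] [t1 t2] cl].
split; [exact: conj m2 m1 | exact: conj i2 i1 | by rewrite addvC capvC |
  exact: conj t2 t1 |].
move=> S /cl[e|e|e|e]; [exact: Or41 | exact: Or43 | exact: Or42 | exact: Or44].
Qed.

Lemma cplx_decomposition : ~ irrC (gC (-1)) ->
  exists W1 W2, isotropic_splitting W1 W2.
Proof.
rewrite /isotropic_splitting -g0set_cplx => red.
have [E E0 Egr] := cplx_characteristic_element.
have [//|] := conformal_decomposition (cplx_graded gg)
  (cplx_semisimple ssg) E0 Egr (cplx_form_linl transport_linl)
  (cplx_form_linr transport_linr) cplx_transport_sym cplx_transport_nd
  cplx_transport_co cplx_gr_m1_neq0.
move=> [U [W [z [c [d [[Um Wm] [Ui Wi] [gUW UW0] [Uiso Wiso] [z0 cd zu zw]]]]]]].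
exists U, W; split; [exact: conj Um Wm | exact: conj Ui Wi | exact: conj gUW UW0 |
  exact: conj Uiso Wiso |].
move=> S; exact: (submodule_classification Ui Wi gUW z0 cd zu zw Um Wm).
Qed.

Lemma real_submodule_cplx (S : {vspace g}) :
  submodule g0 (ggr (-1)) S ->
  modC (cplxv S).
Proof.
move=> [sS SA]; split.
  apply/subvP => z; rewrite !memv_cplx => /andP[z1 z2].
  by rewrite !(subvP sS).
move=> A z [A1 A2]; rewrite !memv_cplx cplx_lieE /= => /andP[z1 z2].
by rewrite memvB ?memvD ?SA.
Qed.

Lemma splitting_contragredient W1 W2 : isotropic_splitting W1 W2 ->
  contragredient (cplx_set hg0) W1 W2.
Proof.
move=> [[[_ m1] [_ m2]] _ [eW _] [t1 t2] _].
apply: (contragredient_of_isotropic (cplx_form_linl transport_linl)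
  (cplx_form_linr transport_linr) (W := gC (-1)) _ _ _ cplx_transport_sym
  cplx_transport_nd eW t1 t2).
- by move=> A x [[A1 _] [A2 _]]; apply: m1; split.
- by move=> A x [[A1 _] [A2 _]]; apply: m2; split.
move=> A [[_ A1] [_ A2]].
exact: (cplx_form_so transport_linl transport_linr A1 A2).
Qed.

Lemma conj_submodule W : modC W -> exists2 W', modC W' &
  forall z : cplx g, z \in W' <-> ((z.1, - z.2) : cplx g) \in W.
Proof.
move=> [sW WA].
have [W' W'P] : exists W' : {vspace cplx g}, forall z : cplx g,
    z \in W' <-> ((z.1, - z.2) : cplx g) \in W.
  apply: vspace_of_pred => [|[a c] z w zW wW]; first by rewrite /= oppr0 mem0v.
  have := memvD (memvZ (a -i* c)%C zW) wW; congr (_ \in W).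
  rewrite !cplx_scaleE !cplx_addE /=; congr pair.
    by rewrite scaleNr scalerN opprK.
  by rewrite scaleNr scalerN !opprD.
exists W' => //; split.
  apply/subvP => z /W'P/(subvP sW); rewrite !memv_cplx /= => /andP[-> z2].
  by rewrite -memvN.
move=> A z [A1 A2] /W'P zW; apply/W'P.
have : lie ((A.1, - A.2) : cplx g) ((z.1, - z.2) : cplx g) \in W.
  by apply: WA => //; split=> //=; rewrite memvN.
congr (_ \in W); rewrite !cplx_lieE /=; congr pair.
  by rewrite lieNl lieNr opprK.
by rewrite lieNl lieNr opprD.
Qed.

(** The conjugate of W2 is one of the four submodules. Since the complexification of
S is its own conjugate and meets W2 trivially, only W2 is possible; and a
conjugation-stable subspace is the complexification of its real points. *)
Lemma conjugate_summand_real (S : {vspace g}) W2 :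
    isotropic_splitting (cplxv S) W2 -> exists T, W2 = cplxv T.
Proof.
move=> [[[sW1 _] m2] [[W10 _] [W20 _]] [eW W0] _ cl].
have [W' m' W'P] := conj_submodule m2.
have conjK (z : cplx g) : ((z.1, - - z.2) : cplx g) = z by rewrite opprK; case: z.
have W2W' (z : cplx g) : z \in W2 -> ((z.1, - z.2) : cplx g) \in W'.
  by move=> zW; apply/W'P; rewrite /= conjK.
have conjS (U : {vspace g}) (z : cplx g) :
    z \in cplxv U -> ((z.1, - z.2) : cplx g) \in cplxv U.
  by rewrite !memv_cplx /= memvN.
have eW' : W' = W2.
  have [e|e|//|e] := cl W' m'; exfalso.
  - apply: W20; apply/eqP; rewrite -subv0; apply/subvP => z /W2W'.
    rewrite e !memv0 => /eqP[z1 /eqP]; rewrite oppr_eq0 => /eqP z2.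
    by case: (z) z1 z2 => a c /= -> ->.
  - apply: W20; apply/eqP; rewrite -subv0 -W0; apply/subvP => z zW.
    rewrite memv_cap zW andbT -[z]conjK; apply: (conjS S ((z.1, - z.2) : cplx g)).
    by rewrite -e W2W'.
  apply: W10; apply/eqP; rewrite -subv0 -W0; apply/subvP => z zW.
  rewrite memv_cap zW /= -[z]conjK; apply/(W'P ((z.1, - z.2) : cplx g)).
  by rewrite e; apply/conjS/(subvP sW1).
have [T TP] : exists T : {vspace g}, forall x, x \in T <-> (cplx_in x : cplx g) \in W2.
  apply: vspace_of_pred => [|a x y xW yW]; first exact: mem0v.
  have := memvD (memvZ (a%:C)%C xW) yW.
  by rewrite cplx_scaler cplx_addE /= scaler0 addr0.
exists T; apply/vspaceP => z; rewrite memv_cplx; apply/idP/andP.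
  move=> zW; have zc : ((z.1, - z.2) : cplx g) \in W2 by rewrite -eW' W2W'.
  have half x : (2^-1 : R) *: (x + x) = x :> g.
    by rewrite -mulr2n -scaler_nat scalerA mulVf ?scale1r // pnatr_eq0.
  have z1 : (cplx_in z.1 : cplx g) \in W2.
    have := memvZ ((2^-1 : R)%:C)%C (memvD zW zc).
    by rewrite cplx_scaler cplx_addE /= subrr scaler0 half.
  split; apply/TP => //.
  have := memvZ (- 'i)%C (memvB zW z1); congr (_ \in W2).
  rewrite scaleNr cplx_scalei cplx_oppE cplx_addE /= /cplx_in subrr subr0.
  by rewrite opprK oppr0.
move=> [/TP z1 /TP z2]; have := memvD z1 (memvZ ('i)%C z2).
by rewrite cplx_scalei cplx_addE /= /cplx_in oppr0 addr0 add0r; case: (z).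
Qed.

Lemma real_isotropic_splitting (S : {vspace g}) W2 :
    submodule g0 (ggr (-1)) S -> isotropic_splitting (cplxv S) W2 ->
  exists T : {vspace g},
    [/\ submodule g0 (ggr (-1)) S /\ submodule g0 (ggr (-1)) T,
        ggr (-1) = (S + T)%VS /\ directv (S + T),
        totally_isotropic b S /\ totally_isotropic b T,
        contragredient hg0 S T &
        irrC (cplxv S) /\ irrC (cplxv T)].
Proof.
move=> mS spl; have [T eT] := conjugate_summand_real spl; rewrite eT in spl.
have [[_ [sT TA]] irr [eW W0] [t1 t2] _] := spl; exists T.
have inP (U : {vspace g}) x : ((cplx_in x : cplx g) \in cplxv U) = (x \in U).
  by rewrite memv_cplx mem0v andbT.
have mT : submodule g0 (ggr (-1)) T.
  split; first by apply/subvP => x; rewrite -!inP; apply: (subvP sT).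
  move=> A x A0 xT.
  have AC : cplx_set g0 (cplx_in A) by split=> //=; apply: mem0v.
  have xC : (cplx_in x : cplx g) \in cplxv T by rewrite inP.
  by have := TA _ _ AC xC; rewrite cplx_lie_inl /= lie0r inP.
have eST : ggr (-1) = (S + T)%VS.
  apply/eqP; rewrite eqEsubv subv_add mS.1 mT.1 !andbT; apply/subvP => x.
  rewrite -inP eW => /memv_addP[u uS [w wT e]].
  have -> : x = u.1 + w.1 by have := congr1 fst e.
  by move: uS wT; rewrite !memv_cplx => /andP[u1 _] /andP[w1 _]; rewrite memv_add.
have iso (U : {vspace g}) : totally_isotropic bC (cplxv U) -> totally_isotropic b U.
  move=> tU x y; rewrite -!inP => xU yU; have := tU _ _ xU yU.
  rewrite /cplx_form /= => -[+ _].
  have b0 t : b 0 t = 0 by apply: (form0l transport_linl).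
  by rewrite b0 subr0.
split.
- exact: conj mS mT.
- split; first exact: eST.
  apply/directv_addP/eqP; rewrite -subv0; apply/subvP => x /memv_capP[xS xT].
  have : (cplx_in x : cplx g) \in (cplxv S :&: cplxv T)%VS by rewrite memv_cap !inP xS.
  by rewrite W0 !memv0 => /eqP[->].
- exact: conj (iso S t1) (iso T t2).
- apply: (contragredient_of_isotropic transport_linl transport_linr (W := ggr (-1))
    _ _ _ _ transport_nd eST (iso S t1) (iso T t2)).
  + by move=> A x [A0 _]; apply: mS.2.
  + by move=> A x [A0 _]; apply: mT.2.
  + by move=> A [].
  by move=> x y _ _; apply: transport_sym.
exact: irr.
Qed.

Lemma reducible_real_summand : ~ irreducible_module g0 (ggr (-1)) ->
  exists S W, submodule g0 (ggr (-1)) S /\ isotropic_splitting (cplxv S) W.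
Proof.
move=> red; have [S [mS S0 Sg]] : exists S : {vspace g},
    [/\ submodule g0 (ggr (-1)) S, S <> 0%VS & S <> ggr (-1)].
  apply: contrapT => nS; apply: red; split; first exact: gr_m1_neq0.
  move=> S mS; apply: contrapT => /not_orP[S0 Sg]; apply: nS.
  by exists S.
have mSC := real_submodule_cplx mS.
have [|W1 [W2 spl]] := cplx_decomposition.
  by move=> [_ /(_ _ mSC)[/cplxv0|/cplxv_inj]].
have [_ _ _ _ /(_ _ mSC)[/cplxv0//|e|e|/cplxv_inj//]] := spl.
  by exists S, W2; rewrite e.
by exists S, W1; rewrite e; split=> //; apply: isotropic_splittingC.
Qed.

End Prolongation.

Theorem proposition5p1 (R : realType)
    (m : lieVectType R) (mgr : int -> {vspace m})
    (B : {biscalar (subvs_of (mgr (-1)))})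
    (g : lieVectType R) (ggr : int -> {vspace g})
    (iota : 'Hom(m, g)) (tau : 'Hom('End(m), g)) :
  conformal_fgla B ->
  is_prolongation B (fun p => ggr p) iota tau ->
  lie_semisimple g ->
  let b := transport_form B iota in
  let g0 : set g := [set A | A \in ggr 0]%classic in
  let hg0 : set g :=
    [set A | A \in ggr 0 /\ so_on (ggr (-1)) b (lie A)]%classic in
  [/\ irreducible_module g0 (ggr (-1)) ->
      ~ irreducible_module (cplx_set g0) (cplxv (ggr (-1))) ->
      exists W1 W2 : {vspace cplx g},
        [/\ submodule (cplx_set g0) (cplxv (ggr (-1))) W1,
            submodule (cplx_set g0) (cplxv (ggr (-1))) W2,
            cplxv (ggr (-1)) = (W1 + W2)%VS /\ directv (W1 + W2),
            totally_isotropic (cplx_form b) W1 /\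
            totally_isotropic (cplx_form b) W2
          & contragredient (cplx_set hg0) W1 W2],
      ~ irreducible_module g0 (ggr (-1)) ->
      exists W1 W2 : {vspace g},
        [/\ submodule g0 (ggr (-1)) W1 /\ submodule g0 (ggr (-1)) W2,
            ggr (-1) = (W1 + W2)%VS /\ directv (W1 + W2),
            totally_isotropic b W1 /\ totally_isotropic b W2,
            contragredient hg0 W1 W2
          & irreducible_module (cplx_set g0) (cplxv W1) /\
            irreducible_module (cplx_set g0) (cplxv W2)]
    & simple_gla ggr /\ simple_gla (fun p => cplxv (ggr p))].
Proof.
move=> cfm prol ssg b g0 hg0; split.
- move=> _ red; have [W1 [W2 spl]] := cplx_decomposition cfm prol ssg red.
  have [[m1 m2] _ [eW W0] [t1 t2] _] := spl; exists W1, W2; split.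
  + exact: m1.
  + exact: m2.
  + by split; [exact: eW | apply/directv_addP].
  + exact: conj t1 t2.
  exact: (splitting_contragredient cfm prol spl).
- move=> red; have [S [W [mS spl]]] := reducible_real_summand cfm prol ssg red.
  by have [T ST] := real_isotropic_splitting cfm prol mS spl; exists S, T.
split; split.
- exact: prol_graded prol.
- exact: (prolongation_simple cfm prol ssg).
- exact: (cplx_graded (prol_graded prol)).
exact: (cplx_prolongation_simple cfm prol ssg).
Qed.
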